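(* Fix $\alpha\in(0,1)$. For each $n$ let $X_1,\dots,X_n$ be i.i.d. from a distribution $P$ on $\mathbb{R}^d$, where $d=d_n$ and $P=P_n$ may depend on $n$, and let $m_1=m_1(n)$, $m_2=n-m_1$ be positive integers. Suppose that $P=N(0,\Sigma)$; that there exist constants $\lambda_\ast,\lambda^\ast>0$ such that the eigenvalues of $\Sigma$ satisfy $\lambda_\ast\le\lambda_1(\Sigma)\le\dots\le\lambda_d(\Sigma)\le\lambda^\ast$; that $d/n\to\tau\in(0,\infty)$; that $m_1/n\to\kappa\in(0,1)$; and that $\|\Sigma-I\|_F=O(\sqrt{d/n})$. Then, as $n\to\infty$, $$\mathbb{E}_P[\phi_{\mathrm{cov}}]=\Phi\left(z_\alpha+\frac{n\sqrt{\kappa(1-\kappa)}\,\|\Sigma-I\|_F^2}{\sqrt2\,\mathrm{tr}(\Sigma^2)}\right)+o(1).$$ Therefore the power is asymptotically maximized when $m_1/n\to\kappa=1/2$.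
   Context: $\Phi$ is the cumulative distribution function of $N(0,1)$, $z_\beta$ its $\beta$-quantile, and $\|\cdot\|_F$ the Frobenius norm. The constants $\lambda_\ast,\lambda^\ast,\tau,\kappa$ do not depend on $n$. Let $$f_{\mathrm{cov}}(x)=\frac1{m_2}\sum_{j=m_1+1}^{n}\mathrm{tr}\bigl\{(xx^\top-I)(X_jX_j^\top-I)\bigr\},\qquad \overline f_{\mathrm{cov}}=\frac1{m_1}\sum_{i=1}^{m_1}f_{\mathrm{cov}}(X_i),$$ $$T_{\mathrm{cov}}=\frac{\sqrt{m_1}\,\overline f_{\mathrm{cov}}}{\sqrt{m_1^{-1}\sum_{i=1}^{m_1}\{f_{\mathrm{cov}}(X_i)-\overline f_{\mathrm{cov}}\}^2}},$$ and $\phi_{\mathrm{cov}}=\mathbf 1(T_{\mathrm{cov}}>z_{1-\alpha})$. *)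

(* Defs.v *)
From HB Require Import structures.
From mathcomp Require Import all_boot all_order all_algebra.
From mathcomp Require Import all_classical all_reals all_analysis.

Set Implicit Arguments.
Unset Strict Implicit.
Unset Printing Implicit Defensive.

Import Order.TTheory GRing.Theory Num.Theory.
Import numFieldNormedType.Exports.

Local Open Scope classical_set_scope.
Local Open Scope ring_scope.

(* The vectors of R^d, as columns, with their Borel sigma-algebra. *)
Definition borel_cV (R : realType) (d : nat) :=
  g_sigma_algebraType (@open 'cV[R]_d).

Definition frobenius_norm (R : realType) (d : nat) (A : 'M[R]_d) : R :=
  Num.sqrt (\sum_(i < d) \sum_(j < d) A i j ^+ 2).

Definition normal_cdf (R : realType) (x : R) : R :=
  fine (normal_prob 0 1 `]-oo, x]).

Definition normal_quantile (R : realType) (beta : R) : R :=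
  inf [set x : R | beta <= normal_cdf x].

(* The law N(m, v) on R with variance v. The case v = 0 is split off because
   [normal_prob m 0] is a junk value (a uniform law), not the point mass at m. *)
Definition normal_law1 (R : realType) (m v : R) (B : set R) : \bar R :=
  if v == 0 then dirac m B else normal_prob m (Num.sqrt v) B.

(* Q = N(mu, Sigma) on R^d: Sigma is symmetric positive semidefinite and each
   linear form x |-> a^T x has law N(a^T mu, a^T Sigma a) under Q. *)
Definition is_normal_law (R : realType) (d : nat)
    (Q : probability (borel_cV R d) R) (mu : 'cV[R]_d) (Sigma : 'M[R]_d) : Prop :=
  [/\ Sigma^T = Sigma,
      forall a : 'cV[R]_d, 0 <= (a^T *m Sigma *m a) 0 0 &
      forall (a : 'cV[R]_d) (B : set R), measurable B ->
        Q [set x : 'cV[R]_d | B ((a^T *m x) 0 0)] =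
        normal_law1 ((a^T *m mu) 0 0) ((a^T *m Sigma *m a) 0 0) B].

(* Mutual independence of finitely many random elements; subfamilies are
   covered by taking B i = setT. *)
Definition independent_rvs (R : realType) (disp disp' : measure_display)
    (Omega : measurableType disp) (T : measurableType disp')
    (pr : probability Omega R) (n : nat) (X : 'I_n -> {RV pr >-> T}) : Prop :=
  forall B : 'I_n -> set T, (forall i, measurable (B i)) ->
    fine (pr [set w | forall i, B i (X i w)]) =
    \prod_(i < n) fine (pr (X i @^-1` B i)).

Definition iid_from (R : realType) (disp disp' : measure_display)
    (Omega : measurableType disp) (T : measurableType disp')
    (pr : probability Omega R) (n : nat) (X : 'I_n -> {RV pr >-> T})
    (Q : probability T R) : Prop :=
  independent_rvs X /\
  forall (i : 'I_n) (A : set T), measurable A -> distribution pr (X i) A = Q A.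

(* Indices are shifted by one: i < m1 is the first subsample and
   m1 <= j < n the second one, of size n - m1. *)
Definition f_cov (R : realType) (n d m1 : nat) (X : 'I_n -> 'cV[R]_d)
    (x : 'cV[R]_d) : R :=
  (n - m1)%N%:R^-1 *
  \sum_(j < n | (m1 <= j)%N)
    \tr ((x *m x^T - 1%:M) *m (X j *m (X j)^T - 1%:M)).

Definition fbar_cov (R : realType) (n d m1 : nat) (X : 'I_n -> 'cV[R]_d) : R :=
  m1%:R^-1 * \sum_(i < n | (i < m1)%N) f_cov m1 X (X i).

Definition T_cov (R : realType) (n d m1 : nat) (X : 'I_n -> 'cV[R]_d) : R :=
  Num.sqrt m1%:R * fbar_cov m1 X /
  Num.sqrt (m1%:R^-1 *
    \sum_(i < n | (i < m1)%N) (f_cov m1 X (X i) - fbar_cov m1 X) ^+ 2).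

Definition phi_cov (R : realType) (alpha : R) (n d m1 : nat)
    (X : 'I_n -> 'cV[R]_d) : R :=
  (normal_quantile (1 - alpha) < T_cov m1 X)%R%:R.

(* The expectation of phi_cov for the data X with the split (m1, n - m1). *)
Definition power_cov (R : realType) (alpha : R) (disp : measure_display)
    (Omega : measurableType disp) (pr : probability Omega R) (n d m1 : nat)
    (X : 'I_n -> {RV pr >-> borel_cV R d}) : R :=
  fine ('E_pr[fun w => phi_cov alpha m1 (fun i => X i w : 'cV[R]_d)]).

(* Split sizes with m1, n - m1 >= 1 (possible only for n >= 2) and
   m1 / n --> kappa. *)
Definition split_ratio (R : realType) (m1 : nat -> nat) (kappa : R) : Prop :=
  (forall n, (1 < n)%N -> (0 < m1 n < n)%N) /\
  (m1 n)%:R / n%:R @[n --> \oo] --> kappa.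

(* Main.v *)
Require Import Defs.
From HB Require Import structures.
From mathcomp Require Import all_boot all_order all_algebra.
From mathcomp Require Import all_classical all_reals all_analysis.
From mathcomp Require Import measurable_realfun.
From mathcomp Require Import spectral sesquilinear.
From mathcomp Require complex.
From mathcomp Require Import ring lra.

(** The spectral theorem gives Sigma = L L^T with L^T L = diag g, where g lists
    the eigenvalues of Sigma; then X_i = L z_i with z_i standard Gaussian
    ([whitening], [std_gauss_white]).  In these coordinates the statistic of one
    observation is a centred quadratic form plus a shift,
      f_cov (X_i) = sum_ab W_ab (z_ia z_ib - delta_ab) + mu      ([f_covE]),
    where the weights W and the shift mu depend on the second sample only.
    Given the second sample, the first m1 quadratic forms are thus independent
    and centred, with variance 2 |W|_F^2, and T_cov is a function of their sum,
    of the sum of their squares and of mu ([T_covE]).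

    Write s = tr (Sigma^2) = sum_a g_a^2 and
    Delta = |Sigma - I|_F^2 = sum_a (g_a - 1)^2, which is bounded.  Two
    quantities of the second sample become deterministic as s grows:
    - rho = m2 |W|_F^2 / s^2, the conditional variance divided by 2 s^2 / m2, is
      close to 1 ([Ex_rho_near1]); W is, up to a diagonal matrix of bounded
      norm, a centred average of m2 independent matrices, and expanding its
      squared norm leaves the squares of the single terms, whose mean is close
      to 1, and cross terms, which are small;
    - sqrt m1 mu, on the scale of the standard deviation, is close to
      sqrt (m1 m2) Delta / (sqrt 2 s) ([Ex_drift]).
    The normalised quadratic forms are martingale differences whose conditional
    variances add up to rho and whose third moments are O (m1^(-3/2)), because
    fourth moments of Gaussian quadratic forms are controlled by their
    variances ([Ex_Qf4]).  The central limit theorem [martingale_clt], proved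
    by replacing the summands one by one by Gaussian variables and smoothing the
    indicator of a half-line by the normal distribution function itself, applies
    to their sum; [slutsky] passes from the sum to the studentised statistic.
    The result is
      P (T_cov > z) = Phi (sqrt (m1 m2) Delta / (sqrt 2 s) - z) + o (1).

    The second moments of these deviations are at most constants divided by s;
    the constants depend only on the eigenvalue bounds, on the bound for Delta
    and on the ratios of n, s and m1.  Moreover
    lambda_lo^2 d <= s <= lambda_hi^2 d.  Since d grows like n, s tends to
    infinity; replacing m1 / n by its limit kappa then costs o (1) because Phi is
    Lipschitz ([power_limit]).  The second claim follows because
    kappa (1 - kappa) is largest at kappa = 1/2 and Phi is increasing.

    A multivariate normal law is given here through its linear forms, so
    Gaussian moments come from Stein's identity, obtained by polarising the
    moments of the linear forms ([stein_prodl], [stein]). *)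

Set Implicit Arguments.
Unset Strict Implicit.
Unset Printing Implicit Defensive.

Import Order.TTheory GRing.Theory Num.Theory.
Import numFieldNormedType.Exports.

Local Open Scope classical_set_scope.
Local Open Scope ring_scope.

(** * Random variables with all moments *)

Section moments.
Context d (T : measurableType d) (R : realType) (P : probability T R).
Implicit Types f g : T -> R.

Definition Ex f : R := \int[P]_x f x.

(** Closed under sums and products, so that every polynomial in Gaussian
    variables belongs to it and integrability needs no separate argument. *)
Definition mom f : Prop := measurable_fun setT f /\
  forall k : nat, P.-integrable setT (EFin \o (fun x => `|f x| ^+ k)).

Definition intg f := P.-integrable setT (EFin \o f).

Lemma mom_meas f : mom f -> measurable_fun setT f.
Proof. by case. Qed.

Lemma intg_le f g : measurable_fun setT f -> (forall x, `|f x| <= g x) ->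
  intg g -> intg f.
Proof.
move=> mf fg ig; apply: (le_integrable _ _ _ ig) => //.
  exact/measurable_EFinP.
move=> x _ /=; rewrite lee_fin (le_trans (fg x))// ler_norm//.
Qed.

Lemma mom_intg f : mom f -> intg f.
Proof.
move=> [mf h]; apply: (@intg_le _ (fun x => `|f x| ^+ 1)) => //.
exact: h.
Qed.

Lemma mom_bounded f M : measurable_fun setT f -> (forall x, `|f x| <= M) -> mom f.
Proof.
move=> mf fM; split=> // k.
apply: (@intg_le _ (fun=> M ^+ k)).
- by apply: measurable_funX; exact: measurableT_comp.
- by move=> x; rewrite ger0_norm ?exprn_ge0// lerXn2r// ?nnegrE// (le_trans _ (fM x)).
- exact: finite_measure_integrable_cst.
Qed.

Lemma mom_cst c : mom (fun=> c).
Proof. by apply: (@mom_bounded _ `|c|). Qed.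

Lemma intgD f g : intg f -> intg g -> intg (fun x => f x + g x).
Proof. by move=> hf hg; exact: (integrableD _ hf hg). Qed.

Lemma intgZ f c : intg f -> intg (fun x => c * f x).
Proof. by move=> hf; exact: (integrableZl _ _ hf). Qed.

Lemma intgB f g : intg f -> intg g -> intg (fun x => f x - g x).
Proof. by move=> hf hg; exact: (integrableB _ hf hg). Qed.

Lemma momM f g : mom f -> mom g -> mom (fun x => f x * g x).
Proof.
move=> [mf hf] [mg hg]; split; first exact: measurable_funM.
move=> k; apply: (@intg_le _ (fun x => `|f x| ^+ (k + k) + `|g x| ^+ (k + k))).
- apply: measurable_funX; apply: measurableT_comp => //; exact: measurable_funM.
- move=> x; rewrite ger0_norm ?exprn_ge0// normrM exprMn !exprD.
  move: (`|f x| ^+ k) (`|g x| ^+ k) => a b; nra.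
- by apply: intgD; [exact: hf|exact: hg].
Qed.

Lemma momD f g : mom f -> mom g -> mom (fun x => f x + g x).
Proof.
move=> [mf hf] [mg hg]; split; first exact: measurable_funD.
move=> k; apply: (@intg_le _ (fun x => 2 ^+ k * (`|f x| ^+ k + `|g x| ^+ k))).
- apply: measurable_funX; apply: measurableT_comp => //; exact: measurable_funD.
- move=> x; rewrite ger0_norm ?exprn_ge0//.
  pose m := Num.max `|f x| `|g x|.
  have m0 : 0 <= m by rewrite le_max normr_ge0.
  have fm : `|f x| <= m by rewrite le_max lexx.
  have gm : `|g x| <= m by rewrite le_max lexx orbT.
  apply: (@le_trans _ _ (2 ^+ k * m ^+ k)).
    rewrite -exprMn lerXn2r ?nnegrE// ?mulr_ge0//.
    by rewrite (le_trans (ler_normD _ _))// mulr2n mulrDl mul1r lerD.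
  apply: ler_wpM2l; first exact: exprn_ge0.
  rewrite /m; case: (leP `|f x| `|g x|) => _; first by rewrite lerDr exprn_ge0.
  by rewrite lerDl exprn_ge0.
- by apply/intgZ/intgD; [exact: hf|exact: hg].
Qed.

Lemma momN f : mom f -> mom (fun x => - f x).
Proof.
move=> [mf hf]; split; first exact: measurableT_comp.
by move=> k; apply: eq_integrable (hf k) => // x _ /=; rewrite normrN.
Qed.

Lemma momB f g : mom f -> mom g -> mom (fun x => f x - g x).
Proof. by move=> hf hg; apply: momD => //; exact: momN. Qed.

Lemma mom_abs f : mom f -> mom (fun x => `|f x|).
Proof.
move=> [mf hf]; split; first exact: measurableT_comp.
by move=> k; apply: eq_integrable (hf k) => // x _ /=; rewrite normr_id.
Qed.

Lemma momX f k : mom f -> mom (fun x => f x ^+ k).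
Proof.
move=> hf; elim: k => [|k ih]; first exact: mom_cst.
by under eq_fun do rewrite exprS; exact: momM.
Qed.

Lemma mom_sum (I : Type) (r : seq I) (p : pred I) (F : I -> T -> R) :
  (forall i, p i -> mom (F i)) -> mom (fun x => \sum_(i <- r | p i) F i x).
Proof.
move=> hF; elim: r => [|i r ih].
  by rewrite (_ : (fun _ => _) = fun=> 0); [exact: mom_cst|apply/funext => x; rewrite big_nil].
case pi : (p i).
  rewrite (_ : (fun _ => _) = fun x => F i x + \sum_(j <- r | p j) F j x).
    by apply: momD => //; exact: hF.
  by apply/funext => x; rewrite big_cons pi.
by rewrite (_ : (fun _ => _) = fun x => \sum_(j <- r | p j) F j x)//;
  apply/funext => x; rewrite big_cons pi.
Qed.

Lemma eq_Ex f g : f =1 g -> Ex f = Ex g.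
Proof. by move=> /funext ->. Qed.

Lemma Ex_cst c : Ex (fun=> c) = c.
Proof.
rewrite /Ex (@Rintegral_cst _ _ _ P setT measurableT).
rewrite [X in fine X](_ : _ = 1%E); last exact: probability_setT.
by rewrite mulr1.
Qed.

Lemma ExD f g : intg f -> intg g -> Ex (fun x => f x + g x) = Ex f + Ex g.
Proof. by move=> hf hg; rewrite /Ex RintegralD. Qed.

Lemma ExB f g : intg f -> intg g -> Ex (fun x => f x - g x) = Ex f - Ex g.
Proof. by move=> hf hg; rewrite /Ex RintegralB. Qed.

Lemma ExZ f c : intg f -> Ex (fun x => c * f x) = c * Ex f.
Proof. by move=> hf; rewrite /Ex RintegralZl. Qed.

Lemma Ex_sum (I : Type) (r : seq I) (p : pred I) (F : I -> T -> R) :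
  (forall i, p i -> mom (F i)) ->
  Ex (fun x => \sum_(i <- r | p i) F i x) = \sum_(i <- r | p i) Ex (F i).
Proof.
move=> hF; elim: r => [|i r ih].
  by rewrite big_nil -[RHS]Ex_cst; apply: eq_Ex => x; rewrite big_nil.
rewrite big_cons; case pi : (p i).
  rewrite -ih -ExD; [|exact/mom_intg/hF|exact/mom_intg/mom_sum].
  by apply: eq_Ex => x; rewrite big_cons pi.
by rewrite -ih; apply: eq_Ex => x; rewrite big_cons pi.
Qed.

Lemma le_Ex f g : intg f -> intg g -> (forall x, f x <= g x) -> Ex f <= Ex g.
Proof. by move=> hf hg fg; apply: le_Rintegral. Qed.

Lemma Ex_ge0 f : (forall x, 0 <= f x) -> 0 <= Ex f.
Proof. by move=> f0; apply: Rintegral_ge0. Qed.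

Lemma Ex_abs f : intg f -> `|Ex f| <= Ex (fun x => `|f x|).
Proof. by move=> hf; apply: le_normr_Rintegral. Qed.

(** The variance of |f| is nonnegative. *)
Lemma Ex_abs2 f : mom f -> Ex (fun x => `|f x|) ^+ 2 <= Ex (fun x => f x ^+ 2).
Proof.
move=> hf; have hF := mom_abs hf; set e := Ex (fun x => `|f x|).
have : 0 <= Ex (fun x => (`|f x| - e) ^+ 2).
  by apply: Ex_ge0 => x; exact: sqr_ge0.
have -> : Ex (fun x => (`|f x| - e) ^+ 2) =
    Ex (fun x => f x ^+ 2 + (e ^+ 2 - 2 * e * `|f x|)).
  by apply: eq_Ex => x; rewrite -[f x ^+ 2]real_normK ?num_real//; ring.
rewrite ExD; [|exact/mom_intg/momX|]; last first.
  by apply: mom_intg; apply: momB; [exact: mom_cst|apply: momM => //; exact: mom_cst].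
rewrite ExB; [|exact/mom_intg/mom_cst|]; last first.
  by apply: mom_intg; apply: momM => //; exact: mom_cst.
rewrite Ex_cst ExZ; last exact: mom_intg.
by rewrite -/e; move: (Ex _) => y; nra.
Qed.

Lemma mom_indic (A : set T) : measurable A -> mom (\1_A : T -> R).
Proof.
move=> mA; apply: (@mom_bounded _ 1) => // x.
by rewrite indicE; case: (_ \in _); rewrite ?normr0 ?normr1.
Qed.

Lemma Ex_indic (A : set T) : measurable A -> Ex (\1_A : T -> R) = fine (P A).
Proof. by move=> mA; rewrite /Ex /Rintegral integral_indic// setIT. Qed.

(** Markov's inequality for the square of f. *)
Lemma chebyshev2 f (e : R) : 0 < e -> mom f ->
  fine (P [set x | e < `|f x|]) <= Ex (fun x => f x ^+ 2) / e ^+ 2.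
Proof.
move=> e0 hf.
have mA : measurable [set x | e < `|f x|].
  have mf : measurable_fun setT (fun x => e < `|f x|).
    by apply: measurable_fun_ltr => //; apply: measurableT_comp => //; case: hf.
  by have := mf measurableT [set true]; rewrite setTI preimage_true; apply.
rewrite -Ex_indic// mulrC -ExZ; last exact/mom_intg/momX.
apply: le_Ex; [exact/mom_intg/mom_indic| |].
  by apply: intgZ; exact/mom_intg/momX.
move=> x; rewrite indicE; have [xA|xA] := pselect ([set x | e < `|f x|] x).
  rewrite mem_set// -ler_pdivrMl ?invr_gt0 ?exprn_gt0// invrK mulr1.
  by rewrite -[f x ^+ 2]real_normK ?num_real// lerXn2r ?nnegrE// ltW.
by rewrite memNset// mulr_ge0 ?sqr_ge0// invr_ge0 sqr_ge0.
Qed.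

End moments.

Ltac mom_tac := repeat first [assumption | apply: mom_cst | apply: momB | apply: momD
  | apply: momM | apply: momX | apply: momN | apply: mom_abs].

(** * Taylor bounds from derivative bounds *)

Section calculus.
Context (R : realType).
Implicit Types f g : R -> R.

(** Differentiation rules for functions written as explicit lambda terms: the
    derivative of a composite expression is then the term built by applying
    them, and a ring or field identity brings it to the wanted form. *)
Lemma dcst (c x : R) : is_derive x 1 (fun=> c) 0.
Proof. exact: is_derive_cst. Qed.

Lemma did (x : R) : is_derive x 1 (fun y : R => y) 1.
Proof. exact: is_derive_id. Qed.

Lemma dM f g (x df dg : R) : is_derive x 1 f df -> is_derive x 1 g dg ->
  is_derive x 1 (fun y => f y * g y) (df * g x + f x * dg).
Proof.
move=> hf hg; have h := is_deriveM hf hg; apply: (is_derive_eq h).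
by rewrite /GRing.scale/=; ring.
Qed.

Lemma dD f g (x df dg : R) : is_derive x 1 f df -> is_derive x 1 g dg ->
  is_derive x 1 (fun y => f y + g y) (df + dg).
Proof. by move=> hf hg; exact: (is_deriveD hf hg). Qed.

Lemma dN f (x df : R) : is_derive x 1 f df -> is_derive x 1 (fun y => - f y) (- df).
Proof. by move=> hf; exact: (is_deriveN hf). Qed.

Lemma dB f g (x df dg : R) : is_derive x 1 f df -> is_derive x 1 g dg ->
  is_derive x 1 (fun y => f y - g y) (df - dg).
Proof. by move=> hf hg; exact: (is_deriveB hf hg). Qed.

Lemma dX f n (x df : R) : is_derive x 1 f df ->
  is_derive x 1 (fun y => f y ^+ n) (n%:R * f x ^+ n.-1 * df).
Proof.
move=> hf; have h := is_deriveX n hf.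
have -> : (fun y => f y ^+ n) = f ^+ n by apply/funext => y; rewrite exprfctE.
by apply: (is_derive_eq h).
Qed.

Lemma dcomp f g (x df dg : R) : is_derive (g x) 1 f df -> is_derive x 1 g dg ->
  is_derive x 1 (fun y => f (g y)) (df * dg).
Proof. by move=> hf hg; exact: (is_derive1_comp hf hg). Qed.

Lemma dV f (x df : R) : f x != 0 -> is_derive x 1 f df ->
  is_derive x 1 (fun y => (f y)^-1) (- (f x) ^- 2 * df).
Proof. by move=> h hf; exact: is_deriveV. Qed.

Lemma is_derive_cont f (df : R -> R) (a b : R) :
  (forall x : R, a <= x <= b -> is_derive x 1 f (df x)) ->
  {within `[a, b], continuous f}.
Proof.
move=> hf; apply: derivable_within_continuous => x; rewrite in_itv/= => /hf h.
by case: h.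
Qed.

(** Mean value theorem between 0 and s; iterating it gives Taylor bounds with
    constants that are not sharp. *)
Lemma int_bound f (df : R -> R) (C : R) (k : nat) : 0 <= C ->
  (forall x : R, 0 <= x -> is_derive x 1 f (df x)) -> f 0 = 0 ->
  (forall s, 0 <= s -> `|df s| <= C * s ^+ k) ->
  forall s, 0 <= s -> `|f s| <= C * s ^+ k.+1.
Proof.
move=> C0 hf f0 hdf s s0.
have [||c] := @MVT_segment R f df 0 s s0.
- by move=> x; rewrite in_itv/= => /andP[x0 _]; apply: hf; exact: ltW.
- by apply: (@is_derive_cont _ df) => x /andP[x0 _]; exact: hf.
rewrite in_itv/= => /andP[c0 cs]; rewrite f0 !subr0 => ->.
rewrite normrM (ger0_norm s0) exprSr mulrA ler_wpM2r//.
rewrite (le_trans (hdf c c0))// ler_wpM2l// lerXn2r// nnegrE//.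
Qed.

Lemma taylor2 f f1 f2 (C : R) : 0 <= C ->
  (forall x : R, 0 <= x -> is_derive x 1 f (f1 x)) ->
  (forall x : R, 0 <= x -> is_derive x 1 f1 (f2 x)) ->
  (forall x, 0 <= x -> `|f2 x| <= C) ->
  forall s, 0 <= s -> `|f s - f 0 - f1 0 * s| <= C * s ^+ 2.
Proof.
move=> C0 h1 h2 hC.
have b1 : forall s, 0 <= s -> `|f1 s - f1 0| <= C * s ^+ 1.
  apply: (@int_bound (fun s => f1 s - f1 0) f2) => //.
  - move=> x x0; apply: is_derive_eq; first exact: (dB (h2 x x0) (dcst _ _)).
    by rewrite subr0.
  - by rewrite subrr.
  - by move=> s s0; rewrite expr0 mulr1; exact: hC.
apply: (@int_bound (fun s => f s - f 0 - f1 0 * s) (fun s => f1 s - f1 0)) => //.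
- move=> x x0; apply: is_derive_eq.
    exact: (dB (dB (h1 x x0) (dcst _ _)) (dM (dcst _ _) (did _))).
  by rewrite /=; ring.
- by rewrite /=; ring.
Qed.

Lemma taylor3_pos f f1 f2 f3 (C : R) : 0 <= C ->
  (forall x : R, is_derive x 1 f (f1 x)) ->
  (forall x : R, is_derive x 1 f1 (f2 x)) ->
  (forall x : R, is_derive x 1 f2 (f3 x)) ->
  (forall x, `|f3 x| <= C) ->
  forall s, 0 <= s -> `|f s - f 0 - f1 0 * s - f2 0 * s ^+ 2 / 2| <= C * s ^+ 3.
Proof.
move=> C0 h1 h2 h3 hC.
have b1 := @taylor2 f1 f2 f3 C C0 (fun x _ => h2 x) (fun x _ => h3 x) (fun x _ => hC x).
apply: (@int_bound (fun s => f s - f 0 - f1 0 * s - f2 0 * s ^+ 2 / 2)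
          (fun s => f1 s - f1 0 - f2 0 * s)) => //.
- move=> x x0.
  have h := dB (dB (dB (h1 x) (dcst (f 0) x)) (dM (dcst (f1 0) x) (did x)))
      (dM (dM (dcst (f2 0) x) (dX 2 (did x))) (dcst (2^-1) x)).
  apply: (is_derive_eq h).
  by rewrite /=; field.
- by rewrite /=; ring.
Qed.

(** For negative s the one-sided bound is applied to the reflection of f. *)
Lemma taylor3 f f1 f2 f3 (C : R) : 0 <= C ->
  (forall x : R, is_derive x 1 f (f1 x)) ->
  (forall x : R, is_derive x 1 f1 (f2 x)) ->
  (forall x : R, is_derive x 1 f2 (f3 x)) ->
  (forall x, `|f3 x| <= C) ->
  forall y s, `|f (y + s) - f y - f1 y * s - f2 y * s ^+ 2 / 2| <= C * `|s| ^+ 3.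
Proof.
move=> C0 h1 h2 h3 hC y s.
have dsh (g g1 : R -> R) (e : R) : (forall x : R, is_derive x 1 g (g1 x)) ->
    forall x : R, is_derive x 1 (fun u => g (y + e * u)) (e * g1 (y + e * x)).
  move=> hg x.
  have h' := dD (dcst y x) (dM (dcst e x) (did x)).
  have h := @dcomp g (fun u => y + e * u) x _ _ (hg (y + e * x)) h'.
  apply: (is_derive_eq h).
  by rewrite /=; ring.
have dZ (g g1 : R -> R) (c : R) : (forall x : R, is_derive x 1 g (g1 x)) ->
    forall x : R, is_derive x 1 (fun u => c * g u) (c * g1 x).
  move=> hg x; have h := dM (dcst c x) (hg x); apply: (is_derive_eq h).
  by rewrite /=; ring.
have key (e : R) : `|e| = 1 -> forall u, 0 <= u ->
   `|f (y + e * u) - f y - e * f1 y * u - e * (e * f2 y) * u ^+ 2 / 2| <= C * u ^+ 3.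
  move=> e1 u u0.
  have := @taylor3_pos (fun u => f (y + e * u)) (fun u => e * f1 (y + e * u))
    (fun u => e * (e * f2 (y + e * u))) (fun u => e * (e * (e * f3 (y + e * u)))) C C0.
  move=> /(_ (dsh _ _ _ h1)) /(_ (dZ _ _ _ (dsh _ _ _ h2))).
  move=> /(_ (dZ _ _ _ (dZ _ _ _ (dsh _ _ _ h3)))) H.
  have hb (x : R) : `|e * (e * (e * f3 (y + e * x)))| <= C.
    by rewrite !normrM e1 !mul1r.
  by have := H hb u u0; rewrite !mulr0 !addr0.
have [s0|s0] := leP 0 s.
  have := key 1 (normr1 _) s s0; rewrite !mul1r.
  by rewrite (ger0_norm s0).
have e1 : `|-1 : R| = 1 by rewrite normrN1.
have := key (-1) e1 (- s); rewrite oppr_ge0 => /(_ (ltW s0)).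
by rewrite (ltr0_norm s0) !mulN1r !opprK sqrrN mulrNN.
Qed.

End calculus.

(** * The standard normal density and its moments *)

Section stdnormal.
Context (R : realType).
Notation mu := (@lebesgue_measure R).
Notation phi := (@normal_pdf R 0 1).
Notation N := (@normal_prob R 0 1).

Lemma phiE x : phi x = normal_peak 1 * expR (- x ^+ 2 / 2).
Proof. by rewrite normal_pdfE ?oner_eq0// /normal_fun subr0 expr1n. Qed.

Lemma phi_sym x : phi (- x) = phi x.
Proof. by rewrite !phiE sqrrN. Qed.

Lemma phi_gt0 x : 0 < phi x.
Proof. by rewrite phiE mulr_gt0 ?expR_gt0 ?normal_peak_gt0 ?oner_eq0. Qed.

Lemma phi_ge0 x : 0 <= phi x.
Proof. exact/ltW/phi_gt0. Qed.

Lemma is_derive_phi (x : R) : is_derive x 1 phi (- x * phi x).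
Proof.
have h1 := dM (dN (dX 2 (did x))) (dcst (2^-1) x).
have h2 := @dcomp _ expR (fun y => - y ^+ 2 * 2^-1) x _ _ (is_derive_expR _) h1.
have h := dM (dcst (normal_peak 1) x) h2.
have -> : phi = fun y => normal_peak 1 * expR (- y ^+ 2 * 2^-1).
  by apply/funext => y; rewrite phiE.
by apply: (is_derive_eq h); rewrite /=; field.
Qed.

Lemma continuous_phi : continuous phi.
Proof. exact/continuous_normal_pdf/oner_neq0. Qed.

Let sq2 : Num.sqrt 2 != 0 :> R.
Proof. by rewrite gt_eqF// sqrtr_gt0 ltr0n. Qed.

(** exp y >= 1 + y >= y, applied with y = x^2 / (4 j) and raised to the power j. *)
Lemma expR_dom_pow (x : R) j : x ^+ (2 * j) <= (4 * j%:R) ^+ j * expR (x ^+ 2 / 4).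
Proof.
case: j => [|j]; first by rewrite muln0 !expr0 mul1r -[leLHS]addr0 (le_trans _ (expR_ge1Dx _))// lerD2l mulr_ge0 ?sqr_ge0.
have -> : x ^+ 2 / 4 = j.+1%:R * (x ^+ 2 / (4 * j.+1%:R)) by rewrite invfM mulrCA; congr (_ * _); rewrite mulrCA mulfV ?mulr1// pnatr_eq0.
rewrite expRM_natl -exprMn exprM lerXn2r ?nnegrE ?sqr_ge0// ?mulr_ge0 ?expR_ge0//.
rewrite -ler_pdivrMl ?mulr_gt0 ?ltr0n//.
by rewrite mulrC (le_trans _ (expR_ge1Dx _))// lerDr.
Qed.

(** Every polynomial factor is absorbed by passing from variance 1 to variance
    2; the wider density is bounded and integrable, so this single bound gives
    both [phi_pow_bounded] and [integrable_pow_phi]. *)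
Lemma phi_pow_le_wide j : exists2 C : R, 0 <= C &
  forall x, `|x| ^+ j * phi x <= C * normal_pdf 0 (Num.sqrt 2) x.
Proof.
pose p1 : R := normal_peak 1; pose p2 : R := normal_peak (Num.sqrt 2).
have p10 : 0 < p1 by rewrite normal_peak_gt0// oner_eq0.
have p20 : 0 < p2 by rewrite normal_peak_gt0.
pose K : R := 1 + (4 * j%:R) ^+ j.
have K0 : 0 <= K by rewrite /K addr_ge0// exprn_ge0// mulr_ge0.
exists (K * p1 / p2); first by rewrite divr_ge0 ?mulr_ge0// ltW.
move=> x; rewrite phiE normal_pdfE// /normal_fun subr0 sqr_sqrtr//.
rewrite -/p1 -/p2.
have -> : - x ^+ 2 / (2 *+ 2) = - (x ^+ 2 / 4).
  by rewrite mulNr -mulrnA; congr (- (_ / _)).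
set e := expR (- (x ^+ 2 / 4)).
have e0 : 0 < e by exact: expR_gt0.
have -> : expR (- x ^+ 2 / 2) = e * e.
  by rewrite /e -expRD; congr expR; field.
have -> : K * p1 / p2 * (p2 * e) = p1 * e * K by field; rewrite gt_eqF.
have -> : `|x| ^+ j * (p1 * (e * e)) = p1 * e * (`|x| ^+ j * e) by ring.
apply: ler_wpM2l; first by rewrite mulr_ge0 ?ltW.
have xj : `|x| ^+ j <= 1 + x ^+ (2 * j).
  have -> : x ^+ (2 * j) = (`|x| ^+ j) ^+ 2.
    by rewrite exprM -real_normK ?num_real// -!exprM mulnC.
  have := sqr_ge0 (`|x| ^+ j - 1); have := sqr_ge0 (`|x| ^+ j).
  have : 0 <= `|x| ^+ j by exact: exprn_ge0.
  by move: (`|x| ^+ j) => y; nra.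
have ee : e * expR (x ^+ 2 / 4) = 1 by rewrite /e -expRD addNr expR0.
have := expR_dom_pow x j; have e1 : e <= 1.
  by rewrite -expR0 ler_expR oppr_le0 mulr_ge0 ?sqr_ge0.
have E1 : 0 <= (4 * j%:R : R) ^+ j by rewrite exprn_ge0// mulr_ge0.
move=> h.
apply: (@le_trans _ _ ((1 + x ^+ (2 * j)) * e)); first by rewrite ler_wpM2r// ltW.
rewrite mulrDl mul1r lerD//.
apply: (@le_trans _ _ ((4 * j%:R) ^+ j * expR (x ^+ 2 / 4) * e)).
  by rewrite ler_wpM2r// ltW.
by rewrite -mulrA [_ * e]mulrC ee mulr1.
Qed.

Lemma phi_pow_bounded j : exists2 C : R, 0 <= C & forall x, `|x| ^+ j * phi x <= C.
Proof.
have [C C0 h] := phi_pow_le_wide j; exists (C * normal_peak (Num.sqrt 2)).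
  by rewrite mulr_ge0// normal_peak_ge0.
move=> x; rewrite (le_trans (h x))// ler_wpM2l//; exact: normal_pdf_ub.
Qed.

Lemma integrable_pow_phi j : mu.-integrable setT (EFin \o (fun x => `|x| ^+ j * phi x)).
Proof.
have [C C0 h] := phi_pow_le_wide j.
apply: (@le_integrable _ _ _ mu _ measurableT _
  (EFin \o (fun x => C * normal_pdf 0 (Num.sqrt 2) x))).
- apply/measurable_EFinP; apply: measurable_funM; last exact: measurable_normal_pdf.
  by apply: measurable_funX; exact: normr_measurable.
- move=> x _ /=; rewrite lee_fin ger0_norm ?mulr_ge0 ?exprn_ge0 ?phi_ge0//.
  by rewrite (le_trans (h x))// ler_norm.
- exact: (integrableZl _ _ (integrable_normal_pdf _ _)).
Qed.

(** The change of variables for absolutely continuous measures is phrased with a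
    Radon-Nikodym derivative; this identifies it for the normal law. *)
Lemma RN_phi : ae_eq mu setT (Radon_Nikodym_SigmaFinite.f N mu) (EFin \o phi).
Proof.
have dom := @normal_prob_dominates R 0 1.
apply: integral_ae_eq => //=.
- exact: Radon_Nikodym_SigmaFinite.f_integrable.
- by apply/measurable_EFinP; exact: measurable_normal_pdf.
- by move=> A _ mA; rewrite -Radon_Nikodym_SigmaFinite.f_integral.
Qed.

Lemma ge0_integral_N (f : R -> R) : measurable_fun setT f -> (forall x, 0 <= f x) ->
  (\int[N]_x (f x)%:E = \int[mu]_x (f x * phi x)%:E)%E.
Proof.
move=> mf f0.
have dom := @normal_prob_dominates R 0 1.
rewrite -(Radon_Nikodym_SigmaFinite.change_of_variables dom)//; last exact/measurable_EFinP.
apply: ae_eq_integral => //.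
- apply: emeasurable_funM; first exact/measurable_EFinP.
  exact: (measurable_int _ (Radon_Nikodym_SigmaFinite.f_integrable _)).
- by apply/measurable_EFinP; apply: measurable_funM => //; exact: measurable_normal_pdf.
- under [X in ae_eq _ _ _ X]eq_fun do rewrite EFinM.
  exact: (ae_eqe_mul2l _ RN_phi).
Qed.

Lemma mom_id_N : mom N (fun x => x).
Proof.
split; first exact: measurable_id.
move=> k; apply/integrableP; split.
  by apply/measurable_EFinP; apply: measurable_funX; exact: normr_measurable.
under eq_integral => x _ do rewrite /= ger0_norm ?exprn_ge0//.
rewrite ge0_integral_N.
- have /integrableP[_] := integrable_pow_phi k.
  by under eq_integral => x _ do rewrite /= ger0_norm ?mulr_ge0 ?exprn_ge0 ?phi_ge0//.
- by apply: measurable_funX; exact: normr_measurable.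
- by move=> x; rewrite exprn_ge0.
Qed.

End stdnormal.

Section stdnormal2.
Context (R : realType).
Notation mu := (@lebesgue_measure R).
Notation phi := (@normal_pdf R 0 1).
Notation N := (@normal_prob R 0 1).

Lemma Ex_N (f : R -> R) : intg N f -> Ex N f = \int[mu]_x (f x * phi x).
Proof.
move=> hf; rewrite /Ex /Rintegral; congr fine.
have dom := @normal_prob_dominates R 0 1.
have mf := measurable_int _ hf.
rewrite -(Radon_Nikodym_change_of_variables dom)//.
apply: ae_eq_integral => //.
- by apply: emeasurable_funM.
- apply/measurable_EFinP; apply: measurable_funM; first exact/measurable_EFinP.
  exact: measurable_normal_pdf.
- under [X in ae_eq _ _ _ X]eq_fun do rewrite EFinM.
  apply: ae_eqe_mul2l; apply: ae_eq_trans (@RN_phi R).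
  exact/ae_eq_sym/ae_eq_Radon_Nikodym_SigmaFinite.
Qed.

Lemma eq0_le_inv (a C : R) : (forall n : nat, `|a| <= C / n.+1%:R) -> a = 0.
Proof.
move=> h; apply/eqP; rewrite -normr_eq0; apply/negPn/negP => a0.
have pa : 0 < `|a| by rewrite lt_def a0 normr_ge0.
have C0 : 0 < C by have := h 0%N; rewrite divr1; apply: lt_le_trans.
have := h (Num.bound (C / `|a|)).
have hb := archi_boundP (ltW (divr_gt0 C0 pa)).
apply/negP; rewrite -ltNge ltr_pdivrMr// -ltr_pdivrMl// mulrC.
by rewrite (lt_trans hb)// ltr_nat.
Qed.

(** The integrand is the derivative of x^j phi x, which vanishes at both ends.
    The integral over [-b, b] is at most 2 C / b, and so is the rest, because
    |x| times the integrand is integrable. *)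
Lemma Rintegral_stein j : \int[mu]_x ((j%:R * x ^+ j.-1 - x ^+ j.+1) * phi x) = 0.
Proof.
pose f (x : R) : R := (j%:R * x ^+ j.-1 - x ^+ j.+1) * phi x.
rewrite -[LHS]/(\int[mu]_x f x).
have mf : measurable_fun setT f.
  apply: measurable_funM; last exact: measurable_normal_pdf.
  by apply: measurable_funB => //; apply: measurable_funM => //.
have intx i : mu.-integrable setT (EFin \o (fun x : R => x ^+ i * phi x)).
  apply: le_integrable (@integrable_pow_phi R i) => //.
    by apply/measurable_EFinP; apply: measurable_funM => //; exact: measurable_normal_pdf.
  move=> x _ /=; by rewrite lee_fin !normrM !normrX normr_id.
have intf : mu.-integrable setT (EFin \o f).
  have -> : EFin \o f = EFin \o (fun x => j%:R * (x ^+ j.-1 * phi x) - x ^+ j.+1 * phi x).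
    by apply/funext => x; rewrite /f /=; congr EFin; ring.
  exact: (integrableB _ (integrableZl _ _ (intx _)) (intx _)).
pose g x : R := (j%:R * `|x| ^+ j.-1.+1 + `|x| ^+ j.+2) * phi x.
have intg' : mu.-integrable setT (EFin \o g).
  have -> : EFin \o g = EFin \o (fun x => j%:R * (`|x| ^+ j.-1.+1 * phi x) + `|x| ^+ j.+2 * phi x).
    by apply/funext => x; rewrite /g /=; congr EFin; ring.
  exact: (integrableD measurableT (integrableZl measurableT j%:R (@integrable_pow_phi R j.-1.+1)) (@integrable_pow_phi R j.+2)).
have fg x : `|f x| * `|x| <= g x.
  rewrite /f /g normrM (ger0_norm (phi_ge0 x)) mulrAC ler_wpM2r ?phi_ge0//.
  have -> : j%:R * `|x| ^+ j.-1.+1 + `|x| ^+ j.+2 =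
      (j%:R * `|x| ^+ j.-1 + `|x| ^+ j.+1) * `|x|.
    by rewrite mulrDl -mulrA -!exprSr.
  rewrite ler_wpM2r// (le_trans (ler_normB _ _))// normrM !normrX normr_nat//.
have [C1 C10 hC1] := @phi_pow_bounded R j.+1.
set C2 := \int[mu]_x g x.
apply: (@eq0_le_inv _ (2 * C1 + C2)) => n.
have : 0 < n.+1%:R :> R by rewrite ltr0n.
move: (n.+1%:R) => b n0.
pose D : set (measurableTypeR R) := `[- b, b]%classic.
have mD : measurable D by exact: measurable_itv.
pose F x := x ^+ j * phi x.
have dF (x : R) : is_derive x 1 F (f x).
  have h := dM (dX j (did x)) (is_derive_phi x).
  by apply: (is_derive_eq h); rewrite /f /= exprS; ring.
have ID : \int[mu]_(x in D) f x = F b - F (- b).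
  rewrite /Rintegral (@continuous_FTC2 R f F).
  - by rewrite -EFinB.
  - by rewrite gtrN.
  - apply: continuous_subspaceT => x; apply: cvgM; last exact: continuous_phi.
    apply: cvgB; last exact: exprn_continuous.
    by apply: cvgM; [exact: cvg_cst|exact: exprn_continuous].
  - have cF (x : R) : {for x, continuous F}.
      by apply/differentiable_continuous/derivable1_diffP; have [] := dF x.
    split; first by move=> x _; have [] := dF x.
    + by apply: cvg_at_right_filter; exact: cF.
    + by apply: cvg_at_left_filter; exact: cF.
  - by move=> x _; rewrite derive1E; have [_ ->] := dF x.
have Fb (x : R) : `|x| = b -> `|F x| <= C1 / b.
  move=> xn; rewrite ler_pdivlMr// -xn /F normrM normrX (ger0_norm (phi_ge0 x)).
  by rewrite mulrAC -exprSr.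
have split : \int[mu]_x f x = \int[mu]_(x in D) f x + \int[mu]_(x in ~` D) f x.
  rewrite -Rintegral_setU ?setUv//; first exact: measurableC.
  exact/disj_setPCl.
have tail : `|\int[mu]_(x in ~` D) f x| <= C2 / b.
  have mC : measurable (~` D) by exact: measurableC.
  have ic : mu.-integrable (~` D) (EFin \o f).
    by apply: integrableS intf.
  have h := le_normr_Rintegral mC ic; apply: (le_trans h).
  rewrite [leLHS]Rintegral_mkcond /C2 -RintegralZr//.
  apply: le_Rintegral => //.
  - rewrite -restrict_EFin; apply/(integrable_mkcond _ mC); apply: (@integrableS _ _ _ _ setT) => //.
    exact: integrable_norm.
  - exact: (integrableZr _ _ intg').
  - move=> x _; rewrite patchE; case: ifPn => [|_]; last first.
      by rewrite mulr_ge0 ?invr_ge0 ?(ltW n0)// (le_trans _ (fg x))// mulr_ge0.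
    rewrite inE /D /= in_itv/= => /negP; rewrite -ler_norml -ltNge => nx.
    rewrite ler_pdivlMr//; apply: le_trans (fg x).
    by rewrite ler_wpM2l// ltW.
rewrite split ID (le_trans (ler_normD _ _))// mulrDl lerD//.
rewrite (le_trans (ler_normB _ _))// mulr2n mulrDl mul1r mulrDl lerD//.
- by apply: Fb; rewrite gtr0_norm.
- by apply: Fb; rewrite normrN gtr0_norm.
Qed.

(** Integration by parts; it determines all moments from those of order 0 and 1. *)
Lemma moment_rec j : Ex N (fun x => x ^+ j.+1) = j%:R * Ex N (fun x => x ^+ j.-1).
Proof.
have m := @mom_id_N R.
apply/eqP; rewrite eq_sym -subr_eq0 -ExZ; last exact/mom_intg/momX.
rewrite -ExB; [|by apply: intgZ; exact/mom_intg/momX|exact/mom_intg/momX].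
rewrite Ex_N ?Rintegral_stein//.
apply: intgB; last exact/mom_intg/momX.
by apply: intgZ; exact/mom_intg/momX.
Qed.

End stdnormal2.

(** * The normal distribution function and its quantiles *)

Section cdf.
Context (R : realType).
Notation mu := (@lebesgue_measure R).
Notation phi := (@normal_pdf R 0 1).
Notation N := (@normal_prob R 0 1).
Notation Phi := (@normal_cdf R).

Lemma is_derive_cdf (x : R) : is_derive x 1 Phi (phi x).
Proof.
have h1 : x < x + 1 by rewrite ltrDl.
have hi : mu.-integrable [set` Interval -oo%O (BRight (x + 1))] (EFin \o phi).
  by apply: integrableS (integrable_normal_pdf 0 1).
have [] := continuous_FTC1 h1 hi _ (@continuous_phi R x).
  by rewrite ltNye_eq.
move=> d1 d2.
have E : Phi = (fun y => \int[mu]_(t in [set` Interval -oo%O (BRight y)]) phi t).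
  by [].
rewrite E; split; first exact: d1.
rewrite -derive1E; exact: d2.
Qed.

Lemma cdf_incr (x y : R) : x < y -> Phi x < Phi y.
Proof.
move=> xy; have [|c _ h] := MVT xy (fun x _ => is_derive_cdf x).
  by apply: (@is_derive_cont _ _ phi) => z _; exact: is_derive_cdf.
by rewrite -subr_gt0 h mulr_gt0 ?phi_gt0// subr_gt0.
Qed.

Lemma cdf_le (x y : R) : x <= y -> Phi x <= Phi y.
Proof. by rewrite le_eqVlt => /predU1P[->//|/cdf_incr/ltW]. Qed.

Lemma cdf_lip (x y : R) : `|Phi x - Phi y| <= normal_peak 1 * `|x - y|.
Proof.
wlog : x y / y <= x => [hw|yx].
  have [|/ltW] := leP y x; first exact: hw.
  by move/hw; rewrite distrC [`|y - x|]distrC.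
have [||c _ h] := @MVT_segment _ Phi phi _ _ yx.
- by move=> z _; exact: is_derive_cdf.
- by apply: (@is_derive_cont _ _ phi) => z _; exact: is_derive_cdf.
rewrite h normrM ler_wpM2r// (ger0_norm (phi_ge0 c)).
by apply: normal_pdf_ub; rewrite oner_eq0.
Qed.

Lemma cdf_ge0 x : 0 <= Phi x.
Proof. by rewrite /normal_cdf fine_ge0. Qed.

Lemma cdf_prob (x : R) : Phi x = fine (N `]-oo, x]).
Proof. by []. Qed.

Lemma Ex_N_sqr : Ex N (fun x : R => x ^+ 2) = 1.
Proof. by rewrite moment_rec mul1r; exact: Ex_cst. Qed.

Lemma N_tail (M : R) : 0 < M -> fine (N [set x : R | M < `|x|]) <= (M ^+ 2)^-1.
Proof.
by move=> M0; have := chebyshev2 M0 (@mom_id_N R); rewrite Ex_N_sqr mul1r.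
Qed.

Let mabs (M : R) : measurable [set x : R | M < `|x|].
Proof.
have mf : measurable_fun setT (fun x : R => M < `|x|).
  by apply: measurable_fun_ltr => //; exact: normr_measurable.
by have := mf measurableT [set true]; rewrite setTI preimage_true; apply.
Qed.

Lemma cdf_tail (M : R) : 0 < M -> 1 - (M ^+ 2)^-1 <= Phi M.
Proof.
move=> M0; rewrite lerBlDl -lerBlDr; apply: le_trans (N_tail M0).
have -> : 1 - Phi M = fine (N (~` `]-oo, M])).
  by rewrite probability_setC//= fineB// ?fin_num_measure.
have mB := mabs M; have mA : measurable (~` `]-oo, M] : set R) by exact: measurableC.
apply: fine_le; [exact: fin_num_measure|exact: fin_num_measure|].
apply: le_measure; rewrite ?inE//.
move=> x /=; rewrite in_itv/= => /negP; rewrite -ltNge => h.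
by rewrite (lt_le_trans h)// ler_norm.
Qed.

Lemma cdf_tailN (M : R) : 0 < M -> Phi (- (2 * M)) <= (M ^+ 2)^-1.
Proof.
move=> M0; apply: le_trans (N_tail M0).
have mB := mabs M; have mA : measurable (`]-oo, - (2 * M)] : set R) by [].
apply: fine_le; [exact: fin_num_measure|exact: fin_num_measure|].
apply: le_measure; rewrite ?inE//.
move=> x /=; rewrite in_itv/= => h; rewrite -normrN.
apply: (@lt_le_trans _ _ (- x)); last exact: ler_norm.
by nra.
Qed.

(** Phi x + Phi (-x) has derivative 0, since phi is even, and tends to 1. *)
Lemma cdfN (x : R) : Phi (- x) = 1 - Phi x.
Proof.
pose g x := Phi x + Phi (- x).
have dg (z : R) : is_derive z 1 g 0.
  have h1 := @dcomp _ Phi (fun y => - y) z _ _ (is_derive_cdf _) (dN (did z)).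
  have h := dD (is_derive_cdf z) h1.
  by apply: (is_derive_eq h); rewrite phi_sym; ring.
have gc (y z : R) : g y = g z.
  wlog : y z / y <= z => [hw|yz].
    have [|/ltW] := leP y z; first exact: hw.
    by move/hw.
  have [|c _ h] := @MVT_segment _ g (fun=> 0) _ _ yz (fun u _ => dg u).
    by apply: (@is_derive_cont _ _ (fun=> 0)) => u _; exact: dg.
  by apply/eqP; rewrite eq_sym -subr_eq0 h mul0r.
suff : g x - 1 = 0.
  by move/eqP; rewrite subr_eq0 => /eqP <-; rewrite /g; ring.
apply: (@eq0_le_inv _ _ 1) => n.
rewrite (gc x (2 * n.+1%:R)) div1r.
have : 0 < n.+1%:R :> R by rewrite ltr0n.
have : 1 <= n.+1%:R :> R by rewrite ler1n.
move: (n.+1%:R) => M M1 M0.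
have M20 : 0 < 2 * M by rewrite mulr_gt0.
have t1 := cdf_tail M20; have t2 := cdf_tailN M0.
have t3 : Phi (2 * M) <= 1 by rewrite cdf_prob -fine1 fine_le// ?fin_num_measure// probability_le1.
have t4 := cdf_ge0 (- (2 * M)).
have i1 : (M ^+ 2)^-1 <= M^-1.
  by rewrite lef_pV2 ?posrE ?exprn_gt0// expr2 ler_peMl// ltW.
have i2 : ((2 * M) ^+ 2)^-1 <= M^-1.
  rewrite lef_pV2 ?posrE ?exprn_gt0//; nra.
rewrite ler_norml /g; apply/andP; split; lra.
Qed.

Lemma cdf_lt1 x : Phi x < 1.
Proof.
rewrite -[x]opprK cdfN ltrBlDr ltrDl.
apply: le_lt_trans (cdf_incr (_ : - x - 1 < - x)); first exact: cdf_ge0.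
by rewrite ltrBlDr ltrDl.
Qed.

(** The derivatives of phi up to order two are bounded. *)
Lemma cdf_taylor : exists2 C : R, 0 <= C & forall y s,
  `|Phi (y + s) - Phi y - phi y * s - (- y * phi y) * s ^+ 2 / 2| <= C * `|s| ^+ 3.
Proof.
have [C2 C20 h2] := @phi_pow_bounded R 2.
have [C0 C00 h0] := @phi_pow_bounded R 0.
exists (C2 + C0); first exact: addr_ge0.
apply: (@taylor3 _ Phi phi (fun y => - y * phi y)
  (fun y => (y ^+ 2 - 1) * phi y)) => //.
- exact: addr_ge0.
- exact: is_derive_cdf.
- exact: is_derive_phi.
- move=> x; have h := dM (dN (did x)) (is_derive_phi x).
  by apply: (is_derive_eq h); rewrite /=; ring.
- move=> x; rewrite normrM (ger0_norm (phi_ge0 x)).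
  apply: (@le_trans _ _ ((`|x| ^+ 2 + 1) * phi x)).
    rewrite ler_wpM2r ?phi_ge0// (le_trans (ler_normB _ _))//.
    by rewrite normrX normr1.
  have := h2 x; have := h0 x; rewrite expr0 mul1r mulrDl mul1r => ? ?.
  by rewrite lerD.
Qed.

(** The first-order change of Phi (y / sqrt v) in v, at v = 1, is the same
    function - y phi y / 2 that appears as second-order term in [cdf_taylor].
    This form of the heat equation is what makes the terms of second order
    cancel in [lindeberg]. *)
Lemma cdf_heat : exists2 C : R, 0 <= C & forall y u, 0 <= u ->
  `|Phi (y / Num.sqrt (1 + u)) - Phi y + y * phi y / 2 * u| <= C * u ^+ 2.
Proof.
have [C1 C10 h1] := @phi_pow_bounded R 1.
have [C3 C30 h3] := @phi_pow_bounded R 3.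
exists (C1 + C3); first exact: addr_ge0.
move=> y u u0.
pose r u : R := (Num.sqrt (1 + u))^-1.
have sgt (v : R) : 0 <= v -> 0 < Num.sqrt (1 + v).
  by move=> v0; rewrite sqrtr_gt0 ltr_wpDr.
have rr (v : R) : 0 <= v -> r v ^+ 2 = (1 + v)^-1.
  by move=> v0; rewrite /r exprVn sqr_sqrtr// addr_ge0.
have dr (v : R) : 0 <= v -> is_derive v 1 r (- (r v) ^+ 3 / 2).
  move=> v0; have v1 : 0 < 1 + v by rewrite ltr_wpDr.
  have h' := dD (dcst 1 v) (did v).
  have h'' := @dcomp _ Num.sqrt (fun v => 1 + v) v _ _ (is_derive1_sqrt v1) h'.
  have h := @dV _ (fun v => Num.sqrt (1 + v)) v _ (lt0r_neq0 (sgt v v0)) h''.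
  apply: (is_derive_eq h); rewrite /r.
  have := sgt v v0; move: (Num.sqrt _) => s s0.
  by field; rewrite gt_eqF.
pose Y v := y * r v.
have dY (v : R) : 0 <= v -> is_derive v 1 Y (- Y v * r v ^+ 2 / 2).
  move=> v0; have h := dM (dcst y v) (dr v v0).
  by apply: (is_derive_eq h); rewrite /Y; field.
pose f v := Phi (Y v).
pose f1 v := phi (Y v) * (- Y v * r v ^+ 2 / 2).
pose f2 v := r v ^+ 4 * (3 * Y v - Y v ^+ 3) * phi (Y v) / 4.
have df (v : R) : 0 <= v -> is_derive v 1 f (f1 v).
  by move=> v0; exact: (@dcomp _ Phi Y v _ _ (is_derive_cdf _) (dY v v0)).
have df1 (v : R) : 0 <= v -> is_derive v 1 f1 (f2 v).
  move=> v0.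
  have a1 := @dcomp _ phi Y v _ _ (is_derive_phi _) (dY v v0).
  have a2 := dM (dM (dN (dY v v0)) (dX 2 (dr v v0))) (dcst (2^-1) v).
  have h := dM a1 a2.
  by apply: (is_derive_eq h); rewrite /f2 /=; field.
have bf2 (v : R) : 0 <= v -> `|f2 v| <= C1 + C3.
  move=> v0; rewrite /f2 3!normrM.
  have r1 : `|r v ^+ 4| <= 1.
    rewrite (_ : r v ^+ 4 = (1 + v)^-1 ^+ 2); last by rewrite -rr// -exprM.
    have v1 : 0 < 1 + v by rewrite ltr_wpDr.
    have v2 : (1 + v)^-1 <= 1 by rewrite invf_le1// lerDl.
    by rewrite ger0_norm ?sqr_ge0// exprn_ile1// invr_ge0 ltW.
  have n4 : `|4^-1 : R| = 4^-1 by rewrite ger0_norm.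
  rewrite n4 (ger0_norm (phi_ge0 _)).
  have b : `|3 * Y v - Y v ^+ 3| * phi (Y v) <= 3 * C1 + C3.
    apply: (@le_trans _ _ ((3 * `|Y v| ^+ 1 + `|Y v| ^+ 3) * phi (Y v))).
      rewrite ler_wpM2r ?phi_ge0// (le_trans (ler_normB _ _))//.
      by rewrite normrM normrX expr1 lerD2r ler_wpM2r// ger0_norm.
    have := h1 (Y v); have := h3 (Y v); rewrite mulrDl -mulrA => ? ?.
    by rewrite lerD// ler_wpM2l.
  have b0 : 0 <= `|3 * Y v - Y v ^+ 3| * phi (Y v) by rewrite mulr_ge0 ?phi_ge0.
  rewrite -[X in X / 4]mulrA.
  have := ler_piMl b0 r1.
  by move: (`|r v ^+ 4| * _) => p hp; lra.
have := @taylor2 _ f f1 f2 _ (addr_ge0 C10 C30) df df1 bf2 u u0.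
have r0 : r 0 = 1 by rewrite /r addr0 sqrtr1 invr1.
rewrite /f /f1 /Y r0 !mulr1 expr1n mulr1 -/(r u).
by congr (`|_| <= _); ring.
Qed.

Lemma cdf_cont : continuous Phi.
Proof.
move=> x; apply/differentiable_continuous/derivable1_diffP.
by have [] := is_derive_cdf x.
Qed.

Lemma cdf_surj (b : R) : 0 < b < 1 -> exists x, Phi x = b.
Proof.
move=> /andP[b0 b1].
pose m := Num.min b (1 - b).
have m0 : 0 < m by rewrite lt_min b0 subr_gt0.
pose M : R := 1 + m^-1.
have M1 : 1 <= M by rewrite lerDl invr_ge0 ltW.
have M0 : 0 < M by apply: lt_le_trans M1.
have Mm : (M ^+ 2)^-1 <= m.
  rewrite -[leRHS]invrK lef_pV2 ?posrE ?exprn_gt0 ?invr_gt0//.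
  have : 0 < m^-1 by rewrite invr_gt0.
  rewrite /M; move: (m^-1) => q q0; nra.
have mb : m <= b by rewrite ge_min lexx.
have mb1 : m <= 1 - b by rewrite ge_min lexx orbT.
have t1 := cdf_tailN M0; have t2 := cdf_tail M0.
have le : - (2 * M) <= M by lra.
have [|c _ hc] := @IVT _ Phi (- (2 * M)) M b le (continuous_subspaceT cdf_cont).
  have tt := cdf_le le.
  rewrite min_l// max_r//; apply/andP; split; lra.
by exists c.
Qed.

Lemma normal_quantileK (b : R) : 0 < b < 1 -> Phi (normal_quantile b) = b.
Proof.
move=> b01; have [x xb] := cdf_surj b01.
suff -> : normal_quantile b = x by [].
have -> : normal_quantile b = inf `[x, +oo[.
  congr inf; apply/seteqP; split => y /=; rewrite in_itv/= andbT.
    by rewrite leNgt -xb => h; rewrite leNgt; apply: contra h => /cdf_incr.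
  by rewrite -xb; exact: cdf_le.
by rewrite inf_itv// bnd_simp.
Qed.

Lemma normal_quantile1B (a : R) : 0 < a < 1 ->
  normal_quantile (1 - a) = - normal_quantile a.
Proof.
move=> /andP[a0 a1].
have h1 := @normal_quantileK (1 - a); have h2 := @normal_quantileK a.
have e : Phi (normal_quantile (1 - a)) = Phi (- normal_quantile a).
  by rewrite cdfN h1 ?h2// ?a0//; apply/andP; split; lra.
by case: (ltgtP (normal_quantile (1 - a)) (- normal_quantile a)) => // /cdf_incr;
  rewrite e ltxx.
Qed.

End cdf.

(** * A central limit theorem for martingale differences *)

Section lindeberg.
Context (R : realType).
Notation phi := (@normal_pdf R 0 1).
Notation Phi := (@normal_cdf R).

Lemma measurable_cdf : measurable_fun setT Phi.
Proof. by apply: continuous_measurable_fun; exact: cdf_cont. Qed.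

Lemma cdf_norm_le1 x : `|Phi x| <= 1.
Proof. by rewrite ger0_norm ?cdf_ge0// ltW// cdf_lt1. Qed.

Definition psum d (T : measurableType d) (xi : nat -> T -> R) (k : nat) (w : T) : R :=
  \sum_(i < k) xi i w.

(** The conditional expectations are tested against bounded functions of the
    past partial sum only, which is all that [lindeberg] uses; rho / m is the
    common conditional variance. *)
Record mdiff d (T : measurableType d) (P : probability T R) (m : nat)
    (xi : nat -> T -> R) (rho : T -> R) : Prop := Mdiff {
  mdiff_mom : forall k, (k < m)%N -> mom P (xi k);
  mdiff_momr : mom P rho;
  mdiff1 : forall k (h : R -> R), (k < m)%N -> measurable_fun setT h ->
    (exists M, forall x, `|h x| <= M) ->
    Ex P (fun w => h (psum xi k w) * xi k w) = 0;
  mdiff2 : forall k (h : R -> R), (k < m)%N -> measurable_fun setT h ->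
    (exists M, forall x, `|h x| <= M) ->
    Ex P (fun w => h (psum xi k w) * xi k w ^+ 2) =
    Ex P (fun w => h (psum xi k w) * (rho w / m%:R)) }.

Lemma mom_psum d (T : measurableType d) (P : probability T R) m xi rho k :
  mdiff P m xi rho -> (k <= m)%N -> mom P (psum xi k).
Proof.
move=> hx km; apply: mom_sum => i _; apply: (mdiff_mom hx).
exact: leq_trans (ltn_ord i) km.
Qed.

Lemma mom_bcomp d (T : measurableType d) (P : probability T R) (f : T -> R)
    (h : R -> R) M : measurable_fun setT f -> measurable_fun setT h ->
  (forall x, `|h x| <= M) -> mom P (fun w => h (f w)).
Proof.
move=> mf mh hM; apply: (@mom_bounded _ _ _ _ _ M) => [|x]; last exact: hM.
exact: measurableT_comp.
Qed.

(** The Taylor term of order two in x and the heat term combine into a multiple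
    of x^2 - 1/m, whose conditional expectation is (rho - 1) / m. *)
Lemma step_identity (p1 p2 p3 f Y x m s : R) : s != 0 -> m != 0 ->
  p1 - p2 - f / s * x + Y * f / (2 * s ^+ 2) * (x ^+ 2 - m^-1) =
  (p1 - p3 - f * (x / s) - - Y * f * (x / s) ^+ 2 / 2)
    - (p2 - p3 + Y * f / 2 * (m * s ^+ 2)^-1).
Proof. by move=> s0 n0; field; rewrite s0. Qed.

Lemma sum3_le (a b c p q s : R) : 0 <= a -> 0 <= b -> 0 <= c ->
  0 <= p -> 0 <= q -> 0 <= s -> a * p + b * q + c * s <= (a + b + c) * (p + q + s).
Proof. by move=> a0 b0 c0 p0 q0 s0; nra. Qed.

(** Lindeberg's replacement argument with the smooth test function
    x |-> Phi ((x - a) / e).  If k summands have been taken into account and the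
    other m - k replaced by centred Gaussian variables of variance 1/m, the
    expectation is that of Phi ((S_k - a) / sqrt th_k) with
    th_k = e^2 + (m - k) / m; so no Gaussian variable has to be introduced.  One
    replacement costs a third moment, the deviation of rho from 1, and a term of
    order m^(-2). *)
Lemma lindeberg : exists2 C : R, 0 <= C &
  forall d (T : measurableType d) (P : probability T R) m xi rho (L e a : R),
  (0 < m)%N -> mdiff P m xi rho -> 0 < e ->
  (forall k, (k < m)%N -> Ex P (fun w => `|xi k w| ^+ 3) <= L / m%:R) ->
  `|Ex P (fun w => Phi ((psum xi m w - a) / e)) - Phi (- a / Num.sqrt (1 + e ^+ 2))|
  <= C * (Ex P (fun w => `|rho w - 1|) / e ^+ 2 + L / e ^+ 3 + (m%:R * e ^+ 4)^-1).
Proof.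
have [C1 C10 h1] := @cdf_taylor R.
have [C2 C20 h2] := @cdf_heat R.
have [K K0 hK] := @phi_pow_bounded R 1.
have [K' K'0 hK'] := @phi_pow_bounded R 0.
exists (K + C1 + C2); first by rewrite !addr_ge0.
move=> d T P m xi rho L e a m0 hx e0 hL.
have m0' : 0 < m%:R :> R by rewrite ltr0n.
pose th k : R := e ^+ 2 + (m - k)%:R / m%:R.
have th_ge k : e ^+ 2 <= th k by rewrite lerDl divr_ge0.
have th_gt k : 0 < th k by apply: lt_le_trans (th_ge k); rewrite exprn_gt0.
pose u k x := Phi ((x - a) / Num.sqrt (th k)).
have mu k : measurable_fun setT (u k).
  apply: measurableT_comp; first exact: measurable_cdf.
  by apply: measurable_funM => //; apply: measurable_funB.
have momu k j : (j <= m)%N -> mom P (fun w => u k (psum xi j w)).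
  move=> jm; apply: (@mom_bcomp _ _ _ _ (u k) 1) => //.
    exact: (mom_meas (mom_psum hx jm)).
  by move=> x; exact: cdf_norm_le1.
pose E := Ex P (fun w => `|rho w - 1|).
pose D := K * E / e ^+ 2 + C1 * L / e ^+ 3 + C2 / (m%:R * e ^+ 4).
have step k : (k < m)%N ->
    `|Ex P (fun w => u k.+1 (psum xi k.+1 w)) - Ex P (fun w => u k (psum xi k w))|
    <= D / m%:R.
  move=> km.
  pose t := th k.+1; pose sq := Num.sqrt t.
  have t0 : 0 < t by exact: th_gt.
  have sq0 : 0 < sq by rewrite sqrtr_gt0.
  have sqt : sq ^+ 2 = t by rewrite sqr_sqrtr// ltW.
  have sqe : e <= sq.
    by rewrite -(@ler_pXn2r _ 2) ?nnegrE ?(ltW e0) ?(ltW sq0)// sqt; exact: th_ge.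
  pose v := (m%:R * t)^-1.
  have v0 : 0 <= v by rewrite invr_ge0 mulr_ge0// ltW.
  (* taking one more summand into account lowers the variance from t (1 + v) to t *)
  have thk : th k = t * (1 + v).
    rewrite /v mulrDr mulr1 invfM mulrCA mulfV ?gt_eqF// mulr1 /t /th.
    rewrite -addrA; congr (_ + _); rewrite -[X in _ + X]mul1r -mulrDl.
    by congr (_ / _); rewrite natr1 -subSn.
  pose S := psum xi k.
  have mS : mom P S by apply: (mom_psum hx); exact: ltnW.
  have mx := mdiff_mom hx km.
  have mr := mdiff_momr hx.
  pose y x := (x - a) / sq.
  pose g1 x := phi (y x) / sq.
  pose g2 x := y x * phi (y x) / (2 * t).
  have my : measurable_fun setT y.
    by apply: measurable_funM => //; apply: measurable_funB.
  have mphi : measurable_fun setT phi by exact: measurable_normal_pdf.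
  have mg1 : measurable_fun setT g1.
    by apply: measurable_funM => //; apply: measurableT_comp.
  have mg2 : measurable_fun setT g2.
    by apply: measurable_funM => //; apply: measurable_funM => //; apply: measurableT_comp.
  have bg1 x : `|g1 x| <= K' / sq.
    rewrite normrM (ger0_norm (phi_ge0 _)) (gtr0_norm (_ : 0 < sq^-1)) ?invr_gt0//.
    rewrite ler_wpM2r ?invr_ge0 ?(ltW sq0)//.
    by have := hK' (y x); rewrite expr0 mul1r.
  have bg2 x : `|g2 x| <= K / e ^+ 2.
    rewrite normrM (gtr0_norm (_ : 0 < (2 * t)^-1)) ?invr_gt0 ?mulr_gt0//.
    apply: ler_pM => //; first by rewrite invr_ge0 ltW// mulr_gt0.
      by rewrite normrM (ger0_norm (phi_ge0 _)); have := hK (y x); rewrite expr1.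
    rewrite lef_pV2 ?posrE ?mulr_gt0 ?exprn_gt0//.
    by have := th_ge k.+1; rewrite -/t; lra.
  (* remainder of the second-order expansion of one replacement *)
  pose r w := u k.+1 (S w + xi k w) - u k (S w) - g1 (S w) * xi k w
      + g2 (S w) * (xi k w ^+ 2 - m%:R^-1).
  have br w : `|r w| <= C1 / e ^+ 3 * `|xi k w| ^+ 3 + C2 / (m%:R ^+ 2 * e ^+ 4).
    have e1 : u k.+1 (S w + xi k w) = Phi (y (S w) + xi k w / sq).
      have -> : y (S w) + xi k w / sq = (S w + xi k w - a) / sq.
        by rewrite /y addrAC [RHS]mulrDl.
      by [].
    have e2 : u k (S w) = Phi (y (S w) / Num.sqrt (1 + v)).
      by rewrite /u /y thk sqrtrM ?(ltW t0)// invfM mulrA.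
    have t1 := h1 (y (S w)) (xi k w / sq).
    have t2 := h2 (y (S w)) v v0.
    rewrite /r e1 e2.
    have -> : Phi (y (S w) + xi k w / sq) - Phi (y (S w) / Num.sqrt (1 + v))
      - g1 (S w) * xi k w + g2 (S w) * (xi k w ^+ 2 - m%:R^-1) =
      (Phi (y (S w) + xi k w / sq) - Phi (y (S w)) - phi (y (S w)) * (xi k w / sq)
        - - y (S w) * phi (y (S w)) * (xi k w / sq) ^+ 2 / 2)
      - (Phi (y (S w) / Num.sqrt (1 + v)) - Phi (y (S w)) + y (S w) * phi (y (S w)) / 2 * v).
      rewrite /g1 /g2 /v -sqt.
      have sqn : sq != 0 by rewrite gt_eqF.
      have mn : m%:R != 0 :> R by rewrite gt_eqF.
      exact: step_identity.
    rewrite (le_trans (ler_normB _ _))// lerD//.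
      apply: (le_trans t1); rewrite normrM (gtr0_norm (_ : 0 < sq^-1)) ?invr_gt0//.
      rewrite exprMn mulrA mulrAC ler_wpM2r ?exprn_ge0// ler_wpM2l//.
      by rewrite -exprVn lerXn2r ?nnegrE ?invr_ge0 ?(ltW e0) ?(ltW sq0)// lef_pV2 ?posrE.
    apply: (le_trans t2); rewrite ler_wpM2l//.
    rewrite /v exprVn lef_pV2 ?posrE ?exprn_gt0 ?mulr_gt0 ?exprn_gt0//.
    rewrite exprMn ler_wpM2l ?exprn_ge0// (exprM _ 2 2) lerXn2r ?nnegrE ?sqr_ge0 ?(ltW t0)//.
    exact: th_ge.
  have mg1S : mom P (fun w => g1 (S w)) by apply: mom_bcomp bg1 => //; exact: mom_meas mS.
  have mg2S : mom P (fun w => g2 (S w)) by apply: mom_bcomp bg2 => //; exact: mom_meas mS.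
  have mu1 : mom P (fun w => u k.+1 (psum xi k.+1 w)) by exact: momu.
  have mu2 : mom P (fun w => u k (S w)) by apply: momu; exact: ltnW.
  have Sk w : psum xi k.+1 w = S w + xi k w by rewrite /psum big_ord_recr.
  have mrr : mom P r.
    have -> : r = fun w => u k.+1 (psum xi k.+1 w) - u k (S w) - g1 (S w) * xi k w
      + g2 (S w) * (xi k w ^+ 2 - m%:R^-1) by apply/funext => w; rewrite Sk.
    by mom_tac.
  have mP1 : mom P (fun w => g1 (S w) * xi k w) by mom_tac.
  have mP2 : mom P (fun w => g2 (S w) * xi k w ^+ 2) by mom_tac.
  have mP3 : mom P (fun w => g2 (S w) * (rho w / m%:R)) by mom_tac.
  have mP4 : mom P (fun w => g2 (S w) * m%:R^-1) by mom_tac.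
  have -> : Ex P (fun w => u k.+1 (psum xi k.+1 w)) - Ex P (fun w => u k (S w)) =
      Ex P r - Ex P (fun w => g2 (S w) * (rho w - 1)) / m%:R.
    have z1 : Ex P (fun w => g1 (S w) * xi k w) = 0.
      by apply: (mdiff1 hx) => //; exists (K' / sq).
    have z2 : Ex P (fun w => g2 (S w) * xi k w ^+ 2) = Ex P (fun w => g2 (S w) * (rho w / m%:R)).
      by apply: (mdiff2 hx) => //; exists (K / e ^+ 2).
    have -> : Ex P (fun w => g2 (S w) * (rho w - 1)) / m%:R =
        Ex P (fun w => g2 (S w) * (rho w / m%:R)) - Ex P (fun w => g2 (S w) * m%:R^-1).
      rewrite -ExB; [|exact: mom_intg..].
      rewrite mulrC -ExZ; last by apply: mom_intg; mom_tac.
      by apply: eq_Ex => w; move: (g2 _) (rho w) (_^-1) => p1 p2 p3; ring.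
    rewrite -z2.
    have -> : Ex P r = Ex P (fun w => u k.+1 (psum xi k.+1 w)) - Ex P (fun w => u k (S w))
       - Ex P (fun w => g1 (S w) * xi k w) + (Ex P (fun w => g2 (S w) * xi k w ^+ 2)
         - Ex P (fun w => g2 (S w) * m%:R^-1)).
      rewrite -!ExB; try (by apply: mom_intg; mom_tac).
      rewrite -ExD; try (by apply: mom_intg; mom_tac).
      apply: eq_Ex => w; rewrite /r Sk.
      by rewrite mulrBr.
    by rewrite z1 subr0 addrK.
  have -> : D / m%:R = (C1 / e ^+ 3 * (L / m%:R) + C2 / (m%:R ^+ 2 * e ^+ 4))
      + (K / e ^+ 2 * E) / m%:R.
    by rewrite /D; field; rewrite !gt_eqF.
  rewrite (le_trans (ler_normB _ _))// lerD//.
    apply: (le_trans (Ex_abs (mom_intg mrr))).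
    apply: (@le_trans _ _ (Ex P (fun w => C1 / e ^+ 3 * `|xi k w| ^+ 3 + C2 / (m%:R ^+ 2 * e ^+ 4)))).
      by apply: le_Ex => //; apply: mom_intg; mom_tac.
    rewrite ExD; try (by apply: mom_intg; mom_tac).
    rewrite Ex_cst lerD2r ExZ; last by apply: mom_intg; mom_tac.
    by rewrite ler_wpM2l ?hL// divr_ge0// exprn_ge0// ltW.
  rewrite normrM (gtr0_norm (_ : 0 < m%:R^-1)) ?invr_gt0// ler_wpM2r ?invr_ge0 ?(ltW m0')//.
  have mP5 : mom P (fun w => g2 (S w) * (rho w - 1)) by mom_tac.
  apply: (le_trans (Ex_abs (mom_intg mP5))).
  rewrite /E -ExZ; last by apply: mom_intg; mom_tac.
  apply: le_Ex; try (by apply: mom_intg; mom_tac).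
  by move=> w; rewrite normrM ler_wpM2r.
have tele k : (k <= m)%N ->
    `|Ex P (fun w => u k (psum xi k w)) - Ex P (fun w => u 0%N (psum xi 0 w))|
    <= k%:R * (D / m%:R).
  elim: k => [_|k ih km]; first by rewrite subrr normr0 mul0r.
  rewrite -[X in `|X|](subrKA (Ex P (fun w => u k (psum xi k w)))).
  rewrite (le_trans (ler_normD _ _))// -natr1 mulrDl mul1r addrC lerD//.
    exact/ih/ltnW.
  exact: step.
have := tele m (leqnn _).
have -> : m%:R * (D / m%:R) = D by rewrite mulrCA mulfV ?mulr1// gt_eqF.
have um w : u m (psum xi m w) = Phi ((psum xi m w - a) / e).
  by rewrite /u /th subnn mul0r addr0 sqrtr_sqr gtr0_norm.
have -> : Ex P (fun w => u m (psum xi m w)) = Ex P (fun w => Phi ((psum xi m w - a) / e)).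
  exact: eq_Ex.
have -> : Ex P (fun w => u 0%N (psum xi 0 w)) = Phi (- a / Num.sqrt (1 + e ^+ 2)).
  rewrite -[RHS](Ex_cst P); apply: eq_Ex => w.
  rewrite /u /th subn0 divff ?gt_eqF// /psum big_ord0 sub0r addrC//.
move=> h; apply: (le_trans h); rewrite /D.
have E0 : 0 <= E by apply: Ex_ge0.
have L0 : 0 <= L.
  have : 0 <= L / m%:R by apply: le_trans (hL 0%N m0); apply: Ex_ge0 => w; rewrite exprn_ge0.
  by rewrite pmulr_lge0// invr_gt0.
have a1 : 0 <= E / e ^+ 2 by rewrite divr_ge0// sqr_ge0.
have a2 : 0 <= L / e ^+ 3 by rewrite divr_ge0// exprn_ge0// ltW.
have a3 : 0 <= (m%:R * e ^+ 4)^-1 by rewrite invr_ge0 mulr_ge0// exprn_ge0// ltW.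
rewrite -[K * E / _]mulrA -[C1 * L / _]mulrA.
exact: sum3_le.
Qed.

End lindeberg.

Section martingale_clt.
Context (R : realType).
Notation Phi := (@normal_cdf R).

Lemma measurable_gt d (T : measurableType d) (f g : T -> R) :
  measurable_fun setT f -> measurable_fun setT g ->
  measurable [set w | f w < g w].
Proof.
move=> mf mg; have := measurable_fun_ltr mf mg.
move=> /(_ measurableT [set true]); rewrite setTI preimage_true; apply => //.
Qed.

Lemma squeeze4 (p q1 q2 f1 f2 f r : R) : 0 < r ->
  p <= q1 + r / 4 -> q2 - r / 4 <= p ->
  `|q1 - f1| <= r / 4 -> `|q2 - f2| <= r / 4 ->
  `|f1 - f| <= r / 4 -> `|f2 - f| <= r / 4 -> `|p - f| <= r.
Proof.
rewrite !ler_norml => r0 h1 h2 /andP[u1 u2] /andP[u3 u4] /andP[u5 u6] /andP[u7 u8].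
by apply/andP; split; lra.
Qed.

(** The indicator of a half-line is squeezed between shifts by M e of
    x |-> Phi ((x - a) / e), up to the tail of Phi beyond M.  M is chosen for the
    tail, then e for the modulus of continuity of Phi, and last eta so that the
    bound of [lindeberg], whose worst factor is e^(-4), is small. *)
Lemma martingale_clt (A r : R) : 0 <= A -> 0 < r -> exists2 eta : R, 0 < eta &
  forall d (T : measurableType d) (P : probability T R) m xi rho (L a : R),
  (0 < m)%N -> mdiff P m xi rho ->
  (forall k, (k < m)%N -> Ex P (fun w => `|xi k w| ^+ 3) <= L / m%:R) ->
  Ex P (fun w => `|rho w - 1|) <= eta -> L <= eta -> m%:R^-1 <= eta ->
  `|a| <= A ->
  `|fine (P [set w | a < psum xi m w]) - Phi (- a)| <= r.
Proof.
move=> A0 r0; have [C C0 hC] := lindeberg R.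
pose K : R := normal_peak 1.
have K0 : 0 < K by rewrite normal_peak_gt0// oner_eq0.
pose M : R := 1 + 4 / r.
have r4 : 0 < 4 / r by rewrite divr_gt0.
have M1 : 1 <= M by rewrite lerDl ltW.
have M0 : 0 < M by apply: lt_le_trans M1.
have tail : 1 - Phi M <= r / 4.
  rewrite lerBlDr -lerBlDl (le_trans _ (cdf_tail M0))// lerD2l lerN2.
  rewrite -[leRHS]invrK lef_pV2 ?posrE ?invr_gt0 ?exprn_gt0// ?divr_gt0//.
  rewrite invf_div /M; nra.
pose B := 4 * K * (A + M).
have B0 : 0 < B by rewrite !mulr_gt0// ltr_wpDl.
pose e : R := Num.min 1 (r / B).
have e0 : 0 < e by rewrite lt_min ltr01 divr_gt0.
have e1 : e <= 1 by rewrite ge_min lexx.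
have eB : K * (A + M) * e <= r / 4.
  have : e <= r / B by rewrite ge_min lexx orbT.
  rewrite ler_pdivlMr// /B => h; rewrite ler_pdivlMr//; apply: le_trans h.
  by rewrite le_eqVlt; apply/orP; left; apply/eqP; ring.
pose eta := r * e ^+ 4 / (12 * C + 1).
have c0 : 0 < 12 * C + 1 by rewrite ltr_wpDl// mulr_ge0.
have eta0 : 0 < eta by rewrite divr_gt0// mulr_gt0// exprn_gt0.
exists eta => // d T P m xi rho L a m0 hx hL hrho Leta meta aA.
have bnd b : `|Ex P (fun w => Phi ((psum xi m w - b) / e)) - Phi (- b / Num.sqrt (1 + e ^+ 2))|
    <= r / 4.
  apply: (le_trans (hC _ _ _ _ _ _ _ _ b m0 hx e0 hL)).
  have p2 : e ^+ 4 <= e ^+ 2 by rewrite ler_wiXn2l// ltW.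
  have p3 : e ^+ 4 <= e ^+ 3 by rewrite ler_wiXn2l// ltW.
  have i4 : 0 < (e ^+ 4)^-1 by rewrite invr_gt0 exprn_gt0.
  have i2 : (e ^+ 2)^-1 <= (e ^+ 4)^-1 by rewrite lef_pV2 ?posrE ?exprn_gt0.
  have i3 : (e ^+ 3)^-1 <= (e ^+ 4)^-1 by rewrite lef_pV2 ?posrE ?exprn_gt0.
  have j2 : 0 < (e ^+ 2)^-1 by rewrite invr_gt0 exprn_gt0.
  have j3 : 0 < (e ^+ 3)^-1 by rewrite invr_gt0 exprn_gt0.
  apply: (@le_trans _ _ (C * (eta * (e ^+ 4)^-1 + eta * (e ^+ 4)^-1 + eta * (e ^+ 4)^-1))).
    rewrite ler_wpM2l// !lerD//.
    - by apply: ler_pM => //; [exact: Ex_ge0|exact: ltW].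
    - apply: (@le_trans _ _ (eta / e ^+ 3)); first by rewrite ler_wpM2r// ltW.
      by rewrite ler_wpM2l// ltW.
    - by rewrite invfM ler_wpM2r// ltW.
  have -> : C * (eta * (e ^+ 4)^-1 + eta * (e ^+ 4)^-1 + eta * (e ^+ 4)^-1) =
     r * (3 * C / (12 * C + 1)).
    rewrite /eta; have : e ^+ 4 != 0 by rewrite gt_eqF// exprn_gt0.
    by move: (e ^+ 4) => q q0; field; rewrite q0 gt_eqF.
  rewrite ler_wpM2l ?(ltW r0)// ler_pdivrMr// -[4^-1]mul1r mulrAC ler_pdivlMr//.
  lra.
have sq1 : 1 <= Num.sqrt (1 + e ^+ 2).
  by rewrite -{1}[1]sqrtr1; apply: ler_wsqrtr; rewrite lerDl sqr_ge0.
have sq2 : Num.sqrt (1 + e ^+ 2) <= 1 + e.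
  have e1' : 0 <= 1 + e by rewrite addr_ge0// ltW.
  rewrite -[leRHS](ger0_norm e1') -sqrtr_sqr; apply: ler_wsqrtr.
  nra.
have comp b : `|b - a| <= M * e ->
    `|Phi (- b / Num.sqrt (1 + e ^+ 2)) - Phi (- a)| <= r / 4.
  move=> hb; apply: (le_trans (cdf_lip _ _)); apply: le_trans eB.
  rewrite -mulrA ler_wpM2l ?(ltW K0)//.
  move: (Num.sqrt _) sq1 sq2 => s s1 s2.
  have s0 : 0 < s by apply: lt_le_trans s1.
  have -> : - b / s - - a = ((a - b) + a * (s - 1)) / s by field; rewrite gt_eqF.
  rewrite normrM (gtr0_norm (_ : 0 < s^-1)) ?invr_gt0// ler_pdivrMr//.
  apply: (@le_trans _ _ ((A + M) * e)).
    rewrite (le_trans (ler_normD _ _))// mulrDl [leRHS]addrC lerD//.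
      by rewrite distrC.
    by rewrite normrM ler_pM// ger0_norm ?subr_ge0// lerBlDl.
  by rewrite ler_peMr// mulr_ge0 ?(ltW e0)// addr_ge0// ltW.
have mS : measurable_fun setT (psum xi m) by exact: mom_meas (mom_psum hx (leqnn _)).
have mA : measurable [set w | a < psum xi m w] by apply: measurable_gt.
rewrite -(Ex_indic P mA).
have mI := mom_indic P mA.
have mPhi b : mom P (fun w => Phi ((psum xi m w - b) / e)).
  apply: (@mom_bcomp _ _ _ _ (fun w => (psum xi m w - b) / e) Phi 1) => //.
  - by apply: measurable_funM => //; apply: measurable_funB.
  - exact: measurable_cdf.
  - exact: cdf_norm_le1.
have up : Ex P (\1_[set w | a < psum xi m w]) <=
    Ex P (fun w => Phi ((psum xi m w - (a - M * e)) / e)) + r / 4.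
  rewrite -(Ex_cst P (r / 4)) -ExD; [|exact/mom_intg/mPhi|exact/mom_intg/mom_cst].
  apply: le_Ex; [exact/mom_intg| |].
    by apply: mom_intg; apply: momD; [exact: mPhi|exact: mom_cst].
  move=> w; rewrite indicE; have [xA|xA] := pselect ([set w | a < psum xi m w] w).
    rewrite mem_set//= -lerBlDr.
    apply: (@le_trans _ _ (Phi M)); first by rewrite lerBlDl -lerBlDr.
    apply: cdf_le; rewrite ler_pdivlMr//; move: xA => /=; lra.
  by rewrite memNset// addr_ge0 ?cdf_ge0// divr_ge0// ltW.
have lo : Ex P (fun w => Phi ((psum xi m w - (a + M * e)) / e)) - r / 4 <=
    Ex P (\1_[set w | a < psum xi m w]).
  rewrite -(Ex_cst P (r / 4)) -ExB; [|exact/mom_intg/mPhi|exact/mom_intg/mom_cst].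
  apply: le_Ex; [|exact/mom_intg|].
    by apply: mom_intg; apply: momB; [exact: mPhi|exact: mom_cst].
  move=> w; rewrite indicE; have [xA|xA] := pselect ([set w | a < psum xi m w] w).
    by rewrite mem_set//= lerBlDr; apply: (le_trans (ltW (cdf_lt1 _))); rewrite lerDl; lra.
  rewrite memNset//= subr_le0.
  apply: (@le_trans _ _ (Phi (- M))); last by rewrite cdfN.
  apply: cdf_le; rewrite ler_pdivrMr//; move/negP: xA => /=; rewrite -leNgt; lra.
have Me : 0 <= M * e by rewrite mulr_ge0// ltW.
have k1 : `|(a - M * e) - a| <= M * e by rewrite addrAC subrr sub0r normrN ger0_norm.
have k2 : `|(a + M * e) - a| <= M * e by rewrite addrAC subrr add0r ger0_norm.
exact: (squeeze4 r0 up lo (bnd _) (bnd _) (comp _ k1) (comp _ k2)).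
Qed.

End martingale_clt.

(** * Gaussian vectors and Stein's identity *)

Section law_transfer.
Context (R : realType) (d1 d2 : measure_display).
Context (T1 : measurableType d1) (T2 : measurableType d2).
Context (P : probability T1 R) (N : probability T2 R).

Lemma law_transfer (Y : T1 -> T2) (f : T2 -> R) : measurable_fun setT Y ->
  (forall B, measurable B -> P (Y @^-1` B) = N B) -> intg N f ->
  intg P (f \o Y) /\ Ex P (f \o Y) = Ex N f.
Proof.
move=> mY hY hf.
have mf : measurable_fun setT f by have /measurable_EFinP := measurable_int _ hf.
pose Y' : {RV P >-> T2} := HB.pack Y (isMeasurableFun.Build _ _ _ _ _ mY).
have i1 : intg P (f \o Y).
  apply/integrableP; split; first by apply/measurable_EFinP; exact: measurableT_comp.
  have -> : (\int[P]_x `|(EFin \o (f \o Y)) x| = \int[N]_y `|(f y)%:E|)%E.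
    rewrite -[LHS](@ge0_integral_distribution _ _ _ _ _ P Y' (fun y => `|(f y)%:E|)%E)//.
      by apply: eq_measure_integral => B mB _; exact: hY.
    by apply: measurableT_comp => //; exact/measurable_EFinP.
  by have /integrableP[] := hf.
split=> //; rewrite /Ex /Rintegral; congr fine.
rewrite -[LHS](@integral_distribution _ _ _ _ _ P Y' (EFin \o f))//.
  by apply: eq_measure_integral => B mB _; exact: hY.
exact/measurable_EFinP.
Qed.

End law_transfer.

Section gauss_vector.
Context (R : realType) (dm : measure_display) (T : measurableType dm).
Context (Q : probability T R) (d : nat) (z : 'I_d -> T -> R).
Notation N := (@normal_prob R 0 1).
Implicit Types (s t b l : 'I_d -> R) (ls : seq ('I_d -> R)).

Definition lin t x : R := \sum_a t a * z a x.
Definition ip s t : R := \sum_a s a * t a.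

(** Standard Gaussian vectors are described through the laws of their linear
    forms, as the multivariate normal laws are. *)
Definition std_gauss : Prop := (forall a, measurable_fun setT (z a)) /\
  forall t (B : set R), measurable B ->
    Q [set x | B (lin t x)] = normal_law1 0 (\sum_a t a ^+ 2) B.

Hypothesis hz : std_gauss.

Lemma measurable_lin t : measurable_fun setT (lin t).
Proof.
apply: measurable_sum => a; apply: measurable_funM => //; exact: (proj1 hz).
Qed.

Lemma linZ c t x : lin (fun a => c * t a) x = c * lin t x.
Proof. by rewrite /lin mulr_sumr; apply: eq_bigr => a _; rewrite mulrA. Qed.

Lemma linD s t x : lin (fun a => s a + t a) x = lin s x + lin t x.
Proof. by rewrite /lin -big_split; apply: eq_bigr => a _; rewrite mulrDl. Qed.

Lemma ip_ge0 t : 0 <= ip t t.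
Proof. by apply: sumr_ge0 => a _; rewrite -expr2 sqr_ge0. Qed.

Lemma ip_eq0 t : ip t t = 0 -> forall a, t a = 0.
Proof.
move=> h a; apply/eqP; rewrite -sqrf_eq0 expr2.
have h0 : forall i : 'I_d, true -> 0 <= t i * t i by move=> i _; rewrite -expr2 sqr_ge0.
by have /eqP := h; rewrite psumr_eq0// => /allP/(_ a); rewrite mem_index_enum => /(_ isT).
Qed.

(** A linear form is a standard normal variable times its standard deviation;
    when the latter is 0 the form vanishes. *)
Lemma lin_pow t k : intg Q (fun x => `|lin t x| ^+ k) /\
  Ex Q (fun x => lin t x ^+ k) = Ex N (fun x => x ^+ k) * Num.sqrt (ip t t) ^+ k.
Proof.
have [t0|t0] := eqVneq (ip t t) 0.
  have l0 x : lin t x = 0.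
    by rewrite /lin big1// => a _; rewrite (ip_eq0 t0) mul0r.
  split.
    apply: (@intg_le _ _ _ _ _ (fun=> `|0 : R| ^+ k)).
    - by apply: measurable_funX; apply: measurableT_comp => //; exact: measurable_lin.
    - by move=> x; rewrite l0 ger0_norm ?exprn_ge0.
    - exact/mom_intg/mom_cst.
  rewrite (@eq_Ex _ _ _ _ _ (fun=> 0 ^+ k)); last by move=> x; rewrite l0.
  rewrite Ex_cst t0 sqrtr0; case: k => [|k]; last by rewrite expr0n mulr0.
  by rewrite !expr0 mulr1 (@eq_Ex _ _ _ _ _ (fun=> 1)) ?Ex_cst.
have r0 : 0 < Num.sqrt (ip t t) by rewrite sqrtr_gt0 lt_def t0 ip_ge0.
pose c := (Num.sqrt (ip t t))^-1; pose t' a := c * t a.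
have tE x : lin t x = Num.sqrt (ip t t) * lin t' x.
  by rewrite linZ mulrA divff ?mul1r// gt_eqF.
have tt : \sum_a t' a ^+ 2 = 1.
  rewrite /t'; under eq_bigr do rewrite exprMn.
  rewrite -mulr_sumr /c exprVn sqr_sqrtr ?ip_ge0//.
  by under eq_bigr do rewrite expr2; rewrite mulVf.
have hY B : measurable B -> Q (lin t' @^-1` B) = N B.
  move=> mB; rewrite -[LHS]/(Q [set x | B (lin t' x)]) (proj2 hz)// tt /normal_law1.
  by rewrite oner_eq0 sqrtr1.
have mY := measurable_lin t'.
have [_ h1] := @law_transfer R _ _ T (measurableTypeR R) Q N _ _ mY hY (mom_intg (momX k (@mom_id_N R))).
have [h2 _] := @law_transfer R _ _ T (measurableTypeR R) Q N _ _ mY hY (mom_intg (momX k (mom_abs (@mom_id_N R)))).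
split.
  have -> : (fun x => `|lin t x| ^+ k) =
     fun x => Num.sqrt (ip t t) ^+ k * ((fun y => `|y| ^+ k) \o lin t') x.
    by apply/funext => x; rewrite tE normrM exprMn gtr0_norm.
  exact: intgZ.
rewrite -h1 mulrC -ExZ; last first.
  apply: (@intg_le _ _ _ _ _ ((fun y => `|y| ^+ k) \o lin t')) => //.
    by apply: measurable_funX.
  by move=> x; rewrite normrX.
by apply: eq_Ex => x; rewrite tE exprMn.
Qed.

Lemma mom_lin t : mom Q (lin t).
Proof. by split; [exact: measurable_lin|move=> k; have [] := lin_pow t k]. Qed.

(** A nonzero polynomial has finitely many roots. *)
Lemma poly_fun_inj (p q : {poly R}) : (forall u : R, p.[u] = q.[u]) -> p = q.
Proof.
move=> h; apply/eqP; rewrite -subr_eq0; apply/negPn/negP => pq0.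
pose s : seq R := [seq n%:R | n <- iota 0 (size (p - q))].
have h1 : all (root (p - q)) s.
  by apply/allP => x _; rewrite /root hornerD hornerN h subrr.
have h2 : uniq s.
  rewrite map_inj_in_uniq ?iota_uniq// => i j _ _ /eqP.
  by rewrite eqr_nat => /eqP.
by have := max_poly_roots pq0 h1 h2; rewrite size_map size_iota ltnn.
Qed.

(** Moments of mixed products are read off the linear coefficient in t of
    moments in which b + t l replaces b. *)
Lemma polarisation (A : T -> R) n b l : mom Q A -> exists2 p : {poly R},
  forall t : R, Ex Q (fun x => A x * lin (fun a => b a + t * l a) x ^+ n) = p.[t] &
  p`_1 = n%:R * Ex Q (fun x => A x * lin l x * lin b x ^+ n.-1).
Proof.
move=> mA; have mb := mom_lin b; have ml := mom_lin l.
pose c i := Ex Q (fun x => A x * (lin b x ^+ (n - i) * lin l x ^+ i)) *+ 'C(n, i).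
exists (\poly_(i < n.+1) c i).
  move=> t; rewrite horner_poly.
  have -> : (fun x => A x * lin (fun a => b a + t * l a) x ^+ n) = fun x =>
     \sum_(i < n.+1) (t ^+ i *+ 'C(n, i)) * (A x * (lin b x ^+ (n - i) * lin l x ^+ i)).
    apply/funext => x; rewrite linD linZ exprDn mulr_sumr; apply: eq_bigr => i _.
    by rewrite mulrnAr mulrnAl exprMn; congr (_ *+ _); ring.
  rewrite Ex_sum; last by move=> i _; mom_tac.
  apply: eq_bigr => i _; rewrite ExZ; last by apply: mom_intg; mom_tac.
  by rewrite /c !mulrnAl mulrC.
rewrite coef_poly /c {c}; case: n => [|n] /=; first by rewrite mul0r.
rewrite bin1 mulr_natl subn1 /=; congr (_ *+ _); apply: eq_Ex => x.
by rewrite expr1 mulrAC -mulrA.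
Qed.

(** [Dl l0 ls] is the derivative of [prodl ls] in the direction l0. *)
Fixpoint prodl ls (x : T) : R := if ls is l :: ls' then lin l x * prodl ls' x else 1.
Fixpoint Dl l0 ls (x : T) : R :=
  if ls is l :: ls' then ip l0 l * prodl ls' x + lin l x * Dl l0 ls' x else 0.

Lemma mom_prodl ls : mom Q (prodl ls).
Proof. elim: ls => [|l ls ih] /=; mom_tac; exact: mom_lin. Qed.

Lemma mom_Dl l0 ls : mom Q (Dl l0 ls).
Proof. by elim: ls => [|l ls ih] /=; mom_tac; [exact: mom_prodl|exact: mom_lin]. Qed.

Lemma coef1E (p : {poly R}) : p`_1 = p^`().[0].
Proof. by rewrite horner_coef0 coef_deriv. Qed.

(** The moment of order k + 1 of a linear form is a constant times a power of
    its variance, a polynomial in t when b + t l0 replaces b and k + 1 is even;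
    when k + 1 is odd both sides vanish. *)
Lemma stein_pow l0 b k :
  Ex Q (fun x => lin l0 x * lin b x ^+ k) =
  k%:R * ip l0 b * Ex Q (fun x => lin b x ^+ k.-1).
Proof.
have [p hp p1] := polarisation k.+1 b l0 (mom_cst Q 1).
have k1 : k.+1%:R != 0 :> R by rewrite pnatr_eq0.
apply: (mulfI k1).
have -> : k.+1%:R * Ex Q (fun x => lin l0 x * lin b x ^+ k) = p`_1.
  by rewrite p1; congr (_ * _); apply: eq_Ex => x; rewrite mul1r.
have hp' (t : R) : p.[t] = Ex N (fun x => x ^+ k.+1) *
    Num.sqrt (ip b b + t * (2 * ip l0 b) + t ^+ 2 * ip l0 l0) ^+ k.+1.
  rewrite -hp; have [_ h] := lin_pow (fun a => b a + t * l0 a) k.+1.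
  rewrite (@eq_Ex _ _ _ _ _ (fun x => lin (fun a => b a + t * l0 a) x ^+ k.+1)); last first.
    by move=> x; rewrite mul1r.
  rewrite h; congr (_ * Num.sqrt _ ^+ _).
  rewrite /ip !mulr_sumr -!big_split; apply: eq_bigr => a _ /=; ring.
have [ek|ok] := boolP (odd k); last first.
  have gz j : ~~ odd j -> Ex N (fun x : R => x ^+ j.+1) = 0.
    elim/ltn_ind: j => -[|[|j]] ih//= oj.
      by rewrite moment_rec mul0r.
    by rewrite moment_rec /= ih ?mulr0//; move: oj; rewrite negbK.
  have -> : p = 0 by apply: poly_fun_inj => t; rewrite hp' gz// mul0r horner0.
  rewrite coef0; case: k ok {p hp p1 k1 hp'} => [|[|k]]//= ok.
    by rewrite !mul0r mulr0.
  have [_ ->] := lin_pow b k.+1; rewrite gz ?mul0r ?mulr0//.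
  by move: ok; rewrite negbK.
have [q kq] : exists q, k = q.*2.+1.
  by exists k./2; rewrite -[LHS]odd_double_half ek.
pose r : {poly R} := (ip b b)%:P + (2 * ip l0 b) *: 'X + (ip l0 l0) *: 'X^2.
have -> : p = Ex N (fun x => x ^+ k.+1) *: r ^+ q.+1.
  apply: poly_fun_inj => t; rewrite hp' hornerZ horner_exp /r !hornerE/=.
  congr (_ * _).
  have -> : k.+1 = (2 * q.+1)%N by rewrite kq mul2n doubleS.
  rewrite exprM sqr_sqrtr; first by congr (_ ^+ _); ring.
  have := ip_ge0 (fun a => b a + t * l0 a); congr (_ <= _).
  rewrite /ip !mulr_sumr -!big_split; apply: eq_bigr => a _ /=; ring.
rewrite coef1E derivZ deriv_exp hornerZ hornerMn hornerM horner_exp.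
have -> : r.[0] = ip b b by rewrite horner_coef0 /r !coefE/= !mulr0 !addr0.
have -> : r^`().[0] = 2 * ip l0 b.
  by rewrite -coef1E /r !coefE/= mulr0 mulr1 addr0 add0r.
rewrite kq /= moment_rec /=.
have [_ ->] := lin_pow b q.*2.
rewrite -mul2n !exprM sqr_sqrtr ?ip_ge0//.
have -> : (2 * q).+2%:R = 2 * q.+1%:R :> R by rewrite -natrM; congr _%:R; rewrite mulnS.
rewrite -mulr_natl.
move: (Ex N _) (ip b b ^+ q) => e i; ring.
Qed.

(** Stein's identity for the product of the forms ls and a power of b.  Induction
    on ls: the identity with one more form l is the coefficient of t in the
    identity where b + t l replaces b and k + 1 replaces k.  There the factor
    ip l0 (b + t l) is differentiated too, and this yields the term in which l0
    is contracted with l. *)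
Lemma stein_prodl ls l0 b k :
  Ex Q (fun x => lin l0 x * prodl ls x * lin b x ^+ k) =
  Ex Q (fun x => Dl l0 ls x * lin b x ^+ k) +
  k%:R * ip l0 b * Ex Q (fun x => prodl ls x * lin b x ^+ k.-1).
Proof.
elim: ls b k => [|l ls ih] b k /=.
  rewrite (@eq_Ex _ _ _ _ _ (fun x => lin l0 x * lin b x ^+ k)); last first.
    by move=> x; rewrite mulr1.
  rewrite stein_pow (@eq_Ex _ _ _ _ (fun x => 0 * _) (fun=> 0)); last first.
    by move=> x; rewrite mul0r.
  rewrite Ex_cst add0r; congr (_ * _); apply: eq_Ex => x; by rewrite mul1r.
have ml0 := mom_lin l0; have ml := mom_lin l; have mb := mom_lin b.
have mp := mom_prodl ls; have mD := mom_Dl l0 ls.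
have mA1 : mom Q (fun x => lin l0 x * prodl ls x) by mom_tac.
have [p1 h1 c1] := polarisation k.+1 b l mA1.
have [p2 h2 c2] := polarisation k.+1 b l mD.
have [p3 h3 c3] := polarisation k b l mp.
have pe : p1 = p2 + k.+1%:R *: (((ip l0 b)%:P + (ip l0 l) *: 'X) * p3).
  apply: poly_fun_inj => t.
  have ipE : ip l0 (fun a => b a + t * l a) = ip l0 b + t * ip l0 l.
    by rewrite /ip mulr_sumr -big_split; apply: eq_bigr => a _ /=; ring.
  rewrite hornerD hornerZ hornerM -h1 -h2 -h3 ih /= ipE !hornerE/=.
  by congr (_ + _); ring.
have k1 : k.+1%:R != 0 :> R by rewrite pnatr_eq0.
have p30 : p3`_0 = Ex Q (fun x => prodl ls x * lin b x ^+ k).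
  rewrite -horner_coef0 -h3; apply: eq_Ex => x; congr (_ * _ ^+ _).
  by apply: eq_bigr => a _; rewrite mul0r addr0.
have e := congr1 (fun p : {poly R} => p`_1) pe.
move: e; rewrite coefD coefZ coefM !big_ord_recr big_ord0 /= !coefE /=.
rewrite !(mulr0, mulr1, addr0, add0r) c1 c2 c3 p30 /= -mulrDr => /(mulfI k1) e.
rewrite (@eq_Ex _ _ _ _ _ (fun x => lin l0 x * prodl ls x * lin l x * lin b x ^+ k)); last first.
  by move=> x; ring.
rewrite e.
have -> : Ex Q (fun x => (ip l0 l * prodl ls x + lin l x * Dl l0 ls x) * lin b x ^+ k) =
   ip l0 l * Ex Q (fun x => prodl ls x * lin b x ^+ k) +
   Ex Q (fun x => Dl l0 ls x * lin l x * lin b x ^+ k).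
  rewrite -ExZ; last by apply: mom_intg; mom_tac.
  rewrite -ExD; try (by apply: mom_intg; mom_tac).
  by apply: eq_Ex => x; ring.
have -> : Ex Q (fun x => lin l x * prodl ls x * lin b x ^+ k.-1) =
  Ex Q (fun x => prodl ls x * lin l x * lin b x ^+ k.-1).
  by apply: eq_Ex => x; ring.
ring.
Qed.

End gauss_vector.

(** * Centred quadratic forms of a Gaussian vector *)

Section quadratic.
Context (R : realType) (dm : measure_display) (T : measurableType dm).
Context (Q : probability T R) (d : nat) (z : 'I_d -> T -> R).
Hypothesis hz : std_gauss Q z.
Notation lin := (lin z).
Notation prodl := (prodl z).
Notation Dl := (Dl z).

Definition ebase (a b : 'I_d) : R := (a == b)%:R.

(** Polynomials in z together with their partial derivatives, as a relation: the
    derivatives are carried along the construction. *)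
Inductive polyd : (T -> R) -> ('I_d -> T -> R) -> Prop :=
| Polyd_mono ls : polyd (prodl ls) (fun a => Dl (ebase a) ls)
| Polyd_add p dp q dq : polyd p dp -> polyd q dq ->
    polyd (fun x => p x + q x) (fun a x => dp a x + dq a x)
| Polyd_scale c p dp : polyd p dp ->
    polyd (fun x => c * p x) (fun a x => c * dp a x).

Lemma polyd_ext p dp q dq : polyd p dp -> p =1 q -> (forall a, dp a =1 dq a) ->
  polyd q dq.
Proof.
move=> h pq dpq.
have <- : p = q by apply/funext.
by have <- : dp = dq by apply/funext => a; apply/funext => x; exact: dpq.
Qed.

Lemma lin_ebase a x : lin (ebase a) x = z a x.
Proof.
rewrite /lin (bigD1 a)//= /ebase eqxx mul1r big1 ?addr0// => b ba.
by rewrite eq_sym (negbTE ba) mul0r.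
Qed.

Lemma ip_ebase a (t : 'I_d -> R) : ip (ebase a) t = t a.
Proof.
rewrite /ip (bigD1 a)//= /ebase eqxx mul1r big1 ?addr0// => b ba.
by rewrite eq_sym (negbTE ba) mul0r.
Qed.

Lemma polyd_mom p dp : polyd p dp -> mom Q p /\ forall a, mom Q (dp a).
Proof.
elim=> [ls|p' dp' q dq _ [h1 h2] _ [h3 h4]|c p' dp' _ [h1 h2]].
- by split=> [|a]; [exact: mom_prodl|exact: mom_Dl].
- by split=> [|a]; mom_tac.
- by split=> [|a]; mom_tac.
Qed.

Lemma mom_z a : mom Q (z a).
Proof.
by have := mom_lin hz (ebase a); congr mom; apply/funext => x; rewrite lin_ebase.
Qed.

(** By linearity from [stein_prodl], with the power of b taken to be 0. *)
Lemma stein a p dp : polyd p dp -> Ex Q (fun x => z a x * p x) = Ex Q (dp a).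
Proof.
elim=> [ls|p' dp' q dq hp ihp hq ihq|c p' dp' hp ih].
- have := stein_prodl hz ls (ebase a) (fun=> 0) 0.
  rewrite mul0r mul0r addr0 => h.
  transitivity (Ex Q (fun x => lin (ebase a) x * prodl ls x * lin (fun=> 0) x ^+ 0)).
    by apply: eq_Ex => x; rewrite expr0 mulr1 lin_ebase.
  by rewrite h; apply: eq_Ex => x; rewrite expr0 mulr1.
- have [m1 m2] := polyd_mom hp; have [m3 m4] := polyd_mom hq; have mz := mom_z a.
  rewrite ExD; [|exact/mom_intg..]; rewrite -ihp -ihq -ExD; try (by apply: mom_intg; mom_tac).
  by apply: eq_Ex => x; rewrite mulrDr.
- have [m1 m2] := polyd_mom hp; have mz := mom_z a.
  rewrite ExZ; last exact/mom_intg.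
  rewrite -ih -ExZ; last by apply: mom_intg; mom_tac.
  by apply: eq_Ex => x; ring.
Qed.

Lemma polyd_cst c : polyd (fun=> c) (fun _ _ => 0).
Proof.
apply: (polyd_ext (Polyd_scale c (Polyd_mono [::]))) => [x|a x] /=; first by rewrite mulr1.
by rewrite mulr0.
Qed.

Lemma polyd_z a : polyd (z a) (fun b _ => (a == b)%:R).
Proof.
apply: (polyd_ext (Polyd_mono [:: ebase a])) => [x|b x] /=.
  by rewrite mulr1 lin_ebase.
by rewrite mulr1 mulr0 addr0 ip_ebase.
Qed.

Lemma prodl_cat l1 l2 x : prodl (l1 ++ l2) x = prodl l1 x * prodl l2 x.
Proof. by elim: l1 => [|l l1 ih] /=; rewrite ?mul1r// ih mulrA. Qed.

Lemma Dl_cat l0 l1 l2 x :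
  Dl l0 (l1 ++ l2) x = Dl l0 l1 x * prodl l2 x + prodl l1 x * Dl l0 l2 x.
Proof.
elim: l1 => [|l l1 ih] /=; first by rewrite mul0r add0r mul1r.
by rewrite ih prodl_cat; ring.
Qed.

Lemma polyd_mul p dp q dq : polyd p dp -> polyd q dq ->
  polyd (fun x => p x * q x) (fun a x => dp a x * q x + p x * dq a x).
Proof.
move=> hp; elim: hp q dq => [ls|p1 dp1 p2 dp2 _ ih1 _ ih2|c p1 dp1 _ ih1] q dq hq.
- elim: hq => [ls2|q1 dq1 q2 dq2 _ jh1 _ jh2|c q1 dq1 _ jh1].
  + by apply: (polyd_ext (Polyd_mono (ls ++ ls2))) => [x|a x]; rewrite ?prodl_cat ?Dl_cat.
  + by apply: (polyd_ext (Polyd_add jh1 jh2)) => [x|a x]; ring.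
  + by apply: (polyd_ext (Polyd_scale c jh1)) => [x|a x]; ring.
- by apply: (polyd_ext (Polyd_add (ih1 _ _ hq) (ih2 _ _ hq))) => [x|a x]; ring.
- by apply: (polyd_ext (Polyd_scale c (ih1 _ _ hq))) => [x|a x]; ring.
Qed.

Lemma polyd_sum (I : Type) (r : seq I) (F : I -> T -> R) (dF : I -> 'I_d -> T -> R) :
  (forall i, polyd (F i) (dF i)) ->
  polyd (fun x => \sum_(i <- r) F i x) (fun a x => \sum_(i <- r) dF i a x).
Proof.
move=> h; elim: r => [|i r ih].
  by apply: (polyd_ext (polyd_cst 0)) => [x|a x]; rewrite big_nil.
by apply: (polyd_ext (Polyd_add (h i) ih)) => [x|a x]; rewrite big_cons.
Qed.

Implicit Types W V : 'I_d -> 'I_d -> R.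

(** Centred, because E (z_a z_b) = delta_ab. *)
Definition Qf W (x : T) : R := \sum_a \sum_b W a b * (z a x * z b x - (a == b)%:R).
Definition fnorm2 W : R := \sum_a \sum_b W a b ^+ 2.

Lemma polyd_Qf W : polyd (Qf W)
  (fun c x => \sum_a \sum_b W a b * ((a == c)%:R * z b x + z a x * (b == c)%:R)).
Proof.
apply: polyd_sum => a; apply: polyd_sum => b.
apply: Polyd_scale.
apply: (polyd_ext (Polyd_add (polyd_mul (polyd_z a) (polyd_z b)) (polyd_cst (- (a == b)%:R)))).
  by [].
by move=> c x; rewrite addr0.
Qed.

Definition symf W := forall a b, W a b = W b a.

Lemma polyd_Qf_sym W : symf W -> polyd (Qf W) (fun c x => 2 * \sum_b W c b * z b x).
Proof.
move=> sW; apply: (polyd_ext (polyd_Qf W)) => // c x.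
have -> : \sum_a \sum_b W a b * ((a == c)%:R * z b x + z a x * (b == c)%:R) =
  \sum_a (a == c)%:R * (\sum_b W a b * z b x) + \sum_a z a x * (\sum_b W a b * (b == c)%:R).
  rewrite -big_split; apply: eq_bigr => a _ /=.
  rewrite !mulr_sumr -big_split; apply: eq_bigr => b _ /=; ring.
rewrite mulr_natl mulr2n; congr (_ + _).
  rewrite (bigD1 c)//= eqxx mul1r [X in _ + X]big1 ?addr0// => a /negbTE->.
  by rewrite mul0r.
apply: eq_bigr => a _; rewrite (bigD1 c)//= eqxx mulr1 [X in _ + X]big1 ?addr0.
  by rewrite mulrC sW.
by move=> b /negbTE->; rewrite mulr0.
Qed.

Lemma mom_Qf W : mom Q (Qf W).
Proof. by have [] := polyd_mom (polyd_Qf W). Qed.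

Lemma mom_zz a b : mom Q (fun x => z a x * z b x).
Proof. by apply: momM; exact: mom_z. Qed.

(** Stein's identity for z_a against z_b p; the term in which z_b is
    differentiated cancels the centring delta_ab. *)
Lemma Qf_stein W p dp : polyd p dp ->
  Ex Q (fun x => Qf W x * p x) =
  Ex Q (fun x => \sum_a dp a x * \sum_b W a b * z b x).
Proof.
move=> hp; have [mp mdp] := polyd_mom hp.
have key a b : Ex Q (fun x => z a x * z b x * p x) =
    Ex Q (fun x => (a == b)%:R * p x) + Ex Q (fun x => z b x * dp a x).
  have mb := mom_z b; have m := mdp a.
  rewrite -ExD; try (by apply: mom_intg; mom_tac).
  rewrite (@eq_Ex _ _ _ _ _ (fun x => z a x * (z b x * p x))); last by move=> x; ring.
  rewrite (stein a (polyd_mul (polyd_z b) hp)).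
  by apply: eq_Ex => x; rewrite eq_sym.
transitivity (\sum_a \sum_b W a b * Ex Q (fun x => z b x * dp a x)).
  rewrite (@eq_Ex _ _ _ _ _ (fun x => \sum_a \sum_b
     W a b * (z a x * z b x * p x - (a == b)%:R * p x))); last first.
    move=> x; rewrite mulr_suml; apply: eq_bigr => a _; rewrite mulr_suml.
    by apply: eq_bigr => b _; ring.
  have mab a b : mom Q (fun x => z a x * z b x * p x - (a == b)%:R * p x).
    by apply: momB; [apply: momM => //; exact: mom_zz|mom_tac].
  rewrite Ex_sum; last by move=> a _; apply: mom_sum => b _; apply: momM => //; mom_tac.
  apply: eq_bigr => a _; rewrite Ex_sum; last by move=> b _; apply: momM => //; mom_tac.
  apply: eq_bigr => b _; rewrite ExZ; last exact: mom_intg.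
  have mzz := mom_zz a b.
  rewrite ExB; try (by apply: mom_intg; mom_tac).
  by rewrite key addrAC subrr add0r.
rewrite [RHS]Ex_sum; last first.
  move=> a _; apply: momM => //; apply: mom_sum => b _; apply: momM; [exact: mom_cst|exact: mom_z].
apply: eq_bigr => a _.
rewrite (@eq_Ex _ _ _ _ (fun x => dp a x * _) (fun x => \sum_b W a b * (z b x * dp a x))); last first.
  by move=> x; rewrite mulr_sumr; apply: eq_bigr => b _; ring.
have mm b : mom Q (fun x => z b x * dp a x) by apply: momM => //; exact: mom_z.
rewrite Ex_sum; last by move=> b _; apply: momM => //; mom_tac.
by apply: eq_bigr => b _; rewrite ExZ//; exact: mom_intg.
Qed.

Lemma Ex_Qf W : Ex Q (Qf W) = 0.
Proof.
rewrite (@eq_Ex _ _ _ _ _ (fun x => Qf W x * 1)); last by move=> x; rewrite mulr1.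
rewrite (Qf_stein W (polyd_cst 1)) -[RHS](Ex_cst Q); apply: eq_Ex => x.
by rewrite big1// => a _; rewrite mul0r.
Qed.

Lemma Ex_zz a b : Ex Q (fun x => z a x * z b x) = (a == b)%:R.
Proof. by rewrite (stein a (polyd_z b)) Ex_cst eq_sym. Qed.

Lemma Ex_Qf2 W : symf W -> Ex Q (fun x => Qf W x ^+ 2) = 2 * fnorm2 W.
Proof.
move=> sW.
rewrite (@eq_Ex _ _ _ _ _ (fun x => Qf W x * Qf W x)); last by move=> x; rewrite expr2.
rewrite (Qf_stein W (polyd_Qf_sym sW)).
rewrite (@eq_Ex _ _ _ _ _ (fun x => \sum_a \sum_b \sum_c
   (2 * W a b * W a c) * (z b x * z c x))); last first.
  move=> x; apply: eq_bigr => a _; rewrite -mulrA mulr_suml mulr_sumr.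
  apply: eq_bigr => b _; rewrite mulr_sumr mulr_sumr; apply: eq_bigr => c _; ring.
have m b c (w : R) : mom Q (fun x => w * (z b x * z c x)).
  by apply: momM; [exact: mom_cst|exact: mom_zz].
rewrite Ex_sum; last by move=> a _; apply: mom_sum => b _; apply: mom_sum => c _.
rewrite mulr_sumr; apply: eq_bigr => a _.
rewrite Ex_sum; last by move=> b _; apply: mom_sum => c _.
rewrite mulr_sumr; apply: eq_bigr => b _.
rewrite Ex_sum// (bigD1 b)//= [X in _ + X]big1 ?addr0.
  by rewrite ExZ; [rewrite Ex_zz eqxx mulr1; ring|exact/mom_intg/mom_zz].
move=> c cb; rewrite ExZ; last exact/mom_intg/mom_zz.
by rewrite Ex_zz eq_sym (negbTE cb) mulr0.
Qed.

Lemma fnorm2_ge0 W : 0 <= fnorm2 W.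
Proof. by apply: sumr_ge0 => a _; apply: sumr_ge0 => b _; exact: sqr_ge0. Qed.

(** The matrix W^T W: for symmetric W the squared gradient of Qf W is
    4 (Qf (gram W) + |W|_F^2). *)
Definition gram W a b : R := \sum_c W c a * W c b.

Lemma cauchy_sum (I : finType) (f g : I -> R) :
  (\sum_i f i * g i) ^+ 2 <= (\sum_i f i ^+ 2) * (\sum_i g i ^+ 2).
Proof.
set A := \sum_i f i ^+ 2; set B := \sum_i g i ^+ 2; set C := \sum_i f i * g i.
have A0 : 0 <= A by apply: sumr_ge0 => i _; exact: sqr_ge0.
have h (s t : R) : 0 <= s ^+ 2 * A - 2 * s * t * C + t ^+ 2 * B.
  have -> : s ^+ 2 * A - 2 * s * t * C + t ^+ 2 * B = \sum_i (s * f i - t * g i) ^+ 2.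
    rewrite !mulr_sumr -sumrN -!big_split; apply: eq_bigr => i _ /=; ring.
  by apply: sumr_ge0 => i _; exact: sqr_ge0.
have [A00|A00] := eqVneq A 0.
  have f0 i : f i = 0.
    apply/eqP; rewrite -sqrf_eq0; have /eqP := A00.
    rewrite psumr_eq0; last by move=> j _; exact: sqr_ge0.
    by move=> /allP/(_ i); rewrite mem_index_enum => /(_ isT).
  by rewrite /C big1 ?expr0n ?A00 ?mul0r// => i _; rewrite f0 mul0r.
have Ap : 0 < A by rewrite lt_def A00.
have := h C A; rewrite -(pmulr_rge0 _ Ap).
have -> : C ^+ 2 * A - 2 * C * A * C + A ^+ 2 * B = A * (A * B - C ^+ 2) by ring.
by rewrite pmulr_rge0// pmulr_rge0// subr_ge0.
Qed.

(** Cauchy-Schwarz for each pair of columns of W. *)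
Lemma fnorm2_gram W : fnorm2 (gram W) <= fnorm2 W ^+ 2.
Proof.
have -> : fnorm2 W ^+ 2 = \sum_a \sum_b (\sum_c W c a ^+ 2) * (\sum_c W c b ^+ 2).
  have -> : fnorm2 W = \sum_a \sum_c W c a ^+ 2 by exact: exchange_big.
  by rewrite expr2 mulr_suml; apply: eq_bigr => a _; rewrite mulr_sumr.
by apply: ler_sum => a _; apply: ler_sum => b _; exact: cauchy_sum.
Qed.

(** Stein's identity turns E Q^4 into 6 E (Q^2 Q') + 12 |W|^4, where Q' is the
    form with weights W^T W.  The cross term is at most E Q^4 / 2 plus a multiple
    of E Q'^2, and the half is absorbed. *)
Lemma Ex_Qf4 W : symf W -> Ex Q (fun x => Qf W x ^+ 4) <= 96 * fnorm2 W ^+ 2.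
Proof.
move=> sW.
have hQ := polyd_Qf_sym sW; have mQ := mom_Qf W.
have sV : symf (gram W) by move=> a b; apply: eq_bigr => c _; rewrite mulrC.
have mV := mom_Qf (gram W).
pose s := fnorm2 W.
have s0 : 0 <= s by exact: fnorm2_ge0.
have hQ3 := polyd_mul hQ (polyd_mul hQ hQ).
have e4 : Ex Q (fun x => Qf W x ^+ 4) =
    6 * Ex Q (fun x => Qf W x ^+ 2 * Qf (gram W) x) + 12 * s ^+ 2.
  rewrite (@eq_Ex _ _ _ _ _ (fun x => Qf W x * (Qf W x * (Qf W x * Qf W x)))); last first.
    by move=> x; ring.
  rewrite (Qf_stein W hQ3).
  rewrite (@eq_Ex _ _ _ _ _ (fun x => 6 * (Qf W x ^+ 2 * Qf (gram W) x) + 6 * s * Qf W x ^+ 2)); last first.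
    move=> x.
    have q : Qf (gram W) x + s = \sum_c (\sum_b W c b * z b x) ^+ 2.
      have -> : s = \sum_a \sum_b gram W a b * (a == b)%:R.
        rewrite /s /fnorm2 exchange_big; apply: eq_bigr => a _ /=.
        rewrite [RHS](bigD1 a)//= eqxx mulr1 [X in _ + X]big1 ?addr0; last first.
          by move=> b ba; rewrite eq_sym (negbTE ba) mulr0.
        by apply: eq_bigr => c _; rewrite expr2.
      rewrite /Qf -big_split /=.
      transitivity (\sum_a \sum_b \sum_c W c a * W c b * (z a x * z b x)).
        apply: eq_bigr => a _; rewrite -big_split; apply: eq_bigr => b _ /=.
        by rewrite -mulrDr subrK /gram mulr_suml.
      transitivity (\sum_a \sum_c \sum_b W c a * W c b * (z a x * z b x)).
        by apply: eq_bigr => a _; rewrite exchange_big.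
      rewrite exchange_big; apply: eq_bigr => c _ /=.
      rewrite expr2 mulr_suml; apply: eq_bigr => a _; rewrite mulr_sumr.
      by apply: eq_bigr => b _; ring.
    have -> : 6 * (Qf W x ^+ 2 * Qf (gram W) x) + 6 * s * Qf W x ^+ 2 =
       6 * Qf W x ^+ 2 * (Qf (gram W) x + s) by ring.
    rewrite q mulr_sumr; apply: eq_bigr => a _.
    move: (\sum_b _) (Qf W x) => u v; ring.
  rewrite ExD; try (by apply: mom_intg; mom_tac).
  rewrite !ExZ; try (by apply: mom_intg; mom_tac).
  by rewrite Ex_Qf2// -/s; ring.
have V2 : Ex Q (fun x => Qf (gram W) x ^+ 2) <= 2 * s ^+ 2.
  by rewrite Ex_Qf2// ler_wpM2l// fnorm2_gram.
have cs : 6 * Ex Q (fun x => Qf W x ^+ 2 * Qf (gram W) x) <=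
    Ex Q (fun x => Qf W x ^+ 4) / 2 + 18 * Ex Q (fun x => Qf (gram W) x ^+ 2).
  rewrite [X in _ <= X + _]mulrC -!ExZ; try (by apply: mom_intg; mom_tac).
  rewrite -ExD; try (by apply: mom_intg; mom_tac).
  apply: le_Ex; try (by apply: mom_intg; mom_tac).
  move=> x; move: (Qf W x) (Qf (gram W) x) => u v.
  by have := sqr_ge0 (u ^+ 2 - 6 * v); nra.
rewrite -/s; lra.
Qed.

(** Only the symmetric part of the weights matters, and symmetrising does not
    increase the norm. *)
Definition symp W a b : R := (W a b + W b a) / 2.

Lemma Qf_symp W x : Qf (symp W) x = Qf W x.
Proof.
have e : Qf W x = \sum_a \sum_b W b a * (z a x * z b x - (a == b)%:R).
  rewrite /Qf exchange_big; apply: eq_bigr => a _; apply: eq_bigr => b _.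
  by rewrite [z b x * _]mulrC eq_sym.
have -> : Qf W x = (Qf W x + Qf W x) / 2 by lra.
rewrite {2}e /Qf -big_split mulr_suml; apply: eq_bigr => a _ /=.
by rewrite -big_split mulr_suml; apply: eq_bigr => b _ /=; rewrite /symp; ring.
Qed.

Lemma fnorm2_symp W : fnorm2 (symp W) <= fnorm2 W.
Proof.
have e : fnorm2 W = \sum_a \sum_b W b a ^+ 2 by exact: exchange_big.
have -> : fnorm2 W = (fnorm2 W + fnorm2 W) / 2 by lra.
rewrite {2}e /fnorm2 -big_split mulr_suml; apply: ler_sum => a _ /=.
rewrite -big_split mulr_suml; apply: ler_sum => b _ /=.
by rewrite /symp; have := sqr_ge0 (W a b - W b a); nra.
Qed.

Lemma Ex_Qf2_le W : Ex Q (fun x => Qf W x ^+ 2) <= 2 * fnorm2 W.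
Proof.
have sW : symf (symp W) by move=> a b; rewrite /symp addrC.
rewrite (@eq_Ex _ _ _ _ _ (fun x => Qf (symp W) x ^+ 2)); last by move=> x; rewrite Qf_symp.
by rewrite Ex_Qf2// ler_wpM2l// fnorm2_symp.
Qed.

End quadratic.

(** * Freezing the other observations of an i.i.d. sample *)

Section freeze.
Context (R : realType) (d0 d1 d2 : measure_display).
Context (T0 : measurableType d0) (T1 : measurableType d1) (T2 : measurableType d2).
Context (P : probability T0 R) (N : probability T2 R).
Context (O : T0 -> T1) (Y : T0 -> T2).
Hypothesis mO : measurable_fun setT O.
Hypothesis mY : measurable_fun setT Y.
Hypothesis indep : forall A B, measurable A -> measurable B ->
  P (O @^-1` A `&` Y @^-1` B) = (P (O @^-1` A) * N B)%E.

(** The joint law of independent O and Y is the product of their laws, so that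
    Fubini's theorem integrates Y out with O fixed.  This replaces conditional
    expectations. *)
Lemma freeze (F : T1 * T2 -> R) : measurable_fun setT F ->
  intg P (fun w => F (O w, Y w)) ->
  (forall x, intg N (fun y => F (x, y))) ->
  intg P (fun w => Ex N (fun y => F (O w, y))) /\
  Ex P (fun w => F (O w, Y w)) = Ex P (fun w => Ex N (fun y => F (O w, y))).
Proof.
move=> mF iF iN.
pose O' : {RV P >-> T1} := HB.pack O (isMeasurableFun.Build _ _ _ _ _ mO).
have mOY : measurable_fun setT (fun w => (O w, Y w)).
  exact: measurable_fun_pair.
pose OY : {RV P >-> (T1 * T2)%type} := HB.pack (fun w => (O w, Y w))
  (isMeasurableFun.Build _ _ _ _ _ mOY).
pose M1 : probability T1 R := distribution P O'.
have prodE : forall A, measurable A -> (M1 \x N)%E A = distribution P OY A.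
  apply: product_measure_unique => A B mA mB; exact: indep.
have mFe : measurable_fun setT (EFin \o F) by exact/measurable_EFinP.
have iprod : ((M1 \x N)%E : {measure set _ -> \bar R}).-integrable setT (EFin \o F).
  apply/integrableP; split=> //.
  rewrite (eq_measure_integral (distribution P OY)); last by move=> A mA _; exact: prodE.
  rewrite ge0_integral_distribution//; last exact: measurableT_comp.
  by have /integrableP[] := iF.
have FE x : fubini_F N (EFin \o F) x = (Ex N (fun y => F (x, y)))%:E.
  by rewrite /Ex /Rintegral fineK//; exact: (integrable_fin_num _ (iN x)).
have iff := integrable_fubini_F iprod.
have i1 : M1.-integrable setT (EFin \o (fun x => Ex N (fun y => F (x, y)))).
  by apply: eq_integrable iff => // x _; rewrite FE.
have m1 : measurable_fun setT (fun x => Ex N (fun y => F (x, y))).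
  by have /measurable_EFinP := measurable_int _ i1.
have i2 : intg P (fun w => Ex N (fun y => F (O w, y))).
  apply/integrableP; split; first by apply/measurable_EFinP; exact: (measurableT_comp m1 mO).
  have /integrableP[_] := i1.
  rewrite ge0_integral_distribution//.
  by apply: measurableT_comp => //; exact/measurable_EFinP.
split=> //; rewrite {1}/Ex {1}/Rintegral.
have -> : (\int[P]_x (F (O x, Y x))%:E = \int[M1 \x N]_p (F p)%:E)%E.
  rewrite (eq_measure_integral (distribution P OY)); last by move=> A mA _; exact: prodE.
  by rewrite integral_distribution.
have -> : (\int[M1 \x N]_p (F p)%:E = \int[M1]_x (Ex N (fun y => F (x, y)))%:E)%E.
  by rewrite -(integral12_prod_meas1 iprod); apply: eq_integral => x _; rewrite FE.
rewrite -[RHS]/(fine (\int[P]_w (Ex N (fun y => F (O w, y)))%:E)).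
by congr fine; rewrite (@integral_distribution _ _ _ _ _ P O')//; exact/measurable_EFinP.
Qed.

End freeze.

Section independence.
Context (R : realType) (d0 d2 : measure_display).
Context (T0 : measurableType d0) (T2 : measurableType d2).
Context (P : probability T0 R) (N : probability T2 R) (n : nat).
Context (X : 'I_n -> {RV P >-> T2}).
Hypothesis hX : iid_from X N.

(** A pi-system generating the sigma-algebra of all observations but X i. *)
Definition rect (i : 'I_n) : set (set T0) := [set A | exists B : 'I_n -> set T2,
  (forall j, measurable (B j)) /\ A = [set w | forall j, j != i -> B j (X j w)]].

(** The sample space with that smaller sigma-algebra, so that a function is
    measurable from [others i] when it depends on the other observations only,
    and the identity plays the part of O in [freeze]. *)
Definition others (i : 'I_n) := g_sigma_algebraType (rect i).

Lemma rect_measurable i A : rect i A -> measurable A.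
Proof.
move=> [B [mB ->]].
have -> : [set w | forall j, j != i -> B j (X j w)] =
    \bigcap_(j in [set j | j != i]) (X j @^-1` B j) by [].
apply: fin_bigcap_measurable; first exact: finite_finset.
by move=> j _; exact: measurable_funPTI.
Qed.

Lemma others_measurable i A : (<<s rect i >>) A -> measurable A.
Proof. exact: (smallest_sub (@sigma_algebra_measurable _ T0) (@rect_measurable i)). Qed.

Lemma rectI i : setI_closed (rect i).
Proof.
move=> A A' [B [mB ->]] [B' [mB' ->]].
exists (fun j => B j `&` B' j); split; first by move=> j; exact: measurableI.
apply/seteqP; split => w /=; first by move=> [h h'] j ji; split; [exact: h|exact: h'].
by move=> h; split => j ji; have [] := h j ji.
Qed.

Lemma rectT i : rect i setT.
Proof. by exists (fun=> setT); split => //; apply/seteqP; split. Qed.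

Lemma fine_distr i C : measurable C -> fine (P (X i @^-1` C)) = fine (N C).
Proof. by move=> mC; congr fine; exact: (proj2 hX). Qed.

Lemma indep_rect i A C : rect i A -> measurable C ->
  P (A `&` X i @^-1` C) = (P A * N C)%E.
Proof.
move=> hA mC; have mA := rect_measurable hA; have [B [mB AE]] := hA.
have mXC : measurable (X i @^-1` C) by exact: measurable_funPTI.
have mAC : measurable (A `&` X i @^-1` C) by exact: measurableI.
rewrite -[LHS]fineK ?fin_num_measure// -[P A]fineK ?fin_num_measure//.
rewrite -[N C]fineK ?fin_num_measure// -EFinM; congr EFin.
pose B1 (D : set T2) j := if j == i then D else B j.
have mB1 D : measurable D -> forall j, measurable (B1 D j).
  by move=> mD j; rewrite /B1; case: ifP.
have prodE D : measurable D -> \prod_(j < n) fine (P (X j @^-1` B1 D j)) =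
   fine (N D) * \prod_(j < n | j != i) fine (P (X j @^-1` B j)).
  move=> mD; rewrite (bigD1 i)//= /B1 eqxx fine_distr//; congr (_ * _).
  by apply: eq_bigr => j /negbTE->.
have E D : measurable D -> fine (P (A `&` X i @^-1` D)) =
   fine (N D) * \prod_(j < n | j != i) fine (P (X j @^-1` B j)).
  move=> mD; rewrite -prodE// -(proj1 hX _ (mB1 _ mD)); congr (fine (P _)).
  rewrite AE; apply/seteqP; split => w /=.
    move=> [h h'] j; rewrite /B1; case: ifPn => [/eqP->//|ji]; exact: h.
  move=> h; split; last by have := h i; rewrite /B1 eqxx.
  by move=> j ji; have := h j; rewrite /B1 (negbTE ji).
rewrite (E _ mC); have := E _ (@measurableT _ T2); rewrite preimage_setT setIT => ->.
rewrite mulrC [X in _ = X * _](_ : _ = \prod_(j < n | j != i) fine (P (X j @^-1` B j)))//.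
by rewrite -[RHS]mul1r; congr (_ * _); rewrite [X in fine X](_ : _ = 1%E)//; exact: probability_setT.
Qed.

(** Both sides are finite measures in A that agree on the pi-system [rect i]. *)
Lemma indep_others i A C : (<<s rect i >>) A -> measurable C ->
  P (A `&` X i @^-1` C) = (P A * N C)%E.
Proof.
move=> hA mC.
have mXC : measurable (X i @^-1` C) by exact: measurable_funPTI.
have c0 : 0 <= fine (N C) by rewrite fine_ge0.
rewrite muleC -[N C]fineK ?fin_num_measure//.
rewrite -[LHS]/(mrestr P mXC A) -[RHS]/(mscale (NngNum c0) P A).
apply: (g_sigma_algebra_measure_unique (rect i) (@rect_measurable i) (fun=> setT)) => //.
- by move=> _; exact: rectT.
- by rewrite bigcup_const//; exists 0%N.
- exact: rectI.
- move=> B hB; rewrite -[RHS]/((fine (N C))%:E * P B)%E fineK ?fin_num_measure//.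
  by rewrite muleC; exact: indep_rect.
- move=> _; rewrite -[X in (X < _)%E]/(P (setT `&` X i @^-1` C)) setTI.
  by rewrite (le_lt_trans (probability_le1 _ _)) ?ltry.
Qed.

Lemma measurable_others_id i : measurable_fun setT (id : T0 -> others i).
Proof. by move=> _ A mA; rewrite setTI; exact: (@others_measurable i). Qed.

Lemma measurable_others i j : j != i -> measurable_fun setT (X j : others i -> T2).
Proof.
move=> ji _ A mA; rewrite setTI; apply: sub_sigma_algebra.
exists (fun k => if k == j then A else setT); split.
  by move=> k; case: ifP.
apply/seteqP; split => w /=; first by move=> h k _; case: ifPn => // /eqP ->.
by move=> h; have := h j ji; rewrite eqxx.
Qed.

Lemma freeze_X i (F : others i * T2 -> R) : measurable_fun setT F ->
  intg P (fun w => F (w, X i w)) ->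
  (forall x, intg N (fun y => F (x, y))) ->
  intg P (fun w => Ex N (fun y => F (w, y))) /\
  Ex P (fun w => F (w, X i w)) = Ex P (fun w => Ex N (fun y => F (w, y))).
Proof.
move=> mF i1 i2.
apply: (@freeze R _ _ _ T0 (others i) T2 P N id (X i)) => //.
- exact: measurable_others_id.
- by move=> A B mA mB; exact: indep_others.
Qed.

Lemma X_transfer i f : intg N f -> intg P (f \o X i) /\ Ex P (f \o X i) = Ex N f.
Proof.
apply: law_transfer; first exact: measurable_funPT.
by move=> B mB; exact: (proj2 hX).
Qed.

End independence.

Section gauss_sample.
Context (R : realType) (d0 d2 : measure_display).
Context (T0 : measurableType d0) (T2 : measurableType d2).
Context (P : probability T0 R) (N : probability T2 R) (n d : nat).
Context (X : 'I_n -> {RV P >-> T2}) (z : 'I_d -> T2 -> R).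
Hypothesis hX : iid_from X N.
Hypothesis hz : std_gauss N z.

(** A stand-in for measurability with respect to the observations other than
    X i, in the class of variables with all moments. *)
Definition indep_of (i : 'I_n) (h : T0 -> R) :=
  mom P h /\ measurable_fun setT (h : others X i -> R).

Lemma ind_mom i h : indep_of i h -> mom P h. Proof. by case. Qed.

Lemma ind_cst i c : indep_of i (fun=> c).
Proof. by split; [exact: mom_cst|]. Qed.

Lemma indD i f g : indep_of i f -> indep_of i g -> indep_of i (fun w => f w + g w).
Proof. by move=> [m1 a1] [m2 a2]; split; [exact: momD|exact: measurable_funD]. Qed.

Lemma indM i f g : indep_of i f -> indep_of i g -> indep_of i (fun w => f w * g w).
Proof. by move=> [m1 a1] [m2 a2]; split; [exact: momM|exact: measurable_funM]. Qed.

Lemma indB i f g : indep_of i f -> indep_of i g -> indep_of i (fun w => f w - g w).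
Proof. by move=> [m1 a1] [m2 a2]; split; [exact: momB|exact: measurable_funB]. Qed.

Lemma indX i f k : indep_of i f -> indep_of i (fun w => f w ^+ k).
Proof. by move=> [m1 a1]; split; [exact: momX|exact: measurable_funX]. Qed.

Lemma ind_sum i (I : Type) (r : seq I) (p : pred I) (F : I -> T0 -> R) :
  (forall k, p k -> indep_of i (F k)) ->
  indep_of i (fun x => \sum_(k <- r | p k) F k x).
Proof.
move=> hF; elim: r => [|k r ih].
  by rewrite (_ : (fun _ => _) = fun=> 0); [exact: ind_cst|apply/funext => x; rewrite big_nil].
case pk : (p k).
  rewrite (_ : (fun _ => _) = fun x => F k x + \sum_(j <- r | p j) F j x).
    by apply: indD => //; exact: hF.
  by apply/funext => x; rewrite big_cons pk.
by rewrite (_ : (fun _ => _) = fun x => \sum_(j <- r | p j) F j x)//;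
  apply/funext => x; rewrite big_cons pk.
Qed.

Lemma ind_bcomp i f (h : R -> R) M : indep_of i f -> measurable_fun setT h ->
  (forall x, `|h x| <= M) -> indep_of i (fun w => h (f w)).
Proof.
move=> [m1 a1] mh hM; split; first exact: mom_bcomp (mom_meas m1) mh hM.
exact: measurableT_comp.
Qed.

Lemma mom_X (f : T2 -> R) i : mom N f -> mom P (fun w => f (X i w)).
Proof.
move=> [mf hf]; split; first by apply: measurableT_comp => //; exact: measurable_funPT.
by move=> k; have [] := X_transfer hX i (hf k).
Qed.

Lemma ind_X i j (f : T2 -> R) : j != i -> mom N f -> indep_of i (fun w => f (X j w)).
Proof.
move=> ji mf; split; first exact: mom_X.
apply: (@measurableT_comp _ _ _ _ _ _ f); first exact: mom_meas mf.
exact: measurable_others.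
Qed.

Section quad.
Context (i : 'I_n) (W : 'I_d -> 'I_d -> T0 -> R) (h : T0 -> R).
Hypothesis hW : forall a b, indep_of i (W a b).
Hypothesis hh : indep_of i h.

(** A quadratic form in X i whose weights are random but do not involve X i. *)
Definition QX (w : T0) : R := Qf z (fun a b => W a b w) (X i w).

Lemma mom_QX : mom P QX.
Proof.
apply: mom_sum => a _; apply: mom_sum => b _.
apply: momM; first exact: (ind_mom (hW a b)).
by apply: (@mom_X (fun x => z a x * z b x - (a == b)%:R)); mom_tac; exact: mom_z hz _.
Qed.

Let G k (p : others X i * T2) : R := h p.1 * Qf z (fun a b => W a b p.1) p.2 ^+ k.

Let mG k : measurable_fun setT (G k).
Proof.
apply: measurable_funM.
  by apply: (@measurableT_comp _ _ _ _ _ _ (h : others X i -> R)); [case: hh|exact: measurable_fst].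
apply: measurable_funX; apply: measurable_sum => a; apply: measurable_sum => b.
apply: measurable_funM.
  by apply: (@measurableT_comp _ _ _ _ _ _ (W a b : others X i -> R)); [case: (hW a b)|exact: measurable_fst].
apply: measurable_funB => //; apply: measurable_funM.
  by apply: (@measurableT_comp _ _ _ _ _ _ (z a)); [exact: (proj1 hz)|exact: measurable_snd].
by apply: (@measurableT_comp _ _ _ _ _ _ (z b)); [exact: (proj1 hz)|exact: measurable_snd].
Qed.

(** The weights W and the factor h are frozen, and X i is integrated out. *)
Lemma QX_freeze k :
  intg P (fun w => h w * Ex N (fun y => Qf z (fun a b => W a b w) y ^+ k)) /\
  Ex P (fun w => h w * QX w ^+ k) =
  Ex P (fun w => h w * Ex N (fun y => Qf z (fun a b => W a b w) y ^+ k)).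
Proof.
have mQ := mom_QX; have mh := ind_mom hh.
have i2 x : mom N (fun y => Qf z (fun a b => W a b x) y ^+ k).
  by apply: momX; exact: mom_Qf hz _.
have [||h1 h2] := @freeze_X R _ _ T0 T2 P N n X hX i (G k) (mG k).
- by apply: mom_intg; apply: momM => //; apply: momX.
- by move=> x; exact: (intgZ (h x) (mom_intg (i2 x))).
have e : (fun w => Ex N (fun y => G k (w, y))) =
    (fun w => h w * Ex N (fun y => Qf z (fun a b => W a b w) y ^+ k)).
  by apply/funext => w; rewrite /G /= ExZ//; exact: mom_intg.
by rewrite -e; split.
Qed.

Lemma Ex_QX : Ex P (fun w => h w * QX w) = 0.
Proof.
have [_] := QX_freeze 1; rewrite /= => e; rewrite -[RHS](Ex_cst P).
rewrite (@eq_Ex _ _ _ _ _ (fun w => h w * QX w ^+ 1))// e; apply: eq_Ex => w.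
by rewrite -[X in _ * X]/(Ex N (Qf z (fun a b => W a b w))) (Ex_Qf hz) mulr0.
Qed.

Hypothesis sW : forall a b w, W a b w = W b a w.

Lemma Ex_QX2 : Ex P (fun w => h w * QX w ^+ 2) =
  Ex P (fun w => h w * (2 * fnorm2 (fun a b => W a b w))).
Proof.
have [_ ->] := QX_freeze 2; apply: eq_Ex => w.
by rewrite (Ex_Qf2 hz)// => a b; exact: sW.
Qed.

Lemma ind_fnorm2 : indep_of i (fun w => fnorm2 (fun a b => W a b w)).
Proof. by apply: ind_sum => a _; apply: ind_sum => b _; apply: indX. Qed.

End quad.

Lemma Ex_QX4 i (W : 'I_d -> 'I_d -> T0 -> R) : (forall a b, indep_of i (W a b)) ->
  (forall a b w, W a b w = W b a w) ->
  Ex P (fun w => QX i W w ^+ 4) <=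
  96 * Ex P (fun w => fnorm2 (fun a b => W a b w) ^+ 2).
Proof.
move=> hW sW.
have [i1 e] := QX_freeze hW (ind_cst i 1) 4.
have mF := ind_mom (ind_fnorm2 hW).
rewrite (@eq_Ex _ _ _ _ _ (fun w => 1 * QX i W w ^+ 4)); last by move=> w; rewrite mul1r.
rewrite e -ExZ; last exact/mom_intg/momX.
apply: le_Ex => //; first by apply: intgZ; exact/mom_intg/momX.
by move=> w; rewrite mul1r; apply: (Ex_Qf4 hz) => a b; exact: sW.
Qed.

End gauss_sample.

(** * Spectral theorem and whitening of a covariance matrix *)

Section real_spectral.
Import complex.
Context (R : realType).
Local Open Scope sesquilinear_scope.

(** A complex eigenvalue of a real symmetric matrix is real, because
    w S w' = a (w w') is invariant under conjugation, where w' is the conjugate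
    transpose of the eigenvector w; being real, it is a root of the real
    characteristic polynomial. *)
Lemma sym_eigenvalue n (S : 'M[R]_n.+1) : S^T = S -> exists a, eigenvalue S a.
Proof.
move=> symS.
pose C : numClosedFieldType := R[i].
pose f : {rmorphism R -> C} := real_complex R.
pose SC : 'M[C]_n.+1 := map_mx f S.
have freal (x : R) : (f x)^* = f x by exact: conjc_real.
have SCh : SC ^t* = SC.
  by apply/matrixP => i j; rewrite !mxE freal -[in RHS]symS mxE.
have [a ea] := @eigenvalue_closed C n.+1 SC isT.
have /eigenvalueP [w wS w0] := ea.
have q0 : (w *m w ^t*) 0 0 != 0.
  apply: contra w0 => /eqP; rewrite !mxE => h.
  have h0 : forall i : 'I_n.+1, true -> 0 <= w 0 i * (w ^t*) i 0.
    by move=> i _; rewrite !mxE mul_conjC_ge0.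
  move/eqP: h; rewrite psumr_eq0// => /allP h.
  apply/eqP/rowP => i; rewrite mxE; apply/eqP.
  by have := h i; rewrite mem_index_enum => /(_ isT); rewrite !mxE mul_conjC_eq0.
have ar : a^* = a.
  have e1 : (w *m SC *m w ^t*) 0 0 = a * (w *m w ^t*) 0 0.
    by rewrite wS -scalemxAl mxE.
  have e2 (A : 'M[C]_1) : (A ^t*) 0 0 = (A 0 0)^* by rewrite !mxE.
  have e3 : (w *m SC *m w ^t*) ^t* = w *m SC *m w ^t*.
    rewrite !trmx_mul !map_mxM /= SCh mulmxA; congr (_ *m _ *m _).
    by apply/matrixP => i j; rewrite !mxE conjCK.
  have e4 : (w *m w ^t*) ^t* = w *m w ^t*.
    rewrite !trmx_mul !map_mxM /=; congr (_ *m _).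
    by apply/matrixP => i j; rewrite !mxE conjCK.
  have e5 : ((w *m w ^t*) 0 0)^* = (w *m w ^t*) 0 0 by rewrite -e2 e4.
  have := e2 (w *m SC *m w ^t*); rewrite e3 e1 rmorphM /= e5.
  by move=> /(mulIf q0) <-.
have [r ar'] : exists r : R, a = f r.
  exists (complex.Re a).
  have : a \is Num.real by apply/CrealP.
  by move=> /RRe_real h; exact/esym.
exists r; rewrite eigenvalue_root_char.
move: ea; rewrite eigenvalue_root_char /SC -map_char_poly ar'.
by rewrite fmorph_root.
Qed.

Local Close Scope sesquilinear_scope.

(** The reflection exchanging v and the first basis vector. *)
Lemma householder n (v : 'rV[R]_n.+1) : v *m v^T = 1%:M ->
  exists2 H : 'M[R]_n.+1, H *m H^T = 1%:M & delta_mx 0 0 *m H = v.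
Proof.
move=> vv; pose e0 : 'rV[R]_n.+1 := delta_mx 0 0.
have [ve|ve] := eqVneq v e0.
  by exists 1%:M; rewrite ?trmx1 ?mulmx1 ?ve.
pose u := v - e0; pose q := (u *m u^T) 0 0.
have uq : u *m u^T = q%:M by rewrite [LHS]mx11_scalar.
have q0 : q != 0.
  apply: contra ve => /eqP; rewrite /q mxE => h; rewrite -subr_eq0 -/u.
  have h0 : forall i : 'I_n.+1, true -> 0 <= u 0 i * u^T i 0.
    by move=> i _; rewrite [u^T _ _]mxE -expr2 sqr_ge0.
  move/eqP: h; rewrite psumr_eq0// => /allP h.
  apply/eqP/rowP => i; rewrite [RHS]mxE; apply/eqP; rewrite -sqrf_eq0 expr2.
  by have := h i; rewrite mem_index_enum [u^T _ _]mxE => /(_ isT).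
have e0e0 : e0 *m e0^T = 1%:M.
  by rewrite /e0 trmx_delta mul_delta_mx; apply/matrixP => i j; rewrite !ord1 !mxE.
pose c := (v *m e0^T) 0 0.
have ve0 : v *m e0^T = c%:M by rewrite [LHS]mx11_scalar.
have e0v : e0 *m v^T = c%:M by rewrite -[LHS]trmxK trmx_mul trmxK ve0 tr_scalar_mx.
have qE : q = 2 - 2 * c.
  have : q%:M = (2 - 2 * c)%:M :> 'M[R]_1.
    rewrite -uq /u linearB /= mulmxBl !mulmxBr vv ve0 e0v e0e0.
    by apply/matrixP => i j; rewrite !ord1 !mxE /=; ring.
  by move/matrixP/(_ 0 0); rewrite !mxE.
pose H : 'M[R]_n.+1 := 1%:M - (2 / q) *: (u^T *m u).
have HT : H^T = H by rewrite /H linearB /= trmx1 linearZ /= trmx_mul trmxK.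
have uuuu : u^T *m u *m (u^T *m u) = q *: (u^T *m u).
  by rewrite mulmxA -[u^T *m u *m u^T]mulmxA uq mul_mx_scalar -scalemxAl.
exists H.
  rewrite HT /H; move: (u^T *m u) uuuu => V VV.
  rewrite mulmxBr mulmx1 mulmxBl mul1mx -scalemxAr -scalemxAl VV !scalerA.
  have -> : 2 / q * (2 / q) * q = 2 / q + 2 / q by field.
  by rewrite scalerDl opprB addrK subrK.
rewrite -/e0 /H mulmxBr mulmx1 -scalemxAr mulmxA.
have -> : e0 *m u^T = (c - 1)%:M.
  by rewrite /u linearB /= mulmxBr e0v e0e0 -raddfB.
rewrite mul_scalar_mx scalerA.
have -> : 2 / q * (c - 1) = -1.
  have : 2 - 2 * c != 0 by rewrite -qE.
  by rewrite qE => h; field.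
by rewrite scaleN1r opprK /u addrC subrK.
Qed.

Lemma block_first_row n (A : 'M[R]_(1 + n)) (a : R) : A^T = A ->
  (delta_mx 0 0 : 'rV[R]_(1 + n)) *m A = a *: delta_mx 0 0 ->
  A = block_mx a%:M 0 0 (drsubmx A).
Proof.
move=> AT e0A.
have A0 j : A 0 j = a * (j == 0)%:R.
  have /rowP/(_ j) := e0A; rewrite -rowE !mxE => ->.
  by rewrite eqxx.
have Aur : ursubmx A = 0.
  apply/matrixP => i j; rewrite !mxE.
  have -> : lshift n i = 0 by apply/val_inj; rewrite /= ord1.
  by rewrite A0 mulr0.
have Adl : dlsubmx A = 0 by rewrite -[LHS]trmxK trmx_dlsub AT Aur trmx0.
have Aul : ulsubmx A = a%:M.
  apply/matrixP => i j; rewrite !mxE !ord1 eqxx mulr1n.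
  have -> : lshift n 0 = 0 :> 'I_(1 + n) by apply/val_inj.
  by rewrite A0 eqxx mulr1.
by rewrite -[LHS]submxK Aur Adl Aul.
Qed.

(** Induction on the dimension: a reflection sends a unit eigenvector to the
    first basis vector, and symmetry leaves a block-diagonal matrix. *)
Lemma sym_diag n (S : 'M[R]_n) : S^T = S -> exists O : 'M[R]_n, exists g : 'rV[R]_n,
  O *m O^T = 1%:M /\ O *m S *m O^T = diag_mx g.
Proof.
elim: n S => [|n ih] S symS.
  by exists 1%:M, 0; split; apply/matrixP => -[].
have [a /eigenvalueP [w wS w0]] := sym_eigenvalue symS.
pose q := (w *m w^T) 0 0.
have wq : w *m w^T = q%:M by rewrite [LHS]mx11_scalar.
have q0 : 0 < q.
  have qs : q = \sum_i w 0 i ^+ 2.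
    by rewrite /q mxE; apply: eq_bigr => i _; rewrite mxE expr2.
  rewrite lt_def qs sumr_ge0 ?andbT; last by move=> i _; exact: sqr_ge0.
  apply: contra w0; rewrite psumr_eq0; last by move=> i _; exact: sqr_ge0.
  move=> /allP h; apply/eqP/rowP => i; rewrite mxE; apply/eqP; rewrite -sqrf_eq0.
  by have := h i; rewrite mem_index_enum => /(_ isT).
pose v := (Num.sqrt q)^-1 *: w.
have vv : v *m v^T = 1%:M.
  rewrite /v linearZ /= -scalemxAl -scalemxAr wq scalerA -expr2 exprVn sqr_sqrtr ?ltW//.
  by rewrite scale_scalar_mx mulVf// gt_eqF.
have vS : v *m S = a *: v by rewrite /v -scalemxAl wS !scalerA mulrC.
have [H HH eH] := householder vv.
pose A : 'M[R]_(1 + n) := H *m S *m H^T.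
have AT : A^T = A by rewrite /A !trmx_mul trmxK symS mulmxA.
have e0A : (delta_mx 0 0 : 'rV[R]_(1 + n)) *m A = a *: delta_mx 0 0.
  rewrite /A !mulmxA eH vS -scalemxAl; congr (_ *: _).
  by rewrite -[in LHS]eH -mulmxA HH mulmx1.
have Ablk := block_first_row AT e0A.
have symD : (drsubmx A)^T = drsubmx A by rewrite trmx_drsub AT.
have [V [g' [OO' OAO']]] := ih _ symD.
pose B : 'M[R]_(1 + n) := block_mx 1%:M 0 0 V.
have BT : B^T = block_mx 1%:M 0 0 (V^T) by rewrite tr_block_mx trmx1 !trmx0.
have BB : B *m B^T = 1%:M.
  rewrite BT mulmx_block.
  by rewrite !mulmx0 !mul0mx !addr0 add0r mulmx1 OO' -scalar_mx_block.
have BAB : B *m A *m B^T = diag_mx (row_mx a%:M g').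
  rewrite Ablk BT !mulmx_block.
  rewrite !(mulmx0, mul0mx, addr0, add0r, mulmx1, mul1mx) OAO'.
  rewrite diag_mx_row; congr block_mx.
  by apply/matrixP => i j; rewrite !ord1 !mxE.
exists (B *m H), (row_mx a%:M g'); split.
  by rewrite trmx_mul mulmxA -[B *m H *m H^T]mulmxA HH mulmx1.
rewrite trmx_mul -BAB.
by rewrite /A !mulmxA.
Qed.

(** With S = O^T diag(g) O, take L = O^T diag(sqrt g), and M its inverse. *)
Lemma whitening n (S : 'M[R]_n) (lo hi : R) : S^T = S -> 0 < lo ->
  (forall l, eigenvalue S l -> lo <= l <= hi) ->
  exists L M : 'M[R]_n, exists g : 'I_n -> R,
  [/\ forall a, lo <= g a <= hi, M *m L = 1%:M, L *m M = 1%:M, L *m L^T = S &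
     L^T *m L = diag_mx (\row_a g a)].
Proof.
move=> symS lo0 hl; have [ O [g [OO OSO]]] := sym_diag symS.
have OO' : O^T *m O = 1%:M by exact: mulmx1C.
have SE : S = O^T *m diag_mx g *m O.
  by rewrite -OSO !mulmxA OO' mul1mx -mulmxA OO' mulmx1.
have hg a : lo <= g 0 a <= hi.
  apply: hl; apply/eigenvalueP; exists (row a O).
    rewrite SE !mulmxA -row_mul OO row1.
    by rewrite -rowE row_diag_mx -scalemxAl -rowE.
  apply/negP => /eqP h; have /matrixP/(_ a a) := OO; rewrite !mxE eqxx big1.
    by move/eqP; rewrite eq_sym oner_eq0.
  by move=> j _; have /rowP/(_ j) := h; rewrite !mxE => ->; rewrite mul0r.
have g0 a : 0 < g 0 a by have /andP[h _] := hg a; exact: lt_le_trans h.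
pose s : 'rV[R]_n := \row_a Num.sqrt (g 0 a).
pose t : 'rV[R]_n := \row_a (Num.sqrt (g 0 a))^-1.
have ss : diag_mx s *m diag_mx s = diag_mx g.
  rewrite mulmx_diag; congr diag_mx; apply/rowP => a.
  by rewrite !mxE -expr2 sqr_sqrtr// ltW.
have st : diag_mx s *m diag_mx t = 1%:M.
  rewrite mulmx_diag -diag_const_mx; congr diag_mx; apply/rowP => a.
  by rewrite !mxE mulfV// gt_eqF// sqrtr_gt0.
have ts : diag_mx t *m diag_mx s = 1%:M by exact: mulmx1C.
exists (O^T *m diag_mx s), (diag_mx t *m O), (fun a => g 0 a); split => //.
- by rewrite mulmxA -[_ *m O *m O^T]mulmxA OO mulmx1.
- by rewrite mulmxA -[_ *m diag_mx s *m diag_mx t]mulmxA st mulmx1.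
- by rewrite trmx_mul trmxK tr_diag_mx mulmxA -[_ *m diag_mx s *m diag_mx s]mulmxA ss.
- rewrite trmx_mul trmxK tr_diag_mx mulmxA -[_ *m O *m O^T]mulmxA OO mulmx1 ss.
  by congr diag_mx; apply/rowP => a; rewrite mxE.
Qed.

End real_spectral.

(** * Second moments of sums of orthogonal variables *)

Section Ex_sqr_sum_orth.
Context (R : realType) (d0 : measure_display) (T0 : measurableType d0).
Context (P : probability T0 R).

Lemma Ex_sqr_sum_orth (I : finType) (p : pred I) (F : I -> T0 -> R) :
  (forall i, p i -> mom P (F i)) ->
  (forall i j, p i -> p j -> i != j -> Ex P (fun w => F i w * F j w) = 0) ->
  Ex P (fun w => (\sum_(i | p i) F i w) ^+ 2) = \sum_(i | p i) Ex P (fun w => F i w ^+ 2).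
Proof.
move=> mF oF.
rewrite (@eq_Ex _ _ _ _ _ (fun w => \sum_(i | p i) \sum_(j | p j) F i w * F j w)); last first.
  by move=> w; rewrite expr2 mulr_suml; apply: eq_bigr => i _; rewrite mulr_sumr.
rewrite Ex_sum; last first.
  by move=> i pi; apply: mom_sum => j pj; apply: momM; exact: mF.
apply: eq_bigr => i pi; rewrite Ex_sum; last by move=> j pj; apply: momM; exact: mF.
rewrite (bigD1 i)//= [X in _ + X]big1 ?addr0.
  by apply: eq_Ex => w; rewrite expr2.
by move=> j /andP[pj ji]; apply: oF => //; rewrite eq_sym.
Qed.

Lemma sum4_sq (a b c e : R) : (a + b + c + e) ^+ 2 <= 4 * (a ^+ 2 + b ^+ 2 + c ^+ 2 + e ^+ 2).
Proof.
have h (x y : R) : 2 * (x * y) <= x ^+ 2 + y ^+ 2 by have := sqr_ge0 (x - y); nra.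
have := h a b; have := h a c; have := h a e; have := h b c; have := h b e; have := h c e.
have -> : (a + b + c + e) ^+ 2 = a ^+ 2 + b ^+ 2 + c ^+ 2 + e ^+ 2 + 2 * (a * b) +
  2 * (a * c) + 2 * (a * e) + 2 * (b * c) + 2 * (b * e) + 2 * (c * e) by ring.
lra.
Qed.

Lemma Ex_sum4 (f1 f2 f3 f4 : T0 -> R) : mom P f1 -> mom P f2 -> mom P f3 -> mom P f4 ->
  Ex P (fun w => (f1 w + f2 w + f3 w + f4 w) ^+ 2) <=
  4 * (Ex P (fun w => f1 w ^+ 2) + Ex P (fun w => f2 w ^+ 2) +
       Ex P (fun w => f3 w ^+ 2) + Ex P (fun w => f4 w ^+ 2)).
Proof.
move=> m1 m2 m3 m4.
rewrite -!ExD; try (by apply: mom_intg; mom_tac).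
rewrite -ExZ; last by apply: mom_intg; mom_tac.
by apply: le_Ex; try (by apply: mom_intg; mom_tac); move=> w; exact: sum4_sq.
Qed.

Lemma sum_tail_cst (n m : nat) (c : R) :
  \sum_(j < n | (m <= j)%N) c = (n - m)%:R * c.
Proof.
rewrite -(big_geq_mkord m n predT (fun=> c)) big_const_nat iter_addr_0.
by rewrite mulr_natl.
Qed.

(** A nonnegative quadratic polynomial, evaluated at its vertex u / k. *)
Lemma jensen_alg (k u v : R) : 0 < k ->
  (forall x, 0 <= x ^+ 2 * k - 2 * x * u + v) -> u ^+ 2 <= k * v.
Proof.
move=> k0 h; have := h (k^-1 * u).
have -> : (k^-1 * u) ^+ 2 * k - 2 * (k^-1 * u) * u + v = v - u ^+ 2 / k.
  by field; rewrite gt_eqF.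
by rewrite subr_ge0 ler_pdivrMr// mulrC.
Qed.

(** Convexity of the square; the summands may be dependent. *)
Lemma Ex_avg2 (n m : nat) (Y : 'I_n -> T0 -> R) (C : R) : (m < n)%N ->
  (forall j : 'I_n, mom P (Y j)) ->
  (forall j : 'I_n, Ex P (fun w => Y j w ^+ 2) <= C) ->
  Ex P (fun w => ((n - m)%:R^-1 * \sum_(j < n | (m <= j)%N) Y j w) ^+ 2) <= C.
Proof.
move=> mn mY hC; set k : R := (n - m)%:R.
have k0 : 0 < k by rewrite ltr0n subn_gt0.
have mS : mom P (fun w => \sum_(j < n | (m <= j)%N) Y j w) by apply: mom_sum.
have mS2 : mom P (fun w => \sum_(j < n | (m <= j)%N) Y j w ^+ 2).
  by apply: mom_sum => j _; apply: momX.
apply: (@le_trans _ _ (Ex P (fun w => k^-1 * \sum_(j < n | (m <= j)%N) Y j w ^+ 2))).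
  apply: le_Ex; try (by apply: mom_intg; mom_tac).
  move=> w; rewrite exprMn [k^-1 ^+ 2]expr2 -mulrA ler_wpM2l ?invr_ge0 ?(ltW k0)//.
  rewrite ler_pdivrMl//.
  have h (x : R) : 0 <= x ^+ 2 * k - 2 * x * (\sum_(j < n | (m <= j)%N) Y j w)
       + \sum_(j < n | (m <= j)%N) Y j w ^+ 2.
    have -> : x ^+ 2 * k = \sum_(j < n | (m <= j)%N) x ^+ 2 by rewrite sum_tail_cst mulrC.
    rewrite mulr_sumr -sumrN -!big_split; apply: sumr_ge0 => j _ /=.
    have := sqr_ge0 (x - Y j w); nra.
  exact: jensen_alg k0 h.
rewrite ExZ; last exact: mom_intg.
rewrite Ex_sum; last by move=> j _; apply: momX.
rewrite ler_pdivrMl// -sum_tail_cst.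
by apply: ler_sum => j _.
Qed.

End Ex_sqr_sum_orth.

Section sample.
Context (R : realType) (d0 d2 : measure_display).
Context (T0 : measurableType d0) (T2 : measurableType d2).
Context (P : probability T0 R) (N : probability T2 R) (n d : nat).
Context (X : 'I_n -> {RV P >-> T2}) (z : 'I_d -> T2 -> R).
Hypothesis hX : iid_from X N.
Hypothesis hz : std_gauss N z.
Notation QX := (QX X z).
Notation indep_of := (indep_of X).

(** Entry (a, b) of z z^T - I. *)
Definition mm (a b : 'I_d) (x : T2) : R := z a x * z b x - (a == b)%:R.

(** Deterministic weights, seen as random ones. *)
Definition ccst (V : 'I_d -> 'I_d -> R) : 'I_d -> 'I_d -> T0 -> R := fun a b _ => V a b.

Lemma ind_ccst i V a b : indep_of i (ccst V a b).
Proof. exact: ind_cst. Qed.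

Lemma mom_mm a b : mom N (mm a b).
Proof. by apply: momB; [exact: mom_zz|exact: mom_cst]. Qed.

Lemma QX_ind i k (W : 'I_d -> 'I_d -> T0 -> R) : i != k ->
  (forall a b, indep_of k (W a b)) -> indep_of k (QX i W).
Proof.
move=> ik hW; apply: ind_sum => a _; apply: ind_sum => b _; apply: indM => //.
exact: (@ind_X _ _ _ _ _ _ _ _ _ hX k i (mm a b) ik (mom_mm a b)).
Qed.

Lemma mom_QXc i V : mom P (QX i (ccst V)).
Proof. exact: (mom_QX hX hz (ind_ccst i V)). Qed.

Lemma Ex_QXc2 i V : Ex P (fun w => QX i (ccst V) w ^+ 2) <= 2 * fnorm2 V.
Proof.
have [_ h] := X_transfer hX i (mom_intg (momX 2 (mom_Qf hz V))).
by rewrite -[leLHS]/(Ex P ((fun x => Qf z V x ^+ 2) \o X i)) h; exact: Ex_Qf2_le.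
Qed.

Lemma Ex_QXc4 i V : symf V -> Ex P (fun w => QX i (ccst V) w ^+ 4) <= 96 * fnorm2 V ^+ 2.
Proof.
move=> sV.
have [_ h] := X_transfer hX i (mom_intg (momX 4 (mom_Qf hz V))).
by rewrite -[leLHS]/(Ex P ((fun x => Qf z V x ^+ 4) \o X i)) h; exact: Ex_Qf4.
Qed.

Lemma QXc_orth V i j : i != j -> Ex P (fun w => QX i (ccst V) w * QX j (ccst V) w) = 0.
Proof.
move=> ij; apply: (Ex_QX hX hz (ind_ccst j V)).
by apply: QX_ind => // a b; exact: ind_ccst.
Qed.

Lemma Ex_sumQXc2 V (p : pred 'I_n) :
  Ex P (fun w => (\sum_(j | p j) QX j (ccst V) w) ^+ 2) <= \sum_(j < n | p j) 2 * fnorm2 V.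
Proof.
rewrite Ex_sqr_sum_orth; last 2 first.
- by move=> i _; exact: mom_QXc.
- by move=> i j _ _; exact: QXc_orth.
by apply: ler_sum => j _; exact: Ex_QXc2.
Qed.

End sample.

(** * The statistic conditionally on the second sample *)

Section rho.
Context (R : realType) (d0 d2 : measure_display).
Context (T0 : measurableType d0) (T2 : measurableType d2).
Context (P : probability T0 R) (N : probability T2 R) (n d : nat).
Context (X : 'I_n -> {RV P >-> T2}) (z : 'I_d -> T2 -> R).
Hypothesis hX : iid_from X N.
Hypothesis hz : std_gauss N z.
Notation QX := (QX X z).
Notation indep_of := (indep_of X).
Notation mm := (mm z).
Context (g : 'I_d -> R) (m1 : nat) (hi : R).
Hypothesis m1n : (m1 < n)%N.
Hypothesis hg : forall a, 0 < g a <= hi.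

(** The diagonal matrix with entries f. *)
Definition dgf (f : 'I_d -> R) (a b : 'I_d) : R := f a * (a == b)%:R.

Lemma dgf_sum (f : 'I_d -> R) (F : 'I_d -> 'I_d -> R) :
  \sum_a \sum_b dgf f a b * F a b = \sum_a f a * F a a.
Proof.
apply: eq_bigr => a _; rewrite (bigD1 a)//= [X in _ + X]big1 ?addr0.
  by rewrite /dgf eqxx mulr1.
by move=> b ba; rewrite /dgf eq_sym (negbTE ba) mulr0 mul0r.
Qed.

Lemma fnorm2_dgf f : fnorm2 (dgf f) = \sum_a f a ^+ 2.
Proof.
rewrite /fnorm2 (eq_bigr (fun a => \sum_b dgf f a b * dgf f a b)); last first.
  by move=> a _; apply: eq_bigr => b _; rewrite expr2.
rewrite dgf_sum; apply: eq_bigr => a _; by rewrite /dgf eqxx mulr1 expr2.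
Qed.

Lemma symf_dgf f : symf (dgf f).
Proof.
move=> a b; rewrite /dgf [b == a]eq_sym; have [->//|ab] := eqVneq a b.
by rewrite !mulr0.
Qed.

(** The size of the second sample, tr (Sigma^2) and |Sigma - I|_F^2 in terms of
    the eigenvalues g of Sigma. *)
Definition m2 : R := (n - m1)%:R.
Definition gsq : R := \sum_a g a ^+ 2.
Definition gdev : R := \sum_a (g a - 1) ^+ 2.
(** The mean of z z^T - I over the second sample. *)
Definition B (a b : 'I_d) (w : T0) : R :=
  m2^-1 * \sum_(j < n | (m1 <= j)%N) mm a b (X j w).
(** Given the second sample, the statistic of an observation of the first one is
    the quadratic form with weights [cond_weight] plus [cond_mean]; 2 |W|_F^2 is
    its conditional variance, and [rho] is that variance divided by 2 s^2 / m2. *)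
Definition cond_weight (a b : 'I_d) (w : T0) : R :=
  g a * g b * B a b w + dgf (fun a => g a * (g a - 1)) a b.
Definition cond_mean (w : T0) : R := \sum_a g a * (g a - 1) * B a a w + gdev.
Definition rho (w : T0) : R := m2 * fnorm2 (fun a b => cond_weight a b w) / gsq ^+ 2.

Lemma m2_gt0 : 0 < m2. Proof. by rewrite ltr0n subn_gt0. Qed.

(** Grouping the cross terms by their largest index produces a sum of martingale
    differences. *)
Lemma sq_sum_split (y : 'I_n -> R) :
  (\sum_j y j) ^+ 2 = \sum_l y l ^+ 2 + 2 * \sum_l y l * \sum_(j < n | (j < l)%N) y j.
Proof.
have e1 : \sum_l y l * \sum_(j < n | (j < l)%N) y j =
    \sum_l \sum_j y l * y j * (j < l)%:R.
  apply: eq_bigr => l _; rewrite mulr_sumr big_mkcond; apply: eq_bigr => j _ /=.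
  by case: ifP; rewrite ?mulr1 ?mulr0.
have e2 : \sum_l \sum_j y l * y j * (l < j)%:R = \sum_l \sum_j y l * y j * (j < l)%:R.
  rewrite exchange_big; apply: eq_bigr => l _; apply: eq_bigr => j _ /=.
  by rewrite [y j * _]mulrC.
have e3 : \sum_l y l ^+ 2 = \sum_l \sum_j y l * y j * (l == j)%:R.
  apply: eq_bigr => l _; rewrite (bigD1 l)//= eqxx mulr1 [X in _ + X]big1 ?addr0 ?expr2//.
  by move=> j jl; rewrite eq_sym (negbTE jl) mulr0.
rewrite e1 mulr2n mulrDl mul1r -{1}e2 e3 -!big_split expr2 mulr_suml.
apply: eq_bigr => l _; rewrite mulr_sumr -!big_split; apply: eq_bigr => j _ /=.
rewrite -!mulrDr -[l == j]/(val l == val j).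
by case: ltngtP; rewrite ?addr0 ?add0r mulr1.
Qed.

Lemma sq_sum_splitp (p : pred 'I_n) (y : 'I_n -> R) :
  (\sum_(j | p j) y j) ^+ 2 = \sum_(l | p l) y l ^+ 2 +
  2 * \sum_(l | p l) y l * \sum_(j < n | p j && (j < l)%N) y j.
Proof.
pose y' j := if p j then y j else 0.
rewrite big_mkcond -/y' (sq_sum_split y') [in RHS]big_mkcond; congr (_ + _).
  by apply: eq_bigr => l _; rewrite /y'; case: ifP => //; rewrite expr0n.
congr (_ * _); rewrite [RHS]big_mkcond; apply: eq_bigr => l _; rewrite {1}/y'.
case: ifP; rewrite ?mul0r// => pl; congr (_ * _).
rewrite big_mkcond [RHS]big_mkcond; apply: eq_bigr => j _ /=.
by rewrite /y'; case: (p j); case: (j < l)%N.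
Qed.

(** The part of |W|_F^2 mixing observation l of the second sample with earlier
    ones is, up to a constant factor, a quadratic form in X l with these
    weights. *)
Definition past_weight (l : 'I_n) (a b : 'I_d) (w : T0) : R :=
  g a ^+ 2 * g b ^+ 2 * \sum_(j < n | (m1 <= j)%N && (j < l)%N) mm a b (X j w).

Definition E1 := dgf (fun a => g a ^+ 3 * (g a - 1)).
Definition E2 := dgf (fun a => g a ^+ 2).
Definition E4 := dgf (fun a => g a ^+ 4).
Definition gfour : R := \sum_a g a ^+ 4.

(** The expansion of rho - 1.  T1w is linear in B and T2w is the norm of the
    diagonal shift of the weights.  T3w collects the products of distinct
    observations and T4w the squares of single ones, centred by 1.  The
    four terms have second moments of order at most 1 / tr (Sigma^2). *)
Definition T1w w : R := 2 / gsq ^+ 2 * \sum_(j < n | (m1 <= j)%N) QX j (ccst E1) w.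
Definition T2w : R := m2 / gsq ^+ 2 * \sum_a (g a * (g a - 1)) ^+ 2.
Definition T3w w : R := 2 / (m2 * gsq ^+ 2) * \sum_(l < n | (m1 <= l)%N) QX l (past_weight l) w.
Definition Yw (j : 'I_n) w : R :=
  2 / gsq * QX j (ccst E2) w + QX j (ccst E2) w ^+ 2 / gsq ^+ 2
  + (- 2 / gsq ^+ 2) * QX j (ccst E4) w + - (gfour / gsq ^+ 2).
Definition T4w w : R := m2^-1 * \sum_(j < n | (m1 <= j)%N) Yw j w.

Hypothesis sg0 : 0 < gsq.

Lemma QXdgf j f w : QX j (ccst (dgf f)) w = \sum_a f a * (z a (X j w) ^+ 2 - 1).
Proof.
rewrite /QX /Qf /ccst (dgf_sum f (fun a b => z a (X j w) * z b (X j w) - (a == b)%:R)).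
by apply: eq_bigr => a _; rewrite eqxx expr2.
Qed.

(** sum_ab g_a^2 g_b^2 (z_a z_b - delta_ab)^2 is the square of
    sum_a g_a^2 z_a^2, whose mean is s, up to diagonal terms; Yw is what remains
    after subtraction of s^2 and division by s^2. *)
Lemma diag_term (j : 'I_n) w :
  \sum_a \sum_b g a ^+ 2 * g b ^+ 2 * mm a b (X j w) ^+ 2 =
  gsq ^+ 2 * (Yw j w + 1).
Proof.
pose zz a := z a (X j w).
have -> : \sum_a \sum_b g a ^+ 2 * g b ^+ 2 * mm a b (X j w) ^+ 2 =
   (\sum_a g a ^+ 2 * zz a ^+ 2) ^+ 2 + \sum_a g a ^+ 4 * (1 - 2 * zz a ^+ 2).
  have -> : \sum_a g a ^+ 4 * (1 - 2 * zz a ^+ 2) =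
      \sum_a \sum_b dgf (fun=> 1) a b * (g a ^+ 2 * g b ^+ 2 * (1 - 2 * (zz a * zz b))).
    rewrite (dgf_sum (fun=> 1) (fun a b => g a ^+ 2 * g b ^+ 2 * (1 - 2 * (zz a * zz b)))).
    by apply: eq_bigr => a _; ring.
  have -> : (\sum_a g a ^+ 2 * zz a ^+ 2) ^+ 2 =
     \sum_a \sum_b (g a ^+ 2 * zz a ^+ 2) * (g b ^+ 2 * zz b ^+ 2).
    by rewrite expr2 mulr_suml; apply: eq_bigr => a _; rewrite mulr_sumr.
  rewrite -!big_split; apply: eq_bigr => a _; rewrite -!big_split.
  apply: eq_bigr => b _ /=; rewrite /mm /dgf -/(zz a) -/(zz b).
  by case: (a == b) => /=; ring.
have e2 : \sum_a g a ^+ 2 * zz a ^+ 2 = gsq + QX j (ccst E2) w.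
  rewrite /E2 QXdgf /gsq -big_split; apply: eq_bigr => a _ /=.
  by rewrite /zz; ring.
have e4 : \sum_a g a ^+ 4 * (1 - 2 * zz a ^+ 2) = - gfour - 2 * QX j (ccst E4) w.
  rewrite /E4 QXdgf /gfour mulr_sumr -!sumrN -big_split; apply: eq_bigr => a _ /=.
  by rewrite /zz; ring.
rewrite e2 e4 /Yw; move: (QX j (ccst E2) w) (QX j (ccst E4) w) => q2 q4.
by field; rewrite gt_eqF.
Qed.

Lemma rho_decomp w : rho w - 1 = T1w w + T2w + T3w w + T4w w.
Proof.
have m20 := m2_gt0.
pose S a b := \sum_(j < n | (m1 <= j)%N) mm a b (X j w).
have F : fnorm2 (fun a b => cond_weight a b w) =
    (\sum_a \sum_b g a ^+ 2 * g b ^+ 2 * S a b ^+ 2) / m2 ^+ 2 +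
    2 * (\sum_a g a ^+ 3 * (g a - 1) * S a a) / m2 + \sum_a (g a * (g a - 1)) ^+ 2.
  rewrite -(fnorm2_dgf (fun a => g a * (g a - 1))).
  have -> : \sum_a g a ^+ 3 * (g a - 1) * S a a =
     \sum_a \sum_b dgf (fun a => g a * (g a - 1)) a b * (g a * g b * S a b).
    rewrite (dgf_sum _ (fun a b => g a * g b * S a b)).
    by apply: eq_bigr => a _; ring.
  rewrite /fnorm2 mulr_suml mulr_sumr mulr_suml -!big_split; apply: eq_bigr => a _ /=.
  rewrite mulr_suml mulr_sumr mulr_suml -!big_split; apply: eq_bigr => b _ /=.
  rewrite /cond_weight /B -/(S a b); move: (dgf _ a b) (S a b) => t u.
  by field; rewrite gt_eqF.
have G : \sum_a \sum_b g a ^+ 2 * g b ^+ 2 * S a b ^+ 2 =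
   \sum_(l < n | (m1 <= l)%N) (gsq ^+ 2 * (Yw l w + 1)) +
   2 * \sum_(l < n | (m1 <= l)%N) QX l (past_weight l) w.
  have -> : \sum_a \sum_b g a ^+ 2 * g b ^+ 2 * S a b ^+ 2 =
    \sum_a \sum_b (\sum_(l < n | (m1 <= l)%N) g a ^+ 2 * g b ^+ 2 * mm a b (X l w) ^+ 2 +
       2 * \sum_(l < n | (m1 <= l)%N) past_weight l a b w * mm a b (X l w)).
    apply: eq_bigr => a _; apply: eq_bigr => b _.
    rewrite /S sq_sum_splitp mulrDr mulr_sumr; congr (_ + _).
    rewrite mulrCA; congr (_ * _); rewrite mulr_sumr; apply: eq_bigr => l _.
    by rewrite /past_weight; ring.
  rewrite (eq_bigr (fun a => \sum_b \sum_(l < n | (m1 <= l)%N) g a ^+ 2 * g b ^+ 2 * mm a b (X l w) ^+ 2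
    + 2 * \sum_b \sum_(l < n | (m1 <= l)%N) past_weight l a b w * mm a b (X l w))); last first.
    by move=> a _; rewrite big_split /= mulr_sumr.
  rewrite big_split /= -mulr_sumr; congr (_ + _ * _).
    transitivity (\sum_a \sum_(l < n | (m1 <= l)%N) \sum_b g a ^+ 2 * g b ^+ 2 * mm a b (X l w) ^+ 2).
      by apply: eq_bigr => a _; rewrite exchange_big.
    by rewrite exchange_big; apply: eq_bigr => l _; exact: diag_term.
  transitivity (\sum_a \sum_(l < n | (m1 <= l)%N) \sum_b past_weight l a b w * mm a b (X l w)).
    by apply: eq_bigr => a _; rewrite exchange_big.
  by rewrite exchange_big.
have H : \sum_(j < n | (m1 <= j)%N) QX j (ccst E1) w = \sum_a g a ^+ 3 * (g a - 1) * S a a.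
  rewrite /E1; under eq_bigr do rewrite QXdgf.
  rewrite exchange_big; apply: eq_bigr => a _; rewrite /S mulr_sumr.
  by apply: eq_bigr => j _; rewrite /mm eqxx expr2.
have K : \sum_(l < n | (m1 <= l)%N) (gsq ^+ 2 * (Yw l w + 1)) =
   gsq ^+ 2 * (\sum_(l < n | (m1 <= l)%N) Yw l w + m2).
  rewrite -mulr_sumr big_split /=; congr (_ * (_ + _)).
  by rewrite sum_tail_cst mulr1.
rewrite /rho F G K /T1w H /T2w /T3w /T4w.
move: (\sum_(l < n | _) Yw l w) (\sum_(l < n | _) QX _ _ _) => u1 u2.
move: (\sum_a _) (\sum_a _) => u3 u4.
by field; rewrite !gt_eqF.
Qed.

Lemma mom_mmX a b j : mom P (fun w => mm a b (X j w)).
Proof. exact: (mom_X hX j (mom_mm hz a b)). Qed.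

Lemma ind_mmX i j a b : j != i -> indep_of i (fun w => mm a b (X j w)).
Proof. by move=> ji; exact: (@ind_X _ _ _ _ _ _ _ _ _ hX i j (mm a b) ji (mom_mm hz a b)). Qed.

Lemma ind_B (i : 'I_n) a b : (i < m1)%N -> indep_of i (B a b).
Proof.
move=> im; apply: indM; first exact: ind_cst.
apply: ind_sum => j mj; apply: ind_mmX.
by apply: contraTneq mj => ->; rewrite -ltnNge.
Qed.

Lemma mom_B a b : mom P (B a b).
Proof. by apply: momM; [exact: mom_cst|apply: mom_sum => j _; exact: mom_mmX]. Qed.

Lemma ind_cond_weight (i : 'I_n) a b : (i < m1)%N -> indep_of i (cond_weight a b).
Proof.
move=> im; apply: indD; last exact: ind_cst.
by apply: indM; [exact: ind_cst|exact: ind_B].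
Qed.

Lemma mom_cond_weight a b : mom P (cond_weight a b).
Proof. by have h := mom_B a b; rewrite /cond_weight; mom_tac. Qed.

Lemma sym_cond_weight a b w : cond_weight a b w = cond_weight b a w.
Proof.
rewrite /cond_weight /B [g b * g a]mulrC (symf_dgf _ a b); congr (_ * (_ * _) + _).
by apply: eq_bigr => j _; rewrite /mm [z b _ * _]mulrC [b == a]eq_sym.
Qed.

Lemma mom_fnormW : mom P (fun w => fnorm2 (fun a b => cond_weight a b w)).
Proof.
by apply: mom_sum => a _; apply: mom_sum => b _; apply: momX; exact: mom_cond_weight.
Qed.

Lemma mom_rho : mom P rho.
Proof. by have h := mom_fnormW; rewrite /rho; mom_tac. Qed.

Lemma ind_rho (i : 'I_n) : (i < m1)%N -> indep_of i rho.
Proof.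
move=> im; apply: indM; last exact: ind_cst.
apply: indM; first exact: ind_cst.
apply: ind_fnorm2 => a b; exact: ind_cond_weight.
Qed.

Lemma ind_past_weight (i l : 'I_n) a b : (l <= i)%N -> indep_of i (past_weight l a b).
Proof.
move=> li; apply: indM; first exact: ind_cst.
apply: ind_sum => j /andP[_ jl]; apply: ind_mmX.
by apply: contraTneq (leq_trans jl li) => ->; rewrite ltnn.
Qed.

Lemma sym_past_weight l a b w : past_weight l a b w = past_weight l b a w.
Proof.
rewrite /past_weight [g b ^+ 2 * _]mulrC; congr (_ * _).
by apply: eq_bigr => j _; rewrite /mm [z b _ * _]mulrC [b == a]eq_sym.
Qed.

Lemma mmQX a b j w :
  mm a b (X j w) = QX j (ccst (fun c e => (c == a)%:R * (e == b)%:R)) w.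
Proof.
rewrite /QX /Qf /ccst (bigD1 a)//= [X in _ = _ + X]big1 ?addr0; last first.
  by move=> c /negbTE ca; rewrite big1// => e _; rewrite ca !mul0r.
rewrite (bigD1 b)//= [X in _ = _ + X]big1 ?addr0; first by rewrite !eqxx !mul1r.
by move=> e /negbTE eb; rewrite eb mulr0 mul0r.
Qed.

Lemma fnorm2_unit (a b : 'I_d) :
  fnorm2 (fun c e => (c == a)%:R * (e == b)%:R : R) = 1.
Proof.
rewrite /fnorm2 (bigD1 a)//= [X in _ + X]big1 ?addr0; last first.
  by move=> c /negbTE ca; rewrite big1// => e _; rewrite ca !mul0r expr0n.
rewrite (bigD1 b)//= [X in _ + X]big1 ?addr0; first by rewrite !eqxx mul1r expr1n.
by move=> e /negbTE eb; rewrite eb mulr0 expr0n.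
Qed.

Lemma Ex_sum_mm2 a b (l : 'I_n) :
  Ex P (fun w => (\sum_(j < n | (m1 <= j)%N && (j < l)%N) mm a b (X j w)) ^+ 2) <= 2 * m2.
Proof.
rewrite (@eq_Ex _ _ _ _ _ (fun w => (\sum_(j < n | (m1 <= j)%N && (j < l)%N)
   QX j (ccst (fun c e => (c == a)%:R * (e == b)%:R)) w) ^+ 2)); last first.
  by move=> w; congr (_ ^+ 2); apply: eq_bigr => j _; exact: mmQX.
apply: (le_trans (Ex_sumQXc2 hX hz _ _)); rewrite fnorm2_unit mulr1.
rewrite mulrC /m2 -sum_tail_cst big_mkcond [leRHS]big_mkcond.
by apply: ler_sum => j _; case: (m1 <= j)%N; case: (j < l)%N.
Qed.

Lemma Ex_fnorm2_past l : Ex P (fun w => fnorm2 (fun a b => past_weight l a b w)) <= 2 * m2 * gfour ^+ 2.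
Proof.
have mS a b : mom P (fun w => (\sum_(j < n | (m1 <= j)%N && (j < l)%N) mm a b (X j w)) ^+ 2).
  by apply: momX; apply: mom_sum => j _; exact: mom_mmX.
rewrite (@eq_Ex _ _ _ _ _ (fun w => \sum_a \sum_b (g a ^+ 4 * g b ^+ 4) *
   (\sum_(j < n | (m1 <= j)%N && (j < l)%N) mm a b (X j w)) ^+ 2)); last first.
  move=> w; apply: eq_bigr => a _; apply: eq_bigr => b _; rewrite /past_weight; ring.
rewrite Ex_sum; last by move=> a _; apply: mom_sum => b _; apply: momM; [exact: mom_cst|].
rewrite expr2 {1}/gfour mulrA mulr_sumr mulr_suml; apply: ler_sum => a _.
rewrite Ex_sum; last by move=> b _; apply: momM; [exact: mom_cst|].
rewrite /gfour mulr_sumr; apply: ler_sum => b _.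
rewrite ExZ; last exact: mom_intg.
have h : 0 <= g a ^+ 4 * g b ^+ 4 by rewrite mulr_ge0// exprn_even_ge0.
rewrite [leRHS](_ : _ = g a ^+ 4 * g b ^+ 4 * (2 * m2)); last by ring.
by rewrite ler_wpM2l// Ex_sum_mm2.
Qed.

Lemma mom_QX_past l : mom P (QX l (past_weight l)).
Proof. by apply: (mom_QX hX hz) => a b; apply: ind_past_weight. Qed.

Lemma Ex_T1w : Ex P (fun w => T1w w ^+ 2) <= 8 * m2 / gsq ^+ 4 * fnorm2 E1.
Proof.
rewrite (@eq_Ex _ _ _ _ _ (fun w => (2 / gsq ^+ 2) ^+ 2 *
  (\sum_(j < n | (m1 <= j)%N) QX j (ccst E1) w) ^+ 2)); last first.
  by move=> w; rewrite /T1w exprMn.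
rewrite ExZ; last first.
  by apply/mom_intg/momX/mom_sum => j _; exact: mom_QXc hX hz _ _.
apply: (@le_trans _ _ ((2 / gsq ^+ 2) ^+ 2 * (m2 * (2 * fnorm2 E1)))).
  rewrite ler_wpM2l ?sqr_ge0//.
  by apply: (le_trans (Ex_sumQXc2 hX hz _ _)); rewrite sum_tail_cst.
rewrite le_eqVlt; apply/orP; left; apply/eqP.
by field; rewrite gt_eqF.
Qed.

(** The forms QX l (past_weight l) are orthogonal: the weights for the larger
    index involve the smaller one, not conversely. *)
Lemma Ex_T3w : Ex P (fun w => T3w w ^+ 2) <= 16 * gfour ^+ 2 / gsq ^+ 4.
Proof.
have m20 := m2_gt0.
rewrite (@eq_Ex _ _ _ _ _ (fun w => (2 / (m2 * gsq ^+ 2)) ^+ 2 *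
  (\sum_(j < n | (m1 <= j)%N) QX j (past_weight j) w) ^+ 2)); last first.
  by move=> w; rewrite /T3w exprMn.
rewrite ExZ; last by apply/mom_intg/momX/mom_sum => j _; exact: mom_QX_past.
rewrite Ex_sqr_sum_orth; last 2 first.
- by move=> i _; exact: mom_QX_past.
- move=> i j _ _.
  have key (k l : 'I_n) : (k < l)%N -> Ex P (fun w => QX k (past_weight k) w * QX l (past_weight l) w) = 0.
    move=> kl; apply: (Ex_QX hX hz); first by move=> a b; exact: ind_past_weight.
    apply: (QX_ind hX hz); last by move=> a b; apply: ind_past_weight; exact: ltnW.
    by rewrite -(inj_eq val_inj) /= ltn_eqF.
  rewrite -(inj_eq val_inj) /= neq_ltn => /orP[|] ij; first exact: key.
  by rewrite -[RHS](key _ _ ij); apply: eq_Ex => w; rewrite mulrC.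
apply: (@le_trans _ _ ((2 / (m2 * gsq ^+ 2)) ^+ 2 * (m2 * (2 * (2 * m2 * gfour ^+ 2))))).
  rewrite ler_wpM2l ?sqr_ge0// /m2 -sum_tail_cst; apply: ler_sum => l _.
  rewrite (@eq_Ex _ _ _ _ _ (fun w => 1 * QX l (past_weight l) w ^+ 2)); last by move=> w; rewrite mul1r.
  rewrite (Ex_QX2 hX hz)//; [|by move=> a b; exact: ind_past_weight|exact: ind_cst|by move=> a b w; exact: sym_past_weight].
  rewrite (@eq_Ex _ _ _ _ _ (fun w => 2 * fnorm2 (fun a b => past_weight l a b w))); last by move=> w; rewrite mul1r.
  rewrite ExZ; first by rewrite ler_wpM2l// Ex_fnorm2_past.
  apply: mom_intg; apply: ind_mom; apply: (@ind_fnorm2 _ _ _ _ _ _ _ _ _ l) => a b.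
  exact: ind_past_weight.
rewrite le_eqVlt; apply/orP; left; apply/eqP.
by field; rewrite !gt_eqF.
Qed.

Lemma mom_Yw j : mom P (Yw j).
Proof.
have h2 := mom_QXc hX hz j E2; have h4 := mom_QXc hX hz j E4.
by rewrite /Yw; mom_tac.
Qed.

Lemma Ex_Yw j : Ex P (fun w => Yw j w ^+ 2) <=
  4 * (8 * gfour / gsq ^+ 2 + 96 * gfour ^+ 2 / gsq ^+ 4 + 8 / gsq ^+ 4 * fnorm2 E4 + gfour ^+ 2 / gsq ^+ 4).
Proof.
have h2 := mom_QXc hX hz j E2; have h4 := mom_QXc hX hz j E4.
have fE2 : fnorm2 E2 = gfour.
  by rewrite fnorm2_dgf; apply: eq_bigr => a _; rewrite -exprM.
rewrite /Yw.
have a1 : mom P (fun w => 2 / gsq * QX j (ccst E2) w) by mom_tac.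
have a2 : mom P (fun w => QX j (ccst E2) w ^+ 2 / gsq ^+ 2) by mom_tac.
have a3 : mom P (fun w => (- 2 / gsq ^+ 2) * QX j (ccst E4) w) by mom_tac.
apply: (le_trans (Ex_sum4 a1 a2 a3 (mom_cst P (- (gfour / gsq ^+ 2))))).
have s2 : 0 < gsq ^+ 2 by rewrite exprn_gt0.
rewrite ler_wpM2l// !lerD//.
- rewrite (@eq_Ex _ _ _ _ _ (fun w => 4 / gsq ^+ 2 * QX j (ccst E2) w ^+ 2)); last first.
    by move=> w; field; rewrite gt_eqF.
  rewrite ExZ; last exact/mom_intg/momX.
  rewrite [leRHS](_ : _ = 4 / gsq ^+ 2 * (2 * gfour)); last by field; rewrite gt_eqF.
  rewrite ler_wpM2l ?divr_ge0 ?(ltW s2)// -fE2; exact: Ex_QXc2 hX hz _ _.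
- rewrite (@eq_Ex _ _ _ _ _ (fun w => (gsq ^+ 4)^-1 * QX j (ccst E2) w ^+ 4)); last first.
    by move=> w; field; rewrite gt_eqF.
  rewrite ExZ; last exact/mom_intg/momX.
  rewrite [leRHS]mulrC ler_wpM2l ?invr_ge0 ?exprn_even_ge0// -fE2.
  exact: (Ex_QXc4 hX hz j (symf_dgf _)).
- rewrite (@eq_Ex _ _ _ _ _ (fun w => 4 / gsq ^+ 4 * QX j (ccst E4) w ^+ 2)); last first.
    by move=> w; field; rewrite gt_eqF.
  rewrite ExZ; last exact/mom_intg/momX.
  rewrite [leRHS](_ : _ = 4 / gsq ^+ 4 * (2 * fnorm2 E4)); last by field; rewrite gt_eqF.
  rewrite ler_wpM2l ?divr_ge0 ?exprn_even_ge0//; exact: Ex_QXc2 hX hz _ _.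
- rewrite Ex_cst le_eqVlt; apply/orP; left; apply/eqP.
  by field; rewrite gt_eqF.
Qed.

Lemma gfour_le : gfour <= hi ^+ 2 * gsq.
Proof.
rewrite /gfour /gsq mulr_sumr; apply: ler_sum => a _.
have /andP[g0 gh] := hg a.
rewrite (exprM _ 2 2) expr2 ler_wpM2r ?sqr_ge0//.
by rewrite lerXn2r ?nnegrE ?(ltW g0)// (le_trans (ltW g0)).
Qed.

Lemma fnorm2_E4_le : fnorm2 E4 <= hi ^+ 6 * gsq.
Proof.
rewrite fnorm2_dgf /gsq mulr_sumr; apply: ler_sum => a _.
have /andP[g0 gh] := hg a.
rewrite -exprM (exprD _ 6 2) ler_wpM2r ?sqr_ge0//.
by rewrite lerXn2r ?nnegrE ?(ltW g0)// (le_trans (ltW g0)).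
Qed.

Lemma fnorm2_E1_le : fnorm2 E1 <= hi ^+ 6 * gdev.
Proof.
rewrite fnorm2_dgf /gdev mulr_sumr; apply: ler_sum => a _.
have /andP[g0 gh] := hg a.
rewrite exprMn -exprM ler_wpM2r ?sqr_ge0//.
by rewrite lerXn2r ?nnegrE ?(ltW g0)// (le_trans (ltW g0)).
Qed.

Lemma sum_g_gm1_le : \sum_a (g a * (g a - 1)) ^+ 2 <= hi ^+ 2 * gdev.
Proof.
rewrite /gdev mulr_sumr; apply: ler_sum => a _.
have /andP[g0 gh] := hg a.
rewrite exprMn ler_wpM2r ?sqr_ge0//.
by rewrite lerXn2r ?nnegrE ?(ltW g0)// (le_trans (ltW g0)).
Qed.

Hypothesis hi0 : 0 < hi.
Hypothesis m10 : (0 < m1)%N.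

Lemma gdev_ge0 : 0 <= gdev.
Proof. by apply: sumr_ge0 => a _; exact: sqr_ge0. Qed.

Lemma gfour_ge0 : 0 <= gfour.
Proof. by apply: sumr_ge0 => a _; rewrite exprn_even_ge0. Qed.

Definition rho_bound (c K : R) : R := 4 * (8 * c * (hi ^+ 6 * K) + (c * (hi ^+ 2 * K)) ^+ 2
  + 16 * hi ^+ 4 + 4 * (8 * hi ^+ 2 + 97 * hi ^+ 4 + 8 * hi ^+ 6)).

(** Each of the four terms of [rho_decomp] is bounded using that sums of higher
    powers of g are at most powers of hi times s, and that m2 <= c s and
    Delta <= K. *)
Lemma Ex_rho_near1 (c K : R) : 1 <= gsq -> m2 <= c * gsq -> gdev <= K ->
  Ex P (fun w => (rho w - 1) ^+ 2) <= rho_bound c K / gsq.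
Proof.
move=> sg1 m2c dK; have m20 := m2_gt0; have d0' := gdev_ge0.
have c0 : 0 <= c by have := lt_le_trans m20 m2c; rewrite pmulr_lgt0// => /ltW.
have K0 : 0 <= K by exact: le_trans dK.
have h6 : 0 <= hi ^+ 6 by rewrite exprn_even_ge0.
have h4 : 0 <= hi ^+ 4 by rewrite exprn_even_ge0.
have h2 : 0 <= hi ^+ 2 by rewrite sqr_ge0.
have hs : 0 <= hi ^+ 2 * gsq by rewrite mulr_ge0// ltW.
have mT1 : mom P T1w.
  by rewrite /T1w; apply: momM; [exact: mom_cst|apply: mom_sum => j _; exact: mom_QXc hX hz _ _].
have mT3 : mom P T3w.
  by rewrite /T3w; apply: momM; [exact: mom_cst|apply: mom_sum => j _; exact: mom_QX_past].
have mT4 : mom P T4w.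
  by rewrite /T4w; apply: momM; [exact: mom_cst|apply: mom_sum => j _; exact: mom_Yw].
rewrite (@eq_Ex _ _ _ _ _ (fun w => (T1w w + T2w + T3w w + T4w w) ^+ 2)); last first.
  by move=> w; rewrite rho_decomp.
apply: (le_trans (Ex_sum4 mT1 (mom_cst P T2w) mT3 mT4)).
pose r := gsq^-1.
have r0 : 0 < r by rewrite invr_gt0.
have r1 : r <= 1 by rewrite invf_le1.
have rs : r * gsq = 1 by rewrite mulVf// gt_eqF.
have r2 : r ^+ 2 <= r by rewrite expr2 ler_piMr// ltW.
have r3 : r ^+ 3 <= r by rewrite exprS ler_piMr ?(ltW r0)// exprn_ile1// ltW.
rewrite [leRHS](_ : _ = 4 * (8 * (c * (hi ^+ 6 * K)) * r + (c * (hi ^+ 2 * K)) ^+ 2 * r +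
   16 * hi ^+ 4 * r + 4 * (8 * hi ^+ 2 * r + 97 * (hi ^+ 4 * r) + 8 * hi ^+ 6 * r))); last first.
  by rewrite /rho_bound -/r; ring.
rewrite ler_wpM2l// !lerD//.
- apply: (le_trans Ex_T1w).
  apply: (@le_trans _ _ (8 * (c * gsq) * r ^+ 4 * (hi ^+ 6 * K))).
    apply: ler_pM => //; rewrite ?fnorm2_ge0//.
    + by rewrite !mulr_ge0// ?invr_ge0 ?exprn_even_ge0// ltW.
    + by rewrite -exprVn -/r ler_wpM2r ?exprn_even_ge0// ler_wpM2l.
    + by apply: (le_trans fnorm2_E1_le); rewrite ler_wpM2l.
  rewrite (_ : 8 * (c * gsq) * r ^+ 4 * (hi ^+ 6 * K) = 8 * (c * (hi ^+ 6 * K)) * r ^+ 3 * (r * gsq)); last by ring.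
  rewrite rs mulr1; apply: ler_wpM2l => //.
  by apply: mulr_ge0 => //; apply: mulr_ge0 => //; exact: mulr_ge0.
- rewrite Ex_cst.
  have t0 : 0 <= T2w.
    rewrite /T2w mulr_ge0 ?divr_ge0 ?(ltW m20) ?sqr_ge0//.
    by apply: sumr_ge0 => a _; exact: sqr_ge0.
  have tt : T2w <= c * (hi ^+ 2 * K) * r.
    apply: (@le_trans _ _ (c * gsq * r ^+ 2 * (hi ^+ 2 * K))).
      apply: ler_pM => //.
      + by rewrite divr_ge0 ?(ltW m20) ?sqr_ge0.
      + by apply: sumr_ge0 => a _; exact: sqr_ge0.
      + by rewrite -exprVn -/r ler_wpM2r ?sqr_ge0.
      + by apply: (le_trans sum_g_gm1_le); rewrite ler_wpM2l.
    rewrite (_ : c * gsq * r ^+ 2 * (hi ^+ 2 * K) = c * (hi ^+ 2 * K) * r * (r * gsq)); last by ring.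
    by rewrite rs mulr1.
  apply: (@le_trans _ _ ((c * (hi ^+ 2 * K)) ^+ 2 * r ^+ 2)).
    have q0 : 0 <= c * (hi ^+ 2 * K) * r.
      by rewrite mulr_ge0 ?(ltW r0)// mulr_ge0// mulr_ge0.
    by rewrite -exprMn lerXn2r ?nnegrE.
  by rewrite ler_wpM2l ?sqr_ge0.
- apply: (le_trans Ex_T3w).
  apply: (@le_trans _ _ (16 * (hi ^+ 2 * gsq) ^+ 2 * r ^+ 4)).
    rewrite -exprVn -/r ler_wpM2r ?exprn_even_ge0// ler_wpM2l//.
    by apply: lerXn2r; rewrite ?nnegrE ?gfour_ge0 ?gfour_le.
  rewrite (_ : 16 * (hi ^+ 2 * gsq) ^+ 2 * r ^+ 4 = 16 * hi ^+ 4 * r ^+ 2 * (r * gsq) ^+ 2); last by ring.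
  by rewrite rs expr1n mulr1 ler_wpM2l// mulr_ge0.
apply: (@le_trans _ _ (4 * (8 * gfour / gsq ^+ 2 + 96 * gfour ^+ 2 / gsq ^+ 4 +
    8 / gsq ^+ 4 * fnorm2 E4 + gfour ^+ 2 / gsq ^+ 4))).
  by apply: (Ex_avg2 m1n); [exact: mom_Yw|exact: Ex_Yw].
rewrite ler_wpM2l// -!exprVn -/r.
have b1 : 8 * gfour * r ^+ 2 <= 8 * hi ^+ 2 * r.
  apply: (@le_trans _ _ (8 * (hi ^+ 2 * gsq) * r ^+ 2)).
    by rewrite ler_wpM2r ?sqr_ge0// ler_wpM2l// gfour_le.
  rewrite (_ : 8 * (hi ^+ 2 * gsq) * r ^+ 2 = 8 * hi ^+ 2 * r * (r * gsq)); last by ring.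
  by rewrite rs mulr1.
have b2 : gfour ^+ 2 * r ^+ 4 <= hi ^+ 4 * r.
  apply: (@le_trans _ _ ((hi ^+ 2 * gsq) ^+ 2 * r ^+ 4)).
    rewrite ler_wpM2r ?exprn_even_ge0//.
    by apply: lerXn2r; rewrite ?nnegrE ?gfour_ge0 ?gfour_le.
  rewrite (_ : (hi ^+ 2 * gsq) ^+ 2 * r ^+ 4 = hi ^+ 4 * r ^+ 2 * (r * gsq) ^+ 2); last by ring.
  by rewrite rs expr1n mulr1 ler_wpM2l.
have b3 : 8 * r ^+ 4 * fnorm2 E4 <= 8 * hi ^+ 6 * r.
  apply: (@le_trans _ _ (8 * r ^+ 4 * (hi ^+ 6 * gsq))).
    by rewrite ler_wpM2l ?fnorm2_E4_le// mulr_ge0// exprn_even_ge0.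
  rewrite (_ : 8 * r ^+ 4 * (hi ^+ 6 * gsq) = 8 * hi ^+ 6 * r ^+ 3 * (r * gsq)); last by ring.
  by rewrite rs mulr1 ler_wpM2l// mulr_ge0.
rewrite -[96 * gfour ^+ 2 * _]mulrA.
move: (8 * gfour * _) (gfour ^+ 2 * _) (8 * r ^+ 4 * _) b1 b2 b3 => x1 x2 x3 b1 b2 b3.
lra.
Qed.

Definition cond_var : R := 2 * gsq ^+ 2 / m2.
Definition cond_sd : R := Num.sqrt cond_var.
Definition sqrt_m1 : R := Num.sqrt m1%:R.
(** The k-th quadratic form of the first sample, divided by sqrt m1 times the
    deterministic standard deviation [cond_sd].  It is indexed by naturals, with
    value 0 beyond n, as the central limit theorem expects. *)
Definition xi (k : nat) (w : T0) : R :=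
  if insub k is Some i then QX (i : 'I_n) cond_weight w / (sqrt_m1 * cond_sd) else 0.
(** On the scale of the sum of the xi k: the shift, and its limit, obtained by
    replacing [cond_mean] by Delta. *)
Definition drift (w : T0) : R := sqrt_m1 * cond_mean w / cond_sd.
Definition drift_lim : R := sqrt_m1 * gdev / cond_sd.
Notation S := (psum xi).

Lemma cond_var_gt0 : 0 < cond_var.
Proof. by rewrite divr_gt0 ?m2_gt0// mulr_gt0// exprn_gt0. Qed.

Lemma cond_sd_gt0 : 0 < cond_sd. Proof. by rewrite sqrtr_gt0 cond_var_gt0. Qed.

Lemma sqrt_m1_gt0 : 0 < sqrt_m1. Proof. by rewrite sqrtr_gt0 ltr0n. Qed.

Lemma cond_sd_sqr : cond_sd ^+ 2 = cond_var. Proof. by rewrite sqr_sqrtr// ltW// cond_var_gt0. Qed.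

Lemma sqrt_m1_sqr : sqrt_m1 ^+ 2 = m1%:R. Proof. by rewrite sqr_sqrtr. Qed.

Lemma xiE (i : 'I_n) w : xi i w = QX i cond_weight w / (sqrt_m1 * cond_sd).
Proof. by rewrite /xi valK. Qed.

Lemma xi_ord k : (k < m1)%N -> exists2 i : 'I_n, val i = k & (i < m1)%N.
Proof. by move=> km; exists (Ordinal (ltn_trans km m1n)). Qed.

Lemma sum_ord_lt (F : nat -> R) k : (k <= n)%N ->
  \sum_(i < k) F i = \sum_(i < n | (i < k)%N) F i.
Proof. by move=> kn; rewrite (big_ord_widen n F kn). Qed.

Lemma mom_QXW (i : 'I_n) : (i < m1)%N -> mom P (QX i cond_weight).
Proof. by move=> im; apply: (mom_QX hX hz) => a b; exact: ind_cond_weight. Qed.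

Lemma mom_xi k : (k < m1)%N -> mom P (xi k).
Proof.
move=> /xi_ord[i <- im]; have h := mom_QXW im.
rewrite (_ : xi i = fun w => QX i cond_weight w / (sqrt_m1 * cond_sd)); first by mom_tac.
by apply/funext => w; rewrite xiE.
Qed.

Lemma ind_xi (i k : 'I_n) : (i < m1)%N -> (k < m1)%N -> i != k -> indep_of k (xi i).
Proof.
move=> im km ik.
rewrite (_ : xi i = fun w => QX i cond_weight w * (sqrt_m1 * cond_sd)^-1); last first.
  by apply/funext => w; rewrite xiE.
apply: indM; last exact: ind_cst.
by apply: (QX_ind hX hz) => // a b; exact: ind_cond_weight.
Qed.

Lemma rho_xi w : 2 * fnorm2 (fun a b => cond_weight a b w) / (sqrt_m1 * cond_sd) ^+ 2 = rho w / m1%:R.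
Proof.
have m20 := m2_gt0; rewrite exprMn sqrt_m1_sqr cond_sd_sqr /cond_var /rho.
by field; rewrite !gt_eqF// ltr0n.
Qed.

Lemma xi_cond2 (i : 'I_n) h : (i < m1)%N -> indep_of i h ->
  Ex P (fun w => h w * xi i w ^+ 2) = Ex P (fun w => h w * (rho w / m1%:R)).
Proof.
move=> im hh.
have hW a b : indep_of i (cond_weight a b) by exact: ind_cond_weight.
pose h' w := h w * ((sqrt_m1 * cond_sd) ^+ 2)^-1.
have hh' : indep_of i h' by apply: indM => //; exact: ind_cst.
rewrite (@eq_Ex _ _ _ _ _ (fun w => h' w * QX i cond_weight w ^+ 2)); last first.
  by move=> w; rewrite xiE exprMn exprVn /h' -[RHS]mulrA [_^-1 * _]mulrC.
rewrite (Ex_QX2 hX hz hW hh' sym_cond_weight); apply: eq_Ex => w.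
by rewrite -rho_xi /h' -[LHS]mulrA [_^-1 * _]mulrC.
Qed.

Lemma xi_cond1 (i : 'I_n) h : (i < m1)%N -> indep_of i h ->
  Ex P (fun w => h w * xi i w) = 0.
Proof.
move=> im hh.
have hW a b : indep_of i (cond_weight a b) by exact: ind_cond_weight.
pose h' w := h w * (sqrt_m1 * cond_sd)^-1.
have hh' : indep_of i h' by apply: indM => //; exact: ind_cst.
rewrite -(Ex_QX hX hz hW hh'); apply: eq_Ex => w.
by rewrite xiE /h' -[RHS]mulrA [_^-1 * _]mulrC.
Qed.

(** The partial sum of the first k terms involves X 0 .. X (k - 1) and the
    second sample, hence not X k. *)
Lemma mdiff_xi : mdiff P m1 xi rho.
Proof.
have indS (i : 'I_n) (h : R -> R) : (i < m1)%N -> measurable_fun setT h ->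
    (exists M, forall x, `|h x| <= M) -> indep_of i (fun w => h (S i w)).
  move=> im mh [M hM]; apply: (@ind_bcomp _ _ _ _ _ _ _ _ _ _ _ M) => //.
  rewrite (_ : S i = fun w => \sum_(j < n | (j < i)%N) xi j w); last first.
    by apply/funext => w; rewrite /psum (sum_ord_lt (fun j => xi j w) (ltnW (ltn_ord i))).
  apply: ind_sum => j ji; apply: ind_xi => //; first exact: ltn_trans ji im.
  by rewrite -(inj_eq val_inj) /= ltn_eqF.
split.
- exact: mom_xi.
- exact: mom_rho.
- move=> k h /xi_ord[i <- im] mh hM.
  by apply: (@xi_cond1 i (fun w => h (S i w))) => //; exact: indS.
- move=> k h /xi_ord[i <- im] mh hM.
  by apply: (@xi_cond2 i (fun w => h (S i w))) => //; exact: indS.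
Qed.

Lemma Ex_xi2 k : (k < m1)%N -> Ex P (fun w => xi k w ^+ 2) = Ex P rho / m1%:R.
Proof.
move=> /xi_ord[i <- im].
rewrite (@eq_Ex _ _ _ _ _ (fun w => 1 * xi i w ^+ 2)); last by move=> w; rewrite mul1r.
rewrite (xi_cond2 im (ind_cst _ _ _)) mulrC -ExZ; last exact/mom_intg/mom_rho.
by apply: eq_Ex => w; rewrite mul1r mulrC.
Qed.

Lemma Ex_xi4 k : (k < m1)%N ->
  Ex P (fun w => xi k w ^+ 4) <= 24 * Ex P (fun w => rho w ^+ 2) / m1%:R ^+ 2.
Proof.
move=> /xi_ord[i <- im]; have m0 : 0 < m1%:R :> R by rewrite ltr0n.
have c0 : 0 < sqrt_m1 * cond_sd by rewrite mulr_gt0 ?sqrt_m1_gt0 ?cond_sd_gt0.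
have hW a b : indep_of i (cond_weight a b) by exact: ind_cond_weight.
rewrite (@eq_Ex _ _ _ _ _ (fun w => ((sqrt_m1 * cond_sd) ^+ 4)^-1 * QX i cond_weight w ^+ 4)); last first.
  by move=> w; rewrite xiE exprMn exprVn mulrC.
rewrite ExZ; last by apply/mom_intg/momX; exact: mom_QXW.
have h4 := Ex_QX4 hX hz hW sym_cond_weight.
apply: (@le_trans _ _ (((sqrt_m1 * cond_sd) ^+ 4)^-1 * (96 * Ex P (fun w => fnorm2 (fun a b => cond_weight a b w) ^+ 2)))).
  by rewrite ler_wpM2l// invr_ge0 exprn_even_ge0.
have -> : 24 * Ex P (fun w => rho w ^+ 2) / m1%:R ^+ 2 = 24 * Ex P (fun w => (rho w / m1%:R) ^+ 2).
  rewrite -mulrA; congr (_ * _); rewrite mulrC -ExZ; last exact/mom_intg/momX/mom_rho.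
  by apply: eq_Ex => w; move: (rho w) => x; rewrite exprMn exprVn mulrC.
have -> : Ex P (fun w => (rho w / m1%:R) ^+ 2) =
   4 / (sqrt_m1 * cond_sd) ^+ 4 * Ex P (fun w => fnorm2 (fun a b => cond_weight a b w) ^+ 2).
  rewrite -ExZ; last exact/mom_intg/momX/mom_fnormW.
  apply: eq_Ex => w; rewrite -rho_xi; move: (sqrt_m1 * cond_sd) (fnorm2 _) c0 => x y x0; field; by rewrite gt_eqF.
rewrite le_eqVlt; apply/orP; left; apply/eqP.
by move: (sqrt_m1 * cond_sd) (Ex P _) c0 => x e x0; field; rewrite gt_eqF.
Qed.

(** |x|^3 <= x^2 / r + r x^4 with r = sqrt m1, for which the two terms have the
    same order. *)
Lemma Ex_xi3 k : (k < m1)%N -> Ex P (fun w => `|xi k w| ^+ 3) <=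
  ((Ex P rho + 24 * Ex P (fun w => rho w ^+ 2)) / sqrt_m1) / m1%:R.
Proof.
move=> km; have hx := mom_xi km; have s0 := sqrt_m1_gt0.
have m0 : 0 < m1%:R :> R by rewrite ltr0n.
apply: (@le_trans _ _ (Ex P (fun w => sqrt_m1^-1 * xi k w ^+ 2 + sqrt_m1 * xi k w ^+ 4))).
  apply: le_Ex; try (by apply: mom_intg; mom_tac).
  move=> w; have n2 : xi k w ^+ 2 = `|xi k w| ^+ 2 by rewrite real_normK ?num_real.
  rewrite (exprM _ 2 2) n2; have : 0 <= `|xi k w| by [].
  move: (`|xi k w|) => x x0.
  have -> : sqrt_m1^-1 * x ^+ 2 + sqrt_m1 * (x ^+ 2) ^+ 2 = x ^+ 2 * (sqrt_m1^-1 + sqrt_m1 * x ^+ 2) by ring.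
  rewrite exprSr ler_wpM2l ?sqr_ge0//.
  rewrite -(ler_pM2l s0) mulrDr mulfV ?gt_eqF//.
  have := sqr_ge0 (sqrt_m1 * x - 1); have : 0 <= sqrt_m1 * x by rewrite mulr_ge0// ltW.
  have -> : sqrt_m1 * (sqrt_m1 * x ^+ 2) = (sqrt_m1 * x) ^+ 2 by ring.
  by move: (sqrt_m1 * x) => y; nra.
rewrite ExD; try (by apply: mom_intg; mom_tac).
rewrite !ExZ; try (by apply: mom_intg; mom_tac).
rewrite Ex_xi2//; have h := Ex_xi4 km.
apply: (@le_trans _ _ (sqrt_m1^-1 * (Ex P rho / m1%:R) + sqrt_m1 * (24 * Ex P (fun w => rho w ^+ 2) / m1%:R ^+ 2))).
  by rewrite lerD2l ler_wpM2l// ltW.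
rewrite le_eqVlt; apply/orP; left; apply/eqP.
rewrite -sqrt_m1_sqr; move: (Ex P _) (Ex P _) => e1 e2.
by field; rewrite gt_eqF.
Qed.

(** The differences xi k ^+ 2 - rho / m1 are orthogonal, since rho does not
    involve the first sample. *)
Lemma Ex_sum_xi2 : Ex P (fun w => (\sum_(k < m1) xi k w ^+ 2 - rho w) ^+ 2) <=
  50 * Ex P (fun w => rho w ^+ 2) / m1%:R.
Proof.
have m0 : 0 < m1%:R :> R by rewrite ltr0n.
have mr := mom_rho.
rewrite (@eq_Ex _ _ _ _ _ (fun w => (\sum_(i < n | (i < m1)%N) (xi i w ^+ 2 - rho w / m1%:R)) ^+ 2)); last first.
  move=> w; congr (_ ^+ 2); rewrite big_split /= -(sum_ord_lt (fun i => xi i w ^+ 2) (ltnW m1n)).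
  congr (_ + _); rewrite -(sum_ord_lt (fun i => - (rho w / m1%:R)) (ltnW m1n)).
  rewrite sumr_const card_ord -[RHS]mulr_natr; move: (rho w) => x.
  by rewrite mulNr divfK// gt_eqF.
rewrite Ex_sqr_sum_orth; last 2 first.
- move=> i im; have h := mom_xi im; mom_tac.
- move=> i j im jm ij.
  pose h w := xi i w ^+ 2 - rho w / m1%:R.
  have hh : indep_of j h.
    apply: indB; first by apply: indX; exact: ind_xi.
    by apply: indM; [exact: ind_rho|exact: ind_cst].
  have mh := ind_mom hh; have mx := mom_xi jm.
  rewrite (@eq_Ex _ _ _ _ _ (fun w => h w * xi j w ^+ 2 - h w * (rho w / m1%:R))); last first.
    by move=> w; rewrite -mulrBr.
  rewrite ExB; try (by apply: mom_intg; mom_tac).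
  by rewrite xi_cond2// subrr.
apply: (@le_trans _ _ (\sum_(i < n | (i < m1)%N) (50 * Ex P (fun w => rho w ^+ 2) / m1%:R ^+ 2))).
  apply: ler_sum => i im; have mx := mom_xi im.
  apply: (@le_trans _ _ (Ex P (fun w => 2 * xi i w ^+ 4 + 2 / m1%:R ^+ 2 * rho w ^+ 2))).
    apply: le_Ex; try (by apply: mom_intg; mom_tac).
    move=> w.
    have -> : 2 / m1%:R ^+ 2 * rho w ^+ 2 = 2 * (rho w / m1%:R) ^+ 2 by field; rewrite gt_eqF.
    move: (xi i w) (rho w / _) => x y.
    by have := sqr_ge0 (x ^+ 2 + y); nra.
  rewrite ExD; try (by apply: mom_intg; mom_tac).
  rewrite !ExZ; try (by apply: mom_intg; mom_tac).
  have := Ex_xi4 im; move: (Ex P _) (Ex P _) => e2 e1 h.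
  apply: (@le_trans _ _ (2 * (24 * e2 / m1%:R ^+ 2) + 2 / m1%:R ^+ 2 * e2)); first by rewrite lerD2r ler_wpM2l.
  by rewrite le_eqVlt; apply/orP; left; apply/eqP; field; rewrite gt_eqF.
rewrite -(sum_ord_lt (fun i => 50 * Ex P (fun w => rho w ^+ 2) / m1%:R ^+ 2) (ltnW m1n)).
rewrite sumr_const card_ord -mulr_natr le_eqVlt; apply/orP; left; apply/eqP.
by move: (Ex P _) => e; field; rewrite gt_eqF.
Qed.

Lemma Ex_mean2 : Ex P (fun w => (S m1 w / sqrt_m1) ^+ 2) = Ex P rho / m1%:R.
Proof.
have m0 : 0 < m1%:R :> R by rewrite ltr0n.
have mS : mom P (S m1) by exact: mom_psum mdiff_xi (leqnn _).
rewrite (@eq_Ex _ _ _ _ _ (fun w => m1%:R^-1 * S m1 w ^+ 2)); last first.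
  by move=> w; rewrite exprMn exprVn sqrt_m1_sqr mulrC.
rewrite ExZ; last exact/mom_intg/momX.
rewrite mulrC; congr (_ / _).
rewrite (@eq_Ex _ _ _ _ _ (fun w => (\sum_(i < n | (i < m1)%N) xi i w) ^+ 2)); last first.
  by move=> w; rewrite /psum (sum_ord_lt (fun j => xi j w) (ltnW m1n)).
rewrite Ex_sqr_sum_orth; last 2 first.
- by move=> i im; exact: mom_xi.
- by move=> i j im jm ij; apply: xi_cond1 => //; exact: ind_xi.
rewrite (eq_bigr (fun=> Ex P rho / m1%:R)); last by move=> i im; exact: Ex_xi2.
rewrite -(sum_ord_lt (fun=> Ex P rho / m1%:R) (ltnW m1n)) sumr_const card_ord -[LHS]mulr_natr.
by rewrite divfK// gt_eqF.
Qed.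

Lemma mom_drift : mom P drift.
Proof.
rewrite /drift; have h : mom P cond_mean.
  apply: momD; last exact: mom_cst.
  by apply: mom_sum => a _; apply: momM; [exact: mom_cst|exact: mom_B].
by mom_tac.
Qed.

(** The fluctuation of the shift is a sum over the second sample of centred
    quadratic forms with weights g (g - 1), small because Delta is bounded. *)
Lemma Ex_drift (c K : R) : 0 <= c -> m1%:R <= c * gsq -> gdev <= K ->
  Ex P (fun w => (drift w - drift_lim) ^+ 2) <= c * (hi ^+ 2 * K) / gsq.
Proof.
move=> c0 m1c dK; have m20 := m2_gt0; have d0' := gdev_ge0.
have h2 : 0 <= hi ^+ 2 by rewrite sqr_ge0.
pose E0 := dgf (fun a => g a * (g a - 1)).
rewrite (@eq_Ex _ _ _ _ _ (fun w => m1%:R / (2 * gsq ^+ 2 * m2) *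
   (\sum_(j < n | (m1 <= j)%N) QX j (ccst E0) w) ^+ 2)); last first.
  move=> w.
  have -> : drift w - drift_lim = sqrt_m1 / cond_sd * (m2^-1 * \sum_(j < n | (m1 <= j)%N) QX j (ccst E0) w).
    have -> : m2^-1 * \sum_(j < n | (m1 <= j)%N) QX j (ccst E0) w = cond_mean w - gdev.
      rewrite /cond_mean addrK /E0; under eq_bigr do rewrite QXdgf.
      rewrite exchange_big mulr_sumr; apply: eq_bigr => a _; rewrite /B mulrCA; congr (_ * _).
      by rewrite mulr_sumr; apply: eq_bigr => j _; rewrite /mm eqxx expr2.
    by rewrite /drift /drift_lim; field; rewrite gt_eqF// cond_sd_gt0.
  rewrite !exprMn !exprVn sqrt_m1_sqr cond_sd_sqr /cond_var; move: (\sum_(j < n | _) _) => u.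
  by field; rewrite !gt_eqF.
rewrite ExZ; last by apply/mom_intg/momX/mom_sum => j _; exact: mom_QXc hX hz _ _.
have k0 : 0 <= m1%:R / (2 * gsq ^+ 2 * m2) by rewrite divr_ge0// !mulr_ge0 ?sqr_ge0// ltW.
apply: (@le_trans _ _ (m1%:R / (2 * gsq ^+ 2 * m2) * (m2 * (2 * (hi ^+ 2 * K))))).
  rewrite ler_wpM2l//; apply: (le_trans (Ex_sumQXc2 hX hz _ _)); rewrite sum_tail_cst.
  rewrite ler_wpM2l ?(ltW m20)// ler_wpM2l// fnorm2_dgf (le_trans sum_g_gm1_le)// ler_wpM2l//.
rewrite [leLHS](_ : _ = m1%:R / gsq ^+ 2 * (hi ^+ 2 * K)); last by field; rewrite !gt_eqF.
rewrite [leRHS](_ : _ = (c * gsq) / gsq ^+ 2 * (hi ^+ 2 * K)); last by field; rewrite gt_eqF.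
apply: ler_wpM2r; first by rewrite mulr_ge0// (le_trans d0').
by apply: ler_wpM2r; rewrite // invr_ge0 sqr_ge0.
Qed.

End rho.

(** * Studentisation *)

Lemma sqr_le_abs (R : realType) (x y : R) : 0 <= y -> (`|x| <= y) = (x ^+ 2 <= y ^+ 2).
Proof.
move=> y0; rewrite -[x ^+ 2]real_normK ?num_real//.
by rewrite ler_pXn2r ?nnegrE.
Qed.

Section slutsky.
Context (R : realType).

(** |sqrt V - 1| (sqrt V + 1) = |V - 1|. *)
Lemma sqrt_near1 (V e : R) : 0 <= e <= 1 -> `|V - 1| <= e -> `|Num.sqrt V - 1| <= e.
Proof.
rewrite !ler_norml => /andP[e0 e1] /andP[h1 h2].
have V0 : 0 <= V by lra.
have := sqr_sqrtr V0; have : 0 <= Num.sqrt V by [].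
by move: (Num.sqrt V) => s s0 hs; apply/andP; split; nra.
Qed.

(** The constants: ss - q^2 is within 3 t of 1, as q^2 <= t^2 <= t; hence so is
    its square root, which moves the threshold zq by at most 3 |zq| t, and the
    replacement of D by dd moves it by t. *)
Lemma student_close (zq t S D dd ss q rho : R) : 0 < t -> 6 * t <= 1 ->
  `|D - dd| <= t -> `|ss - rho| <= t -> `|rho - 1| <= t -> `|q| <= t ->
  (zq - dd + (t + 3 * `|zq| * t) < S -> zq < (S + D) / Num.sqrt (ss - q ^+ 2)) /\
  (zq < (S + D) / Num.sqrt (ss - q ^+ 2) -> zq - dd - (t + 3 * `|zq| * t) < S).
Proof.
move=> t0 t1 hD hs hr hq.
have q2 : 0 <= q ^+ 2 <= t.
  rewrite sqr_ge0 (@le_trans _ _ (t ^+ 2))//; last by nra.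
  by rewrite -sqr_le_abs// ltW.
have hV : `|(ss - q ^+ 2) - 1| <= 3 * t.
  move: q2 hs hr; rewrite !ler_norml => /andP[? ?] /andP[? ?] /andP[? ?].
  by apply/andP; split; lra.
have := sqrt_near1 _ hV; move: (Num.sqrt _) => v.
have t3 : 0 <= 3 * t <= 1 by apply/andP; split; lra.
move=> /(_ t3) hv.
have v0 : 0 < v by move: hv; rewrite ler_norml => /andP[? ?]; lra.
rewrite ltr_pdivlMr//.
have h : `|zq * v - zq| <= 3 * `|zq| * t.
  have -> : zq * v - zq = zq * (v - 1) by ring.
  by rewrite normrM mulrAC [leRHS]mulrC ler_wpM2l.
move: h hD; move: (zq * v) (3 * `|zq| * t) => u b.
rewrite !ler_norml => /andP[? ?] /andP[? ?].
by split; lra.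
Qed.

Context (d : measure_display) (T : measurableType d) (P : probability T R).
Context (S D ss q rho : T -> R) (zq dd t : R).
Hypotheses (mS : mom P S) (mD : mom P D) (ms : mom P ss) (mq : mom P q) (mr : mom P rho).
Hypotheses (t0 : 0 < t) (t1 : 6 * t <= 1).

(** Here S is the sum of the normalised terms, D their shift, ss the sum of their
    squares and q the term that centres it. *)
Definition student_event : set T :=
  [set w | zq < (S w + D w) / Num.sqrt (ss w - q w ^+ 2)].

(** Where the radicand is positive the quotient is cleared; elsewhere it is 0. *)
Lemma measurable_student : measurable student_event.
Proof.
pose V w := ss w - q w ^+ 2.
have mV : measurable_fun setT V by apply: (@mom_meas _ _ _ P); rewrite /V; mom_tac.
have mN : measurable_fun setT (fun w => S w + D w).
  by apply: (@mom_meas _ _ _ P); mom_tac.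
have mR : measurable_fun setT (fun w => zq * Num.sqrt (V w)).
  apply: measurable_funM => //; apply: measurableT_comp mV.
  by apply: continuous_measurable_fun; exact: sqrt_continuous.
have -> : student_event = ([set w | 0 < V w] `&` [set w | zq * Num.sqrt (V w) < S w + D w])
     `|` ([set w | V w <= 0] `&` [set w | zq < 0]).
  apply/seteqP; rewrite /student_event; split=> w /=.
    have [V0|V0] := ltP 0 (V w); [left|right].
      by move: H; rewrite -/(V w) ltr_pdivlMr ?sqrtr_gt0.
    by move: H; rewrite -/(V w) ler0_sqrtr// invr0 mulr0.
  move=> [[V0]|[V0]]; rewrite -/(V w); first by rewrite ltr_pdivlMr ?sqrtr_gt0.
  by rewrite ler0_sqrtr// invr0 mulr0.
apply: measurableU; apply: measurableI.
- exact: measurable_gt.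
- exact: measurable_gt.
- rewrite (_ : [set w | _] = ~` [set w | 0 < V w]).
    by apply: measurableC; exact: measurable_gt.
  by apply/seteqP; split=> w /=; rewrite leNgt => /negP.
- exact: measurable_gt.
Qed.

(** Chebyshev's bound for the probability that one of the four approximations
    used in [student_close] fails by more than t. *)
Definition slutsky_err : R := (Ex P (fun w => (D w - dd) ^+ 2) +
  Ex P (fun w => (ss w - rho w) ^+ 2) + Ex P (fun w => (rho w - 1) ^+ 2) +
  Ex P (fun w => q w ^+ 2)) / t ^+ 2.

Lemma indic_err (A B : set T) : measurable A -> measurable B ->
  (forall w, `|D w - dd| <= t -> `|ss w - rho w| <= t -> `|rho w - 1| <= t ->
     `|q w| <= t -> A w -> B w) ->
  fine (P A) <= fine (P B) + slutsky_err.
Proof.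
move=> mA mB AB; have mA1 := mom_indic P mA; have mB1 := mom_indic P mB.
rewrite -!Ex_indic// /slutsky_err mulrC.
rewrite -!ExD; try (by apply: mom_intg; mom_tac).
rewrite -ExZ; last by apply: mom_intg; mom_tac.
rewrite -ExD; try (by apply: mom_intg; mom_tac).
apply: le_Ex; try (by apply: mom_intg; mom_tac).
move=> w; rewrite !indicE.
have ge1 (x y u v : R) : t < `|x| \/ t < `|y| \/ t < `|u| \/ t < `|v| ->
    1 <= (t ^+ 2)^-1 * (x ^+ 2 + y ^+ 2 + u ^+ 2 + v ^+ 2).
  move=> h; rewrite ler_pdivlMl ?exprn_gt0// mulr1.
  have b (a : R) : t < `|a| -> t ^+ 2 <= a ^+ 2.
    move=> ta; rewrite -[a ^+ 2]real_normK ?num_real//.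
    by apply: lerXn2r; rewrite ?nnegrE ?(ltW t0) ?(ltW ta).
  have := sqr_ge0 x; have := sqr_ge0 y; have := sqr_ge0 u; have := sqr_ge0 v.
  by case: h => [|[|[]]] /b; lra.
have ge0 (x y u v : R) : 0 <= (t ^+ 2)^-1 * (x ^+ 2 + y ^+ 2 + u ^+ 2 + v ^+ 2).
  by rewrite mulr_ge0 ?invr_ge0 ?sqr_ge0// !addr_ge0 ?sqr_ge0.
case: (asboolP (A w)) => [Aw|nA]; last first.
  rewrite memNset//; apply: addr_ge0 => //; exact: ler0n.
rewrite mem_set//=; case: (asboolP (B w)) => [Bw|nB].
  by rewrite mem_set//= lerDl.
rewrite memNset//= add0r; apply: ge1.
have [|h1] := ltP t `|D w - dd|; first by left.
have [|h2] := ltP t `|ss w - rho w|; first by right; left.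
have [|h3] := ltP t `|rho w - 1|; first by right; right; left.
have [|h4] := ltP t `|q w|; first by right; right; right.
by case: nB; exact: AB.
Qed.

Lemma slutsky :
  fine (P student_event) <= fine (P [set w | zq - dd - (t + 3 * `|zq| * t) < S w]) + slutsky_err /\
  fine (P [set w | zq - dd + (t + 3 * `|zq| * t) < S w]) <= fine (P student_event) + slutsky_err.
Proof.
have mg c : measurable [set w | c < S w] by apply: measurable_gt => //; exact: mom_meas mS.
split; apply: indic_err => //; try exact: measurable_student.
  by move=> w h1 h2 h3 h4; exact: (student_close zq (S w) t0 t1 h1 h2 h3 h4).2.
by move=> w h1 h2 h3 h4; exact: (student_close zq (S w) t0 t1 h1 h2 h3 h4).1.
Qed.

End slutsky.

(** * Uniform normal approximation of the power, whitened data *)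

Section power_whitened.
Context (R : realType).
Notation Phi := (@normal_cdf R).

Lemma large_div (C e x : R) : 0 < e -> 0 <= C -> 0 < x -> C / e <= x -> C / x <= e.
Proof. by move=> e0 rho_bound x0; rewrite !ler_pdivrMr// mulrC. Qed.

Lemma sum6_le (x1 x2 x3 x4 x5 s : R) : 0 <= x1 -> 0 <= x2 -> 0 <= x3 -> 0 <= x4 ->
  0 <= x5 -> 1 + x1 + x2 + x3 + x4 + x5 <= s ->
  1 <= s /\ x1 <= s /\ x2 <= s /\ x3 <= s /\ x4 <= s /\ x5 <= s.
Proof. by move=> *; repeat split; lra. Qed.

Lemma rho_bound_ge0 (hi c K : R) : 0 <= hi -> 0 <= c -> 0 <= K -> 0 <= rho_bound hi c K.
Proof.
by move=> h0 c0 K0; rewrite /rho_bound; repeat first [apply: addr_ge0 | apply: mulr_ge0 | apply: exprn_ge0 | by []].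
Qed.

(** drift_lim^2 = (m1 / s) (m2 / s) Delta^2 / 2. *)
Lemma drift_lim_le (n d : nat) (g : 'I_d -> R) m1 (c K : R) : (0 < m1 < n)%N ->
  0 < gsq g -> n%:R <= c * gsq g -> gdev g <= K -> `|drift_lim n g m1| <= c * K.
Proof.
move=> /andP[m10 m1n] s0 nc dK.
have n0 : 0 < n%:R :> R by rewrite ltr0n (leq_trans _ m1n).
have c0 : 0 <= c by rewrite -(pmulr_lge0 _ s0); apply: le_trans nc; exact: ltW.
have d0 : 0 <= gdev g by apply: sumr_ge0 => a _; exact: sqr_ge0.
have K0 : 0 <= K by exact: le_trans dK.
rewrite sqr_le_abs ?mulr_ge0// /drift_lim !exprMn exprVn sqrt_m1_sqr (cond_sd_sqr m1n s0) /cond_var.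
have m20 : 0 < m2 R n m1 by exact: m2_gt0.
have -> : m1%:R * gdev g ^+ 2 * (2 * gsq g ^+ 2 / m2 R n m1)^-1 =
   (m1%:R / gsq g) * (m2 R n m1 / gsq g) / 2 * gdev g ^+ 2.
  by field; rewrite !gt_eqF.
have b1 : m1%:R / gsq g <= c.
  by rewrite ler_pdivrMr// (le_trans _ nc)// ler_nat ltnW.
have b2 : m2 R n m1 / gsq g <= c.
  by rewrite ler_pdivrMr// (le_trans _ nc)// ler_nat leq_subr.
have b0 : 0 <= m1%:R / gsq g by rewrite divr_ge0// ltW.
have b0' : 0 <= m2 R n m1 / gsq g by rewrite divr_ge0// ltW.
apply: ler_pM; rewrite ?sqr_ge0//.
- by rewrite divr_ge0// mulr_ge0.
- rewrite ler_pdivrMr// (@le_trans _ _ (c * c))//; first exact: ler_pM.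
  by rewrite -expr2 ler_peMr ?sqr_ge0// ler1n.
- by apply: lerXn2r; rewrite ?nnegrE.
Qed.

(** The statement is uniform over all sample spaces, dimensions and eigenvalues,
    which is how a triangular array is handled: s0 depends only on the bounds
    hi, c, K and on the precision r. *)
Lemma power_whitened (zq hi c K r : R) : 0 < hi -> 0 < c -> 0 <= K -> 0 < r ->
  exists s0 : R, forall (d0 d2 : measure_display)
    (T0 : measurableType d0) (T2 : measurableType d2)
    (P : probability T0 R) (N : probability T2 R) (n d : nat)
    (X : 'I_n -> {RV P >-> T2}) (z : 'I_d -> T2 -> R) (g : 'I_d -> R) (m1 : nat),
  iid_from X N -> std_gauss N z -> (0 < m1 < n)%N -> (forall a, 0 < g a <= hi) ->
  s0 <= gsq g -> n%:R <= c * gsq g -> gsq g <= c * m1%:R -> gdev g <= K ->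
  `|fine (P (student_event (psum (xi X z g m1) m1) (drift X z g m1)
      (fun w => \sum_(k < m1) xi X z g m1 k w ^+ 2)
      (fun w => psum (xi X z g m1) m1 w / sqrt_m1 R m1) zq)) - Phi (drift_lim n g m1 - zq)| <= r.
Proof.
move=> hi0 c0 K0 r0.
have r40 : 0 < r / 4 by rewrite divr_gt0.
pose pk : R := normal_peak 1.
have pk0 : 0 < pk by rewrite normal_peak_gt0// oner_eq0.
pose b : R := 1 + 3 * `|zq|.
have b0 : 0 < b by rewrite ltr_pwDl// mulr_ge0.
(* the tolerance: small enough for the square root, and moving the argument of
   Phi by b * t costs at most r / 4 *)
pose t : R := (6 + 4 * pk * b / r)^-1.
have q0 : 0 < 4 * pk * b / r by rewrite divr_gt0// !mulr_gt0.
have t0 : 0 < t by rewrite invr_gt0 addr_gt0.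
have tv : t * (6 + 4 * pk * b / r) = 1 by rewrite mulVf// gt_eqF// addr_gt0.
have t1 : 6 * t <= 1.
  by rewrite -[leRHS]tv mulrDr mulrC lerDl mulr_ge0 ?ltW.
have t2 : pk * (b * t) <= r / 4.
  have : t * (4 * pk * b / r) <= 1 by rewrite -[leRHS]tv [leRHS]mulrDr lerDr mulr_ge0 ?ltW.
  rewrite mulrA ler_pdivrMr// mul1r ler_pdivlMr//.
  by move=> h; rewrite (_ : _ * 4 = t * (4 * pk * b))//; ring.
have [eta eta0 hclt] := @martingale_clt R (`|zq| + c * K + b) (r / 4) (addr_ge0 (addr_ge0 (normr_ge0 _) (mulr_ge0 (ltW c0) K0)) (ltW b0)) r40.
pose C := rho_bound hi c K.
have C_ge0 : 0 <= C by apply: rho_bound_ge0; rewrite ?(ltW hi0) ?(ltW c0).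
pose C1 := c * (hi ^+ 2 * K) + C + 202 * c.
have C1_ge0 : 0 <= C1.
  have c0' := ltW c0; rewrite /C1; apply: addr_ge0; last by rewrite mulr_ge0.
  apply: addr_ge0 => //; apply: mulr_ge0 => //; apply: mulr_ge0 => //; exact: sqr_ge0.
pose e1 := t ^+ 2 * (r / 4).
have e10 : 0 < e1 by rewrite mulr_gt0// exprn_gt0.
(* one summand for each condition: s >= 1, second moment of rho - 1 at most 1,
   first absolute moment at most eta, third moments, 1 / m1, error of slutsky *)
exists (1 + C + C / eta ^+ 2 + c * (98 / eta) ^+ 2 + c * eta^-1 + C1 / e1).
move=> d0 d2 T0 T2 P N n d X z g m1 hX hz /andP[m10 m1n] hg.
have p1 : 0 <= C / eta ^+ 2 by rewrite divr_ge0 ?sqr_ge0.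
have p2 : 0 <= c * (98 / eta) ^+ 2 by rewrite mulr_ge0 ?sqr_ge0// ltW.
have p3 : 0 <= c * eta^-1 by rewrite mulr_ge0 ?invr_ge0 ?(ltW c0) ?(ltW eta0).
have p4 : 0 <= C1 / e1 by rewrite divr_ge0// ltW.
set s := gsq g => sbig ns sm dK.
have [s1 [sC [s2 [s3 [s4 s5]]]]] : 1 <= s /\ C <= s /\ C / eta ^+ 2 <= s /\
    c * (98 / eta) ^+ 2 <= s /\ c * eta^-1 <= s /\ C1 / e1 <= s.
  exact: sum6_le sbig.
have s0 : 0 < s by exact: lt_le_trans s1.
have m0 : 0 < m1%:R :> R by rewrite ltr0n.
have mge x : c * x <= s -> x <= m1%:R.
  by move=> h; rewrite -(ler_pM2l c0) (le_trans h).
have hS := mdiff_xi hX hz m1n s0 m10.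
set S := psum (xi X z g m1) m1.
have mS : mom P S by exact: mom_psum hS (leqnn _).
have mD := mom_drift hX hz g m1; have mr := mom_rho hX hz g m1.
have mss : mom P (fun w => \sum_(k < m1) xi X z g m1 k w ^+ 2).
  by apply: mom_sum => k _; apply: momX; exact: (mdiff_mom hS).
have mq : mom P (fun w => S w / sqrt_m1 R m1) by apply: momM => //; exact: mom_cst.
have ns2 : m2 R n m1 <= c * s by apply: le_trans ns; rewrite ler_nat leq_subr.
have ns1 : m1%:R <= c * s by apply: le_trans ns; rewrite ler_nat ltnW.
have er := Ex_rho_near1 hX hz m1n hg s0 s1 ns2 dK; rewrite -/C in er.
have ed := Ex_drift hX hz m1n hg s0 (ltW c0) ns1 dK.
have ess := Ex_sum_xi2 hX hz m1n s0 m10.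
have es := Ex_mean2 hX hz m1n s0 m10; rewrite -/S in es.
set v := Ex P (fun w => (rho X z g m1 w - 1) ^+ 2) in er.
have v1 : v <= 1 by apply: (le_trans er); rewrite ler_pdivrMr// mul1r.
have mr1 : mom P (fun w => rho X z g m1 w - 1) by mom_tac.
have ab := Ex_abs2 mr1; rewrite -/v in ab.
set u := Ex P (fun w => `|rho X z g m1 w - 1|) in ab.
have u0 : 0 <= u by apply: Ex_ge0.
have ueta : u <= eta.
  rewrite -(ler_pXn2r (n := 2))// ?nnegrE ?(ltW eta0)//.
  apply: (le_trans ab); apply: (le_trans er).
  by apply: large_div => //; rewrite exprn_gt0.
have eR : Ex P (rho X z g m1) <= 2.
  rewrite (@eq_Ex _ _ _ _ _ (fun w => 1 + (rho X z g m1 w - 1))); last first.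
    by move=> w; rewrite addrC subrK.
  rewrite ExD; try (by apply: mom_intg; mom_tac).
  rewrite Ex_cst; apply: (@le_trans _ _ (1 + u)).
    by rewrite lerD2l (le_trans (ler_norm _))// Ex_abs//; exact: mom_intg.
  have : u ^+ 2 <= 1 by exact: le_trans ab v1.
  by move: u0; clear; move: u => u; nra.
have eR2 : Ex P (fun w => rho X z g m1 w ^+ 2) <= 4.
  apply: (@le_trans _ _ (Ex P (fun w => 2 + 2 * (rho X z g m1 w - 1) ^+ 2))).
    apply: le_Ex; try (by apply: mom_intg; mom_tac).
    by move=> w; move: (rho X z g m1 w) => x; rewrite -subr_ge0 (_ : _ - _ = (x - 2) ^+ 2) ?sqr_ge0//; ring.
  rewrite ExD; try (by apply: mom_intg; mom_tac).
  rewrite Ex_cst ExZ -/v; last by apply: mom_intg; mom_tac.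
  by move: v1; clear; move: v => v; lra.
have s0M := sqrt_m1_gt0 R m10.
have h3 k : (k < m1)%N -> Ex P (fun w => `|xi X z g m1 k w| ^+ 3) <= (98 / sqrt_m1 R m1) / m1%:R.
  move=> km; apply: (le_trans (Ex_xi3 hX hz m1n s0 m10 km)).
  rewrite ler_wpM2r ?invr_ge0// ler_wpM2r ?invr_ge0 ?(ltW s0M)//.
  by move: eR eR2; clear; move: (Ex P _) (Ex P _) => x y; lra.
have L1 : 98 / sqrt_m1 R m1 <= eta.
  apply: large_div => //.
  rewrite -(ler_pXn2r (n := 2))// ?nnegrE ?(ltW s0M) ?divr_ge0 ?(ltW eta0)//.
  by rewrite sqrt_m1_sqr; exact: mge.
have m1e : m1%:R^-1 <= eta.
  rewrite -[_^-1]mul1r; apply: large_div => //; rewrite mul1r; exact: mge.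
have cl a : `|a| <= `|zq| + c * K + b -> `|fine (P [set w | a < S w]) - Phi (- a)| <= r / 4.
  exact: (hclt _ _ _ _ _ _ _ _ m10 hS h3 ueta L1 m1e).
have ddb : `|drift_lim n g m1| <= c * K by apply: drift_lim_le => //; rewrite m10.
have [sl1 sl2] := slutsky zq (drift_lim n g m1) mS mD mss mq mr t0 t1.
set E := student_event _ _ _ _ _ in sl1 sl2 *.
have y0 : t + 3 * `|zq| * t = b * t by rewrite /b; ring.
rewrite !y0 in sl1 sl2.
have bt : 0 <= b * t <= b.
  apply/andP; split; first by apply: mulr_ge0; exact: ltW.
  apply: ler_piMr; first exact: ltW.
  by move: t1 t0; clear; move: t => t; lra.
have err : slutsky_err P (drift X z g m1) (fun w => \sum_(k < m1) xi X z g m1 k w ^+ 2)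
   (fun w => S w / sqrt_m1 R m1) (rho X z g m1) (drift_lim n g m1) t <= r / 4.
  rewrite /slutsky_err ler_pdivrMr ?exprn_gt0// [leRHS]mulrC -/e1 es -/v.
  apply: (@le_trans _ _ (C1 / s)); last exact: large_div.
  have im : m1%:R^-1 <= c / s.
    by rewrite ler_pdivlMr// ler_pdivrMl// mulrC.
  have ess' : Ex P (fun w => (\sum_(k < m1) xi X z g m1 k w ^+ 2 - rho X z g m1 w) ^+ 2) <= 200 * (c / s).
    apply: (le_trans ess); apply: ler_pM; rewrite ?invr_ge0//.
      by rewrite mulr_ge0//; apply: Ex_ge0 => w; exact: sqr_ge0.
    by move: eR2; clear; move: (Ex P _) => x; lra.
  have es' : Ex P (rho X z g m1) / m1%:R <= 2 * (c / s).
    apply: (@le_trans _ _ (2 / m1%:R)); first by rewrite ler_wpM2r ?invr_ge0.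
    by rewrite ler_wpM2l.
  have -> : C1 / s = c * (hi ^+ 2 * K) / s + 200 * (c / s) + C / s + 2 * (c / s).
    by rewrite /C1; field; rewrite gt_eqF.
  by apply: lerD => //; apply: lerD => //; apply: lerD.
have sl1' := le_trans sl1 (lerD (lexx _) err).
have sl2' := le_trans sl2 (lerD (lexx _) err).
have lip (x : R) : `|Phi (drift_lim n g m1 - zq + x) - Phi (drift_lim n g m1 - zq)| <= pk * `|x|.
  by apply: (le_trans (cdf_lip _ _)); rewrite addrAC subrr add0r.
have tri (x : R) : `|x| <= b -> `|zq - drift_lim n g m1 + x| <= `|zq| + c * K + b.
  move=> xb; apply: (le_trans (ler_normD _ _)); apply: lerD => //.
  by apply: (le_trans (ler_normB _ _)); rewrite lerD2l.
have nb : `|b * t| = b * t by rewrite ger0_norm//; case/andP: bt.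
have bb : b * t <= b by case/andP: bt.
apply: (@squeeze4 _ _ (fine (P [set w | zq - drift_lim n g m1 - b * t < S w]))
   (fine (P [set w | zq - drift_lim n g m1 + b * t < S w]))
   (Phi (- (zq - drift_lim n g m1 - b * t))) (Phi (- (zq - drift_lim n g m1 + b * t)))) => //.
- by rewrite lerBlDr.
- by apply: cl; apply: tri; rewrite normrN nb.
- by apply: cl; apply: tri; rewrite nb.
- rewrite (_ : - _ = drift_lim n g m1 - zq + b * t); last by ring.
  by apply: (le_trans (lip _)); rewrite nb.
- rewrite (_ : - _ = drift_lim n g m1 - zq + - (b * t)); last by ring.
  by apply: (le_trans (lip _)); rewrite normrN nb.
Qed.

End power_whitened.

(** * Reduction of the covariance statistic to whitened data *)

Lemma measurable_coord (R : realType) (d : nat) (b : 'I_d) :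
  measurable_fun [set: borel_cV R d] (fun x : borel_cV R d => (x : 'cV[R]_d) b 0 : R).
Proof.
apply: (measurability _ (RGenOpens.measurableE R)) => /= _ [_ [a [c ->]]] <-.
rewrite setTI; apply: sub_sigma_algebra.
apply: (open_comp (f := fun x : 'cV[R]_d => x b 0)); last exact: interval_open.
by move=> x _; exact: coord_continuous.
Qed.

Section reduction.
Context (R : realType) (d : nat).
Context (Sigma L M : 'M[R]_d) (g : 'I_d -> R).
Hypotheses (ML : M *m L = 1%:M) (LM : L *m M = 1%:M).
Hypotheses (LL : L *m L^T = Sigma) (LtL : L^T *m L = diag_mx (\row_a g a)).

(** The coordinates of z = L^-1 x. *)
Definition white (a : 'I_d) (x : borel_cV R d) : R := (M *m (x : 'cV[R]_d)) a 0.

Lemma std_gauss_white (Q : probability (borel_cV R d) R) :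
  is_normal_law Q 0 Sigma -> std_gauss Q white.
Proof.
move=> [_ _ hQ]; split=> [a|t B mB].
  rewrite /white (_ : (fun _ => _) = fun x : borel_cV R d => \sum_b M a b * (x : 'cV[R]_d) b 0).
    apply: measurable_sum => b; apply: measurable_funM => //.
    exact: measurable_coord.
  by apply/funext => x; rewrite mxE.
pose u : 'cV[R]_d := M^T *m \col_a t a.
have -> : [set x | B (lin white t x)] = [set x : 'cV[R]_d | B ((u^T *m x) 0 0)].
  apply/seteqP; split=> x; rewrite /= (_ : (u^T *m x) 0 0 = lin white t x)//.
    rewrite /u trmx_mul trmxK -mulmxA mxE /lin; apply: eq_bigr => a _.
    by rewrite !mxE /white mxE.
  rewrite /u trmx_mul trmxK -mulmxA mxE /lin; apply: eq_bigr => a _.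
  by rewrite !mxE /white mxE.
rewrite (hQ u B mB) mulmx0 mxE; congr normal_law1.
have -> : u^T *m Sigma *m u = (\col_a t a)^T *m (\col_a t a).
  rewrite /u trmx_mul trmxK -LL !mulmxA -[_ *m M *m L]mulmxA ML mulmx1.
  rewrite -[_ *m L^T *m M^T]mulmxA -trmx_mul ML trmx1 mulmx1 //.
by rewrite mxE; apply: eq_bigr => a _; rewrite !mxE expr2.
Qed.

Lemma tr_SigmaSigma : \tr (Sigma *m Sigma) = gsq g.
Proof.
rewrite -LL -mulmxA mxtrace_mulC !mulmxA LtL -mulmxA LtL mulmx_diag mxtrace_diag.
by apply: eq_bigr => a _; rewrite !mxE expr2.
Qed.

Lemma frobenius_Sigma : frobenius_norm (Sigma - 1%:M) ^+ 2 = gdev g.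
Proof.
rewrite /frobenius_norm sqr_sqrtr; last first.
  by apply: sumr_ge0 => i _; apply: sumr_ge0 => j _; exact: sqr_ge0.
have sS : (Sigma - 1%:M)^T = Sigma - 1%:M.
  by rewrite linearB /= trmx1 -LL trmx_mul trmxK.
have -> : \sum_(i < d) \sum_(j < d) (Sigma - 1%:M) i j ^+ 2 =
    \tr ((Sigma - 1%:M) *m (Sigma - 1%:M)).
  rewrite -{3}sS /mxtrace; apply: eq_bigr => i _; rewrite mxE; apply: eq_bigr => j _.
  by rewrite [(_^T) _ _]mxE expr2.
rewrite mulmxBl mulmxBr mul1mx mulmx1 !raddfB /= tr_SigmaSigma mxtrace1.
have -> : \tr Sigma = \sum_a g a.
  by rewrite -LL mxtrace_mulC LtL mxtrace_diag; apply: eq_bigr => a _; rewrite mxE.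
have -> : d%:R = \sum_(a < d) (1 : R) by rewrite sumr_const card_ord.
rewrite /gsq /gdev -!sumrN -!big_split /=; apply: eq_bigr => a _; ring.
Qed.

Lemma dotE (x y : 'cV[R]_d) :
  (x^T *m y) 0 0 = \sum_a g a * white a x * white a y.
Proof.
have -> : x^T *m y = (M *m x)^T *m diag_mx (\row_a g a) *m (M *m y).
  rewrite -LtL trmx_mul !mulmxA -[x^T *m M^T *m L^T]mulmxA -trmx_mul LM trmx1 mulmx1.
  by rewrite -[x^T *m L *m M]mulmxA LM mulmx1.
rewrite mxE; apply: eq_bigr => a _; rewrite /white mul_mx_diag !mxE.
by rewrite [_ * g a]mulrC.
Qed.

Lemma tr_outer (x y : 'cV[R]_d) : \tr (x *m y^T) = (x^T *m y) 0 0.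
Proof.
rewrite mxtrace_mulC /mxtrace big_ord1 !mxE; apply: eq_bigr => a _.
by rewrite !mxE mulrC.
Qed.

(** The left-hand side is (x^T y)^2 - |x|^2 - |y|^2 + d, and
    x^T y = sum_a g_a z_a(x) z_a(y). *)
Lemma kernelE (x y : 'cV[R]_d) :
  \tr ((x *m x^T - 1%:M) *m (y *m y^T - 1%:M)) =
  \sum_a \sum_b g a * g b * mm white a b y * mm white a b x
  + \sum_a g a * (g a - 1) * mm white a a x
  + (\sum_a g a * (g a - 1) * mm white a a y + gdev g).
Proof.
rewrite mulmxBl mulmxBr mul1mx mulmx1 !raddfB /=.
have -> : \tr (x *m x^T *m (y *m y^T)) = (x^T *m y) 0 0 ^+ 2.
  rewrite -mulmxA [x^T *m _]mulmxA {1}[x^T *m y]mx11_scalar mul_scalar_mx -scalemxAr.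
  by rewrite mxtraceZ tr_outer expr2.
rewrite !tr_outer mxtrace1 !dotE expr2 mulr_suml.
have -> : d%:R = \sum_(a < d) (1 : R) by rewrite sumr_const card_ord.
have -> : \sum_a \sum_b g a * g b * mm white a b y * mm white a b x =
   \sum_a (g a * white a x * white a y * (\sum_b g b * white b x * white b y)
     - g a ^+ 2 * (white a x ^+ 2 + white a y ^+ 2 - 1)).
  apply: eq_bigr => a _; rewrite mulr_sumr (bigD1 a)//= [in RHS](bigD1 a)//=.
  rewrite [X in _ + X](eq_bigr (fun b => g a * white a x * white a y * (g b * white b x * white b y))).
    by rewrite /mm eqxx mulr1n; move: (\sum_(b | _) _) => s; ring.
  move=> b ba; rewrite /mm eq_sym (negbTE ba) !subr0; ring.
rewrite /gdev -!sumrN -!big_split /=; apply: eq_bigr => a _.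
by rewrite /mm eqxx mulr1n; move: (\sum_b _) => s; ring.
Qed.

Context (d0 : measure_display) (T0 : measurableType d0) (P : probability T0 R).
Context (n m1 : nat) (X : 'I_n -> {RV P >-> borel_cV R d}).
Hypotheses (m1n : (m1 < n)%N) (m10 : (0 < m1)%N) (sg0 : 0 < gsq g).
Notation QW i w := (QX X white i (cond_weight X white g m1) w).
Notation Xw w := (fun i => X i w : 'cV[R]_d).

Lemma f_covE (w : T0) (i : 'I_n) :
  f_cov m1 (Xw w) (X i w) = QW i w + cond_mean X white g m1 w.
Proof.
have m20 : m2 R n m1 != 0 by rewrite gt_eqF// m2_gt0.
have cst (c : R) : (m2 R n m1)^-1 * \sum_(j < n | (m1 <= j)%N) c = c.
  by rewrite sum_tail_cst// mulKf.
rewrite /f_cov -/(m2 R n m1).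
rewrite (eq_bigr _ (fun j _ => kernelE (X i w) (X j w))).
rewrite !big_split /= !mulrDr !cst /cond_mean [LHS]addrA [RHS]addrA; congr (_ + _); congr (_ + _).
  have -> : QW i w = \sum_a \sum_b g a * g b * B X white m1 a b w * mm white a b (X i w) +
      \sum_a \sum_b dgf (fun a => g a * (g a - 1)) a b * mm white a b (X i w).
    rewrite /QX /Qf -big_split; apply: eq_bigr => a _; rewrite -big_split; apply: eq_bigr => b _.
    by rewrite /cond_weight mulrDl.
  rewrite dgf_sum; congr (_ + _).
  rewrite exchange_big mulr_sumr; apply: eq_bigr => a _.
  rewrite exchange_big mulr_sumr; apply: eq_bigr => b _ /=.
  rewrite /B -mulr_suml -mulr_sumr; ring.
rewrite exchange_big mulr_sumr; apply: eq_bigr => a _ /=.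
by rewrite /B -mulr_sumr mulrCA.
Qed.

(** All f_cov (X_i) share the shift [cond_mean], which drops out of the sample
    variance; the common factor sqrt m1 * cond_sd cancels in the quotient. *)
Lemma T_covE (w : T0) :
  T_cov m1 (Xw w) = (psum (xi X white g m1) m1 w + drift X white g m1 w) /
    Num.sqrt (\sum_(k < m1) xi X white g m1 k w ^+ 2 -
              (psum (xi X white g m1) m1 w / sqrt_m1 R m1) ^+ 2).
Proof.
have m0 : 0 < m1%:R :> R by rewrite ltr0n.
set x := xi X white g m1; set S := psum x m1 w; set ss := \sum_(k < m1) _.
have sV0 := cond_sd_gt0 m1n sg0; have sM0 := sqrt_m1_gt0 R m10; have sM2' := sqrt_m1_sqr R m1.
set s := cond_sd n g m1 in sV0; set sm := sqrt_m1 R m1 in sM0 sM2' *.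
have fE (i : 'I_n) : f_cov m1 (Xw w) (X i w) = sm * s * x i w + cond_mean X white g m1 w.
  by rewrite f_covE /x xiE [RHS]addrC mulrC divfK 1?addrC// mulf_neq0 ?gt_eqF.
have bar : fbar_cov m1 (Xw w) = sm * s * S / m1%:R + cond_mean X white g m1 w.
  rewrite /fbar_cov (eq_bigr _ (fun i _ => fE i)).
  rewrite -(sum_ord_lt (fun j => sm * s * x j w + cond_mean X white g m1 w) (ltnW m1n)).
  rewrite big_split /= -mulr_sumr sumr_const card_ord -[cond_mean _ _ _ _ _ *+ _]mulr_natr.
  rewrite -[\sum_(i < m1) x i w]/S; move: (cond_mean _ _ _ _ _) => u.
  by field; rewrite gt_eqF.
have var : m1%:R^-1 * \sum_(i < n | (i < m1)%N)
    (f_cov m1 (Xw w) (X i w) - fbar_cov m1 (Xw w)) ^+ 2 = s ^+ 2 * (ss - (S / sm) ^+ 2).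
  rewrite (eq_bigr (fun i : 'I_n => (sm * s * x i w - sm * s * S / m1%:R) ^+ 2)); last first.
    by move=> i _; rewrite fE bar opprD addrACA subrr addr0.
  rewrite -(sum_ord_lt (fun j => (sm * s * x j w - sm * s * S / m1%:R) ^+ 2) (ltnW m1n)).
  rewrite (eq_bigr (fun k : 'I_m1 => sm ^+ 2 * s ^+ 2 * x k w ^+ 2 -
     2 * sm ^+ 2 * s ^+ 2 * S / m1%:R * x k w + sm ^+ 2 * s ^+ 2 * S ^+ 2 / m1%:R ^+ 2)); last first.
    by move=> k _; field; rewrite gt_eqF.
  rewrite big_split /= sumrB sumr_const card_ord -[(_ / _) *+ _]mulr_natr -!mulr_sumr -/ss.
  rewrite -[\sum_(i < m1) x i w]/S exprMn exprVn sM2'.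
  by field; rewrite gt_eqF.
rewrite /T_cov var bar -/(sqrt_m1 R m1) -/sm sqrtrM ?sqr_ge0// sqrtr_sqr gtr0_norm//.
rewrite invfM mulrA; congr (_ * _).
rewrite /drift -/s -/sm -sM2'; move: (cond_mean _ _ _ _ _) => u; field; by rewrite !gt_eqF.
Qed.

Lemma power_covE (alpha : R) :
  mom P (psum (xi X white g m1) m1) -> mom P (drift X white g m1) ->
  mom P (fun w => \sum_(k < m1) xi X white g m1 k w ^+ 2) ->
  power_cov alpha m1 X = fine (P (student_event (psum (xi X white g m1) m1)
     (drift X white g m1) (fun w => \sum_(k < m1) xi X white g m1 k w ^+ 2)
     (fun w => psum (xi X white g m1) m1 w / sqrt_m1 R m1) (normal_quantile (1 - alpha)))).
Proof.
move=> mS mD mss.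
have mq : mom P (fun w => psum (xi X white g m1) m1 w / sqrt_m1 R m1) by mom_tac.
set E := student_event _ _ _ _ _.
have mE : measurable E by exact: (measurable_student _ mS mD mss mq).
rewrite -Ex_indic// /power_cov /Ex /Rintegral expectation.unlock; congr fine.
apply: eq_integral => w _; congr EFin.
rewrite /phi_cov T_covE indicE; congr (_%:R); congr nat_of_bool.
by apply/idP/idP => [h|]; [rewrite inE|rewrite inE].
Qed.

End reduction.

(** * The power of the covariance test *)

Section main.
Context (R : realType).
Notation Phi := (@normal_cdf R).
Notation q := (@normal_quantile R).

Lemma tr_bounds (d : nat) (S : 'M[R]_d) (lo hi : R) : S^T = S -> 0 < lo ->
  (forall l, eigenvalue S l -> lo <= l <= hi) ->
  lo ^+ 2 * d%:R <= \tr (S *m S) <= hi ^+ 2 * d%:R.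
Proof.
move=> sS lo0 hl; have [L [M [g [hg ML LM LL LtL]]]] := whitening sS lo0 hl.
rewrite (tr_SigmaSigma LL LtL) /gsq.
have cs (x : R) : x * d%:R = \sum_(a < d) x by rewrite sumr_const card_ord mulr_natr.
rewrite !cs; apply/andP; split; apply: ler_sum => a _; have /andP[h1 h2] := hg a.
  by apply: lerXn2r; rewrite ?nnegrE ?(ltW lo0) ?(le_trans (ltW lo0) h1).
apply: lerXn2r; rewrite ?nnegrE ?(le_trans (ltW lo0) h1)//.
by rewrite (le_trans (ltW lo0))// (le_trans h1).
Qed.

(** [power_whitened] in terms of Sigma, with z_(1-alpha) = - z_alpha. *)
Lemma power_uniform (alpha lo hi c K r : R) : 0 < alpha < 1 -> 0 < lo -> 0 < hi ->
  0 < c -> 0 <= K -> 0 < r ->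
  exists s0 : R, forall (disp : measure_display) (Omega : measurableType disp)
    (pr : probability Omega R) (n d m1 : nat) (Q : probability (borel_cV R d) R)
    (X : 'I_n -> {RV pr >-> borel_cV R d}) (Sigma : 'M[R]_d),
  iid_from X Q -> is_normal_law Q 0 Sigma ->
  (forall l, eigenvalue Sigma l -> lo <= l <= hi) -> (0 < m1 < n)%N ->
  s0 <= \tr (Sigma *m Sigma) -> n%:R <= c * \tr (Sigma *m Sigma) ->
  \tr (Sigma *m Sigma) <= c * m1%:R -> frobenius_norm (Sigma - 1%:M) ^+ 2 <= K ->
  `|power_cov alpha m1 X - Phi (q alpha + Num.sqrt (m1%:R * (n - m1)%:R) *
      frobenius_norm (Sigma - 1%:M) ^+ 2 / (Num.sqrt 2 * \tr (Sigma *m Sigma)))| <= r.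
Proof.
move=> ha lo0 hi0 c0 K0 r0.
have [s0 hs0] := power_whitened (q (1 - alpha)) hi0 c0 K0 r0.
exists s0 => disp Omega pr n d m1 Q X Sigma hX hN hl hm hs hn hsm hF.
have sS : Sigma^T = Sigma by case: hN.
have /andP[m10 m1n] := hm.
have [L [M [g [hg ML LM LL LtL]]]] := whitening sS lo0 hl.
have trE := tr_SigmaSigma LL LtL.
have frE := frobenius_Sigma LL LtL.
rewrite trE frE in hs hn hsm hF *.
have g0 a : 0 < g a <= hi.
  by have /andP[h1 ->] := hg a; rewrite (lt_le_trans lo0 h1).
have sg0 : 0 < gsq g.
  rewrite -(pmulr_rgt0 _ c0) (lt_le_trans _ hn)// ltr0n.
  exact: leq_ltn_trans m1n.
have hz := std_gauss_white ML LL hN.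
have hS := mdiff_xi hX hz m1n sg0 m10.
have mS : mom pr (psum (xi X (white M) g m1) m1) by exact: mom_psum hS (leqnn _).
have mD := mom_drift hX hz g m1.
have mss : mom pr (fun w => \sum_(k < m1) xi X (white M) g m1 k w ^+ 2).
  by apply: mom_sum => k _; apply: momX; exact: (mdiff_mom hS).
rewrite (power_covE LM LtL m1n m10 sg0 _ mS mD mss).
have := hs0 _ _ _ _ _ _ _ _ _ _ _ _ hX hz hm g0 hs hn hsm hF.
rewrite normal_quantile1B// opprK.
suff -> : drift_lim n g m1 = Num.sqrt (m1%:R * (n - m1)%:R) * gdev g / (Num.sqrt 2 * gsq g).
  by rewrite [q alpha + _]addrC.
have m20 : 0 < m2 R n m1 by exact: m2_gt0.
have sq1 : 0 <= 2 * gsq g ^+ 2 by rewrite mulr_ge0 ?sqr_ge0.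
have e1 : Num.sqrt (2 * gsq g ^+ 2 / m2 R n m1) = Num.sqrt 2 * gsq g / Num.sqrt (m2 R n m1).
  by rewrite sqrtrM// sqrtrM// sqrtr_sqr gtr0_norm// sqrtrV ?ltW.
rewrite /drift_lim /cond_sd /cond_var /sqrt_m1 e1 -/(m2 R n m1) sqrtrM//.
by field; rewrite !gt_eqF// sqrtr_gt0.
Qed.

Context (alpha : R) (halpha : 0 < alpha < 1)
  (disp : nat -> measure_display)
  (Omega : forall n : nat, measurableType (disp n))
  (pr : forall n : nat, probability (Omega n) R)
  (d : nat -> nat)
  (P : forall n : nat, probability (borel_cV R (d n)) R)
  (X : forall n : nat, 'I_n -> {RV (pr n) >-> borel_cV R (d n)})
  (hX : forall n : nat, (1 < n)%N -> iid_from (X n) (P n))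
  (Sigma : forall n : nat, 'M[R]_(d n))
  (hP : forall n : nat, (1 < n)%N -> is_normal_law (P n) 0 (Sigma n))
  (lambda_lo lambda_hi : R) (hlo : 0 < lambda_lo) (hhi : 0 < lambda_hi)
  (hSigma : forall n : nat, (1 < n)%N -> forall l : R,
     eigenvalue (Sigma n) l -> lambda_lo <= l <= lambda_hi)
  (tau : R) (htau : 0 < tau)
  (hd : (d n)%:R / n%:R @[n --> \oo] --> tau)
  (hO : (fun n : nat => frobenius_norm (Sigma n - 1%:M) : R) =O_\oo
        (fun n : nat => Num.sqrt ((d n)%:R / n%:R) : R)).

(** The argument of Phi in the limit, apart from z_alpha. *)
Definition shift (kappa : R) (n : nat) : R :=
  n%:R * Num.sqrt (kappa * (1 - kappa)) * frobenius_norm (Sigma n - 1%:M) ^+ 2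
   / (Num.sqrt 2 * \tr (Sigma n *m Sigma n)).

Lemma near_bounds (u : nat -> R) (l : R) : 0 < l -> u n @[n --> \oo] --> l ->
  \forall n \near \oo, l / 2 <= u n <= 2 * l.
Proof.
move=> l0 hu.
have l2 : 0 < l / 2 by rewrite divr_gt0.
have /cvgrPdist_le/(_ _ l2) := hu; apply: filterS => n.
by rewrite ler_norml => /andP[h1 h2]; apply/andP; split; lra.
Qed.

(** The sizes needed by [power_uniform] hold for large n: tr (Sigma^2) is
    comparable to d, hence to n and to m1.  Then sqrt (m1 m2) / n tends to
    sqrt (kappa (1 - kappa)), and the factor it multiplies stays bounded. *)
Lemma power_limit (m1 : nat -> nat) (kappa : R) : 0 < kappa < 1 ->
  split_ratio m1 kappa -> forall e : R, 0 < e ->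
  \forall n \near \oo,
    `|power_cov alpha (m1 n) (@X n) - Phi (q alpha + shift kappa n)| <= e.
Proof.
move=> /andP[k0 k1] [hm hk] e e0.
have /eqO_exP[C /= C0 hC] := hO.
pose K := C ^+ 2 * (2 * tau).
have K0 : 0 <= K by rewrite mulr_ge0 ?sqr_ge0// mulr_ge0 ?ltW.
pose c := 2 / (lambda_lo ^+ 2 * tau) + 4 * lambda_hi ^+ 2 * tau / kappa.
have ca : 0 < 2 / (lambda_lo ^+ 2 * tau) by rewrite divr_gt0// mulr_gt0 ?exprn_gt0.
have cb : 0 < 4 * lambda_hi ^+ 2 * tau / kappa.
  by rewrite divr_gt0// mulr_gt0// mulr_gt0// exprn_gt0.
have c0 : 0 < c by exact: addr_gt0.
have e20 : 0 < e / 2 by rewrite divr_gt0.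
have [s0 hs0] := power_uniform halpha hlo hhi c0 K0 e20.
pose pk : R := normal_peak 1.
have pk0 : 0 < pk by rewrite normal_peak_gt0// oner_eq0.
pose t := e / 2 / (pk * (c * K + 1)).
have cK0 : 0 <= c * K by rewrite mulr_ge0// ltW.
have cK1 : 0 < c * K + 1 by rewrite ltr_wpDl.
have t0 : 0 < t by rewrite divr_gt0// mulr_gt0.
have hsq : Num.sqrt ((m1 n)%:R / n%:R * (1 - (m1 n)%:R / n%:R)) @[n --> \oo]
    --> Num.sqrt (kappa * (1 - kappa)).
  apply: continuous_cvg; first exact: sqrt_continuous.
  by apply: cvgM => //; apply: cvgB => //; exact: cvg_cst.
have nn : \forall n \near \oo, c * s0 <= n%:R :> R by exact: nbhs_infty_ger.
have n2 : \forall n \near \oo, (1 < n)%N by exact: nbhs_infty_gt.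
have /cvgrPdist_le/(_ _ t0) hsq' := hsq.
have hd' := near_bounds htau hd.
have hk' := near_bounds k0 hk.
near=> n.
have n1 : (1 < n)%N by near: n.
have n0 : 0 < n%:R :> R by rewrite ltr0n ltnW.
have sS : (Sigma n)^T = Sigma n by case: (hP n1).
have := tr_bounds sS hlo (hSigma n1); set tr := \tr _ => /andP[t1 t2].
have /andP[d1 d2] : tau / 2 <= (d n)%:R / n%:R <= 2 * tau by near: n.
have /andP[kk1 _] : kappa / 2 <= (m1 n)%:R / n%:R <= 2 * kappa by near: n.
have b1 : n%:R <= c * tr.
  apply: (@le_trans _ _ (2 / (lambda_lo ^+ 2 * tau) * tr)); last first.
    rewrite ler_wpM2r//; last by rewrite lerDl ltW.
    by apply: le_trans t1; rewrite mulr_ge0 ?sqr_ge0.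
  apply: (@le_trans _ _ (2 / (lambda_lo ^+ 2 * tau) * (lambda_lo ^+ 2 * (d n)%:R))); last first.
    by rewrite ler_wpM2l// ltW.
  have -> : 2 / (lambda_lo ^+ 2 * tau) * (lambda_lo ^+ 2 * (d n)%:R) = 2 / tau * (d n)%:R.
    by field; rewrite !gt_eqF.
  move: d1; rewrite ler_pdivlMr// => d1.
  apply: (@le_trans _ _ (2 / tau * (tau / 2 * n%:R))); last by rewrite ler_wpM2l// divr_ge0// ltW.
  by rewrite le_eqVlt; apply/orP; left; apply/eqP; field; rewrite gt_eqF.
have b2 : tr <= c * (m1 n)%:R.
  apply: (le_trans t2).
  apply: (@le_trans _ _ (4 * lambda_hi ^+ 2 * tau / kappa * (m1 n)%:R)); last first.
    by rewrite ler_wpM2r// lerDr ltW.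
  move: d2 kk1; rewrite ler_pdivrMr// ler_pdivlMr// => d2 kk1.
  apply: (@le_trans _ _ (lambda_hi ^+ 2 * (2 * tau * n%:R))); first by rewrite ler_wpM2l ?sqr_ge0.
  apply: (@le_trans _ _ (4 * lambda_hi ^+ 2 * tau / kappa * (kappa / 2 * n%:R))); last first.
    by rewrite ler_wpM2l// ltW.
  by rewrite le_eqVlt; apply/orP; left; apply/eqP; field; rewrite gt_eqF.
have b3 : s0 <= tr.
  rewrite -(ler_pM2l c0); apply: le_trans b1; near: n; exact: nn.
have b4 : frobenius_norm (Sigma n - 1%:M) ^+ 2 <= K.
  have h : `|frobenius_norm (Sigma n - 1%:M)| <= C * `|Num.sqrt ((d n)%:R / n%:R)|.
    by near: n; exact: hC.
  move: h; rewrite [X in _ <= C * X]ger0_norm// => h.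
  rewrite -[_ ^+ 2]real_normK ?num_real//.
  apply: (@le_trans _ _ ((C * Num.sqrt ((d n)%:R / n%:R)) ^+ 2)).
    by apply: lerXn2r; rewrite ?nnegrE// mulr_ge0// ltW.
  by rewrite exprMn sqr_sqrtr ?divr_ge0 ?(ltW n0)// ler_wpM2l ?sqr_ge0.
have mn := hm n n1; have /andP[_ m1n] := mn.
have := hs0 _ _ _ _ _ _ _ _ _ (hX n1) (hP n1) (hSigma n1) mn b3 b1 b2 b4.
set F := frobenius_norm _ ^+ 2 in b4 *; set pw := power_cov _ _ _ => hpw.
have F0 : 0 <= F by exact: sqr_ge0.
have tr0 : 0 < tr by rewrite -(pmulr_rgt0 _ c0) (lt_le_trans n0).
set x := _ * F / _ in hpw.
have hx : `|x - shift kappa n| <= c * K * t.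
  have sn : Num.sqrt ((m1 n)%:R * (n - m1 n)%:R) =
      n%:R * Num.sqrt ((m1 n)%:R / n%:R * (1 - (m1 n)%:R / n%:R)) :> R.
    rewrite -{1}[n%:R]gtr0_norm// -sqrtr_sqr -sqrtrM ?sqr_ge0//; congr Num.sqrt.
    rewrite natrB 1?ltnW//; field; by rewrite gt_eqF.
  have s20 : 0 < Num.sqrt 2 :> R by rewrite sqrtr_gt0.
  have -> : x - shift kappa n = n%:R / tr * F / Num.sqrt 2 *
     (Num.sqrt ((m1 n)%:R / n%:R * (1 - (m1 n)%:R / n%:R)) - Num.sqrt (kappa * (1 - kappa))).
    rewrite /x /shift sn -/F -/tr; field; by rewrite !gt_eqF.
  rewrite normrM; apply: ler_pM => //; last first.
    by rewrite distrC; near: n; exact: hsq'.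
  rewrite ger0_norm; last first.
    by apply: divr_ge0; [apply: mulr_ge0 => //; rewrite divr_ge0// ltW|exact: ltW].
  rewrite ler_pdivrMr//; apply: (@le_trans _ _ (c * K)).
    by apply: ler_pM => //; rewrite ?divr_ge0 ?(ltW tr0)// ler_pdivrMr.
  rewrite ler_peMr// -[leLHS]sqrtr1 ler_wsqrtr// ler1n//.
have hl : `|Phi (q alpha + x) - Phi (q alpha + shift kappa n)| <= e / 2.
  apply: (le_trans (cdf_lip _ _)); rewrite -/pk opprD addrACA subrr add0r.
  apply: (@le_trans _ _ (pk * (c * K * t))); first by rewrite ler_wpM2l// ltW.
  have -> : e / 2 = pk * ((c * K + 1) * t) by rewrite /t; field; rewrite !gt_eqF.
  by rewrite ler_wpM2l ?(ltW pk0)// ler_wpM2r ?(ltW t0)// lerDl.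
rewrite -(subrKA (Phi (q alpha + x))).
apply: (le_trans (ler_normD _ _)).
by rewrite [leRHS](_ : e = e / 2 + e / 2) ?lerD//; field.
Unshelve. all: by end_near.
Qed.

(** 1/4 - kappa (1 - kappa) = (kappa - 1/2)^2. *)
Lemma shift_le_half (kappa : R) (n : nat) : (1 < n)%N -> shift kappa n <= shift (1 / 2) n.
Proof.
move=> n1; have sS : (Sigma n)^T = Sigma n by case: (hP n1).
have /andP[t1 _] := tr_bounds sS hlo (hSigma n1).
have tr0 : 0 <= \tr (Sigma n *m Sigma n).
  by apply: le_trans t1; rewrite mulr_ge0 ?sqr_ge0.
rewrite /shift ler_wpM2r ?invr_ge0 ?mulr_ge0// ler_wpM2r ?sqr_ge0//.
rewrite ler_wpM2l// ler_wsqrtr//.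
by have := sqr_ge0 (kappa - 1 / 2); move=> h; rewrite -subr_ge0 (_ : _ - _ = (kappa - 1 / 2) ^+ 2)//; field.
Qed.

End main.

Theorem theorem3p2 (R : realType) (alpha : R) (halpha : 0 < alpha < 1)
  (disp : nat -> measure_display)
  (Omega : forall n : nat, measurableType (disp n))
  (pr : forall n : nat, probability (Omega n) R)
  (d : nat -> nat)
  (P : forall n : nat, probability (borel_cV R (d n)) R)
  (X : forall n : nat, 'I_n -> {RV (pr n) >-> borel_cV R (d n)})
  (hX : forall n : nat, (1 < n)%N -> iid_from (X n) (P n))
  (Sigma : forall n : nat, 'M[R]_(d n))
  (hP : forall n : nat, (1 < n)%N -> is_normal_law (P n) 0 (Sigma n))
  (lambda_lo lambda_hi : R) (hlo : 0 < lambda_lo) (hhi : 0 < lambda_hi)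
  (hSigma : forall n : nat, (1 < n)%N -> forall l : R,
     eigenvalue (Sigma n) l -> lambda_lo <= l <= lambda_hi)
  (tau : R) (htau : 0 < tau)
  (hd : (d n)%:R / n%:R @[n --> \oo] --> tau)
  (hO : (fun n : nat => frobenius_norm (Sigma n - 1%:M) : R) =O_\oo
        (fun n : nat => Num.sqrt ((d n)%:R / n%:R) : R))
  (m1 : nat -> nat) (kappa : R) (hkappa : 0 < kappa < 1)
  (hm1 : split_ratio m1 kappa) :
  (power_cov alpha (m1 n) (X n)
     - normal_cdf (normal_quantile alpha
         + n%:R * Num.sqrt (kappa * (1 - kappa))
             * frobenius_norm (Sigma n - 1%:M) ^+ 2
           / (Num.sqrt 2 * \tr (Sigma n *m Sigma n))) @[n --> \oo] --> (0 : R))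
  /\
  (forall m1' : nat -> nat, split_ratio m1' (1 / 2 : R) ->
     forall e : R, 0 < e ->
       \forall n \near \oo,
         power_cov alpha (m1 n) (X n) <= power_cov alpha (m1' n) (X n) + e).
Proof.
have lim m k := @power_limit R alpha halpha disp Omega pr d P X hX Sigma hP
  _ _ hlo hhi hSigma tau htau hd hO m k.
split.
  apply/cvgr0Pnorm_le => e e0; exact: lim hkappa hm1 e e0.
move=> m1' hm1' e e0; have e20 : 0 < e / 2 by rewrite divr_gt0.
have hk : 0 < (1 / 2 : R) < 1 by apply/andP; split; lra.
have n2 : \forall n \near \oo, (1 < n)%N by exact: nbhs_infty_gt.
have lim1 := lim _ _ hkappa hm1 _ e20; have lim2 := lim _ _ hk hm1' _ e20.
move: lim1 lim2 n2; apply: filterS3 => n; move=> h1 h2 n1; move: h1 h2.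
have := shift_le_half hP hlo hSigma kappa n1.
rewrite -(lerD2l (normal_quantile alpha)) => /cdf_le.
move: (power_cov _ _ _) (power_cov _ _ _) (normal_cdf _) (normal_cdf _) => p1 p2 f1 f2 f12.
by rewrite !ler_norml => /andP[h1 h2] /andP[h3 h4]; lra.
Qed.
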